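(* Let $\Sigma$ be either the complex plane $\mathbb{C}$ or the open unit disk $\mathbb{D}=\{z\in\mathbb{C} : |z|<1\}$. Let $X=(X_1,X_2,X_3):\Sigma\to\mathbb{R}^3$ be a conformal minimal immersion with $X_3$ non-constant. Let $K\subset\Sigma$ be a compact set and let $\varepsilon>0$. Then there exists a complete conformal minimal immersion $Y=(Y_1,Y_2,Y_3):\Sigma\to\mathbb{R}^3$ such that (a) $\|X-Y\|<\varepsilon$ on $K$, and (b) $X_3=Y_3$ on $\Sigma$.
   Context: A conformal minimal immersion $X:\Sigma\to\mathbb{R}^3$ is a conformal immersion whose coordinate functions are harmonic. It is complete if the Riemannian metric it induces on $\Sigma$ is complete, i.e. every divergent curve in $\Sigma$ has infinite length with respect to the induced metric. $\|\cdot\|$ denotes the Euclidean norm in $\mathbb{R}^3$. *)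

(* Defs.v *)
From Stdlib Require Import Reals Lra List.
From Coquelicot Require Import Coquelicot.
Open Scope R_scope.

Definition R3 : Type := (R * R * R)%type.
Definition x1 (p : R3) : R := fst (fst p).
Definition x2 (p : R3) : R := snd (fst p).
Definition x3 (p : R3) : R := snd p.
Definition norm3 (p : R3) : R := sqrt (x1 p ^ 2 + x2 p ^ 2 + x3 p ^ 2).
Definition sub3 (p q : R3) : R3 := ((x1 p - x1 q, x2 p - x2 q), x3 p - x3 q).
Definition dot3 (p q : R3) : R := x1 p * x1 q + x2 p * x2 q + x3 p * x3 q.

Inductive sdomain := Plane | Disk.
Definition in_dom (D : sdomain) (z : C) : Prop :=
  match D with Plane => True | Disk => Cmod z < 1 end.

Definition pu (g : C -> R) (z : C) : R := Derive (fun t => g (t, snd z)) (fst z).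
Definition pv (g : C -> R) (z : C) : R := Derive (fun t => g (fst z, t)) (snd z).

Definition C1_on (S : C -> Prop) (g : C -> R) : Prop :=
  forall z, S z ->
    ex_derive (fun t => g (t, snd z)) (fst z) /\
    ex_derive (fun t => g (fst z, t)) (snd z) /\
    continuous g z /\ continuous (pu g) z /\ continuous (pv g) z.

Definition C2_on (S : C -> Prop) (g : C -> R) : Prop :=
  C1_on S g /\ C1_on S (pu g) /\ C1_on S (pv g).

Definition harmonic_on (S : C -> Prop) (g : C -> R) : Prop :=
  C2_on S g /\ forall z, S z -> pu (pu g) z + pv (pv g) z = 0.

Definition Xu (X : C -> R3) (z : C) : R3 :=
  ((pu (fun w => x1 (X w)) z, pu (fun w => x2 (X w)) z), pu (fun w => x3 (X w)) z).
Definition Xv (X : C -> R3) (z : C) : R3 :=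
  ((pv (fun w => x1 (X w)) z, pv (fun w => x2 (X w)) z), pv (fun w => x3 (X w)) z).

Definition conformal_immersion (S : C -> Prop) (X : C -> R3) : Prop :=
  C1_on S (fun w => x1 (X w)) /\ C1_on S (fun w => x2 (X w)) /\
  C1_on S (fun w => x3 (X w)) /\
  forall z, S z ->
    dot3 (Xu X z) (Xu X z) = dot3 (Xv X z) (Xv X z) /\
    dot3 (Xu X z) (Xv X z) = 0 /\
    0 < norm3 (Xu X z).

Definition conformal_minimal_immersion (S : C -> Prop) (X : C -> R3) : Prop :=
  conformal_immersion S X /\
  harmonic_on S (fun w => x1 (X w)) /\ harmonic_on S (fun w => x2 (X w)) /\
  harmonic_on S (fun w => x3 (X w)).

Definition compact_set (K : C -> Prop) : Prop :=
  forall (I : Type) (U : I -> C -> Prop),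
    (forall i, open (U i)) -> (forall z, K z -> exists i, U i z) ->
    exists l : list I, forall z, K z -> exists i, In i l /\ U i z.

Definition divergent_curve (S : C -> Prop) (gamma : R -> C) : Prop :=
  (forall t, 0 <= t < 1 -> S (gamma t) /\ continuous gamma t) /\
  forall K : C -> Prop, compact_set K -> (forall z, K z -> S z) ->
    exists t0, t0 < 1 /\ forall t, t0 <= t < 1 -> ~ K (gamma t).

Fixpoint poly_len (c : R -> R3) (t0 : R) (l : list R) : R :=
  match l with
  | nil => 0
  | t1 :: l' => norm3 (sub3 (c t1) (c t0)) + poly_len c t1 l'
  end.
Fixpoint increasing_from (t0 : R) (l : list R) : Prop :=
  match l with
  | nil => True
  | t1 :: l' => t0 <= t1 /\ increasing_from t1 l'
  end.
Definition infinite_length (c : R -> R3) : Prop :=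
  forall M : R, exists (t0 : R) (l : list R),
    0 <= t0 /\ increasing_from t0 l /\ List.Forall (fun t : R => t < 1) l /\
    M < poly_len c t0 l.

(** Completeness of the induced metric: every divergent curve has infinite length. *)
Definition complete_on (S : C -> Prop) (X : C -> R3) : Prop :=
  forall gamma, divergent_curve S gamma -> infinite_length (fun t => X (gamma t)).

(* Main.v *)
Require Import Defs.
From Stdlib Require Import Reals Lra Lia List Wf_nat Classical ClassicalEpsilon.
From Coquelicot Require Import Coquelicot.
Open Scope R_scope.

(** Write [phi_j = d/du X_j - i d/dv X_j], [A = phi_1 - i phi_2], [B = phi_1 + i phi_2]; then
    [A B = - phi_3^2] and the conformal factor of [X] is [(|A| + |B|) / 2].  For a holomorphic [H]
    the data [(A e^H, B e^-H, phi_3)] define another conformal minimal immersion [Y] with the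
    same third coordinate (there are no periods on a simply connected domain), close to [X]
    wherever [H] is small.

    [H] is a sum of entire functions, one batch for each of a sequence of annuli exhausting the
    domain on which [phi_3] has no zero (its zeros are isolated).  In each annulus [Re H] is made
    huge on many concentric slit rings, whose gaps lie alternately on the right and on the left;
    this is possible by moving poles through the gaps, as in Runge's theorem.  A path that
    crosses a ring off its gap is long because [|A e^H|] is huge there, and a path that uses all
    the gaps travels a long way in a region where the conformal factor is at least
    [sqrt (|A| |B|) = |phi_3|].  Quantitatively, a potential growing by a prescribed amount across
    the annulus is locally 1-Lipschitz for the metric of [Y]; this bounds from below the length
    of inscribed polygons, so rectifiability never enters. *)

(** The obstacle is that making [Re H] huge on the rings gives no control of [H] in the corridors
    between them. There the only lower bound for the conformal factor that is uniform in [H] is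
    [|phi_3|], so each annulus is first shrunk to one free of zeros of [phi_3]. That bound may be
    tiny, but it is known before the labyrinth is built: passing from one gap to the next costs a
    horizontal displacement of at least [2 * c] with [c] fixed once for all, and the number of rings
    is chosen afterwards. Only then are the width of the rings and the Lipschitz constant of the
    potential on them known, and only after these the height of [Re H]. Each stage proves its
    crossing estimate for every exponent at distance at most 1 from the current partial sum; the
    later terms are geometrically small and cannot destroy it. Cauchy's formula enters only through
    the isolation of the zeros of [phi_3]. *)

(** * Modulus estimates, neighbourhoods and continuity in the complex plane *)

Lemma Im_le_Cmod (z : C) : Rabs (Im z) <= Cmod z.
Proof. eapply Rle_trans; [apply Rmax_r | apply (Rmax_Cmod z)]. Qed.

Lemma Cmod_le_Re_Im (z : C) : Cmod z <= Rabs (Re z) + Rabs (Im z).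
Proof.
  generalize (Rabs_pos (Re z)) (Rabs_pos (Im z)) (Cmod_ge_0 z); intros Ha Hb Hc.
  apply Rsqr_incr_0_var; [|lra].
  unfold Rsqr.
  generalize (Cmod2_alt z) (pow2_abs (Re z)) (pow2_abs (Im z)); simpl; nra.
Qed.

Lemma Cmod_minus_sym (x y : C) : Cmod (x - y) = Cmod (y - x).
Proof. rewrite <- Cmod_opp; f_equal; ring. Qed.

Lemma Cmod_triangle_minus (x y : C) : Cmod (x - y) <= Cmod x + Cmod y.
Proof. unfold Cminus; rewrite <- (Cmod_opp y); apply Cmod_triangle. Qed.

Lemma Cmod_triangle_rev (x y : C) : Cmod x - Cmod y <= Cmod (x - y).
Proof.
  generalize (Cmod_triangle (x - y) y).
  replace (x - y + y)%C with x by ring; lra.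
Qed.

Lemma Cmod_triangle_rev' (x y : C) : Cmod x <= Cmod y + Cmod (x - y).
Proof. generalize (Cmod_triangle_rev x y); lra. Qed.

Lemma Cmod_R_pos (x : R) : 0 <= x -> Cmod x = x.
Proof. intros; rewrite Cmod_R; apply Rabs_pos_eq; assumption. Qed.

Lemma C_nonzero_of_Cmod (z : C) : 0 < Cmod z -> z <> 0.
Proof. apply Cmod_gt_0. Qed.

Lemma C_ext (z w : C) : Re z = Re w -> Im z = Im w -> z = w.
Proof. destruct z, w; simpl; intros; subst; reflexivity. Qed.

Lemma locally_Cmod (z : C) (P : C -> Prop) :
  locally z P <-> exists eta, 0 < eta /\ forall w, Cmod (w - z) < eta -> P w.
Proof.
  split.
  - intros [e He]; exists e; split; [apply cond_pos|]; intros w Hw; apply He.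
    split; unfold ball; simpl; unfold AbsRing_ball, abs, minus, plus, opp; simpl.
    + generalize (re_le_Cmod (w - z)); unfold Re; simpl; unfold Rminus; lra.
    + generalize (Im_le_Cmod (w - z)); unfold Im; simpl; unfold Rminus; lra.
  - intros [eta [He H]].
    assert (He2 : 0 < eta / 2) by lra.
    exists (mkposreal _ He2); intros w [H1 H2]; apply H.
    unfold ball in H1, H2; simpl in H1, H2;
    unfold AbsRing_ball, abs, minus, plus, opp in H1, H2; simpl in H1, H2.
    generalize (Cmod_le_Re_Im (w - z)); unfold Re, Im; simpl; unfold Rminus; lra.
Qed.

Lemma continuous_Re_Im {U : UniformSpace} (f : U -> C) (x : U) :
  continuous (fun y => Re (f y)) x -> continuous (fun y => Im (f y)) x ->
  continuous f x.
Proof.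
  intros H1 H2.
  apply (continuous_ext (fun y => (Re (f y), Im (f y)))).
  - intros y; destruct (f y); reflexivity.
  - apply (continuous_comp_2 (fun y => Re (f y)) (fun y => Im (f y)) (fun a b => (a, b)));
      trivial.
    apply (continuous_ext (fun p : R * R => p)).
    + intros [a b]; reflexivity.
    + apply continuous_id.
Qed.

Lemma continuous_Re {U : UniformSpace} (f : U -> C) (x : U) :
  continuous f x -> continuous (fun y => Re (f y)) x.
Proof. intros H; apply (continuous_comp f (fun z : C => Re z)); trivial. apply continuous_fst. Qed.

Lemma continuous_Im {U : UniformSpace} (f : U -> C) (x : U) :
  continuous f x -> continuous (fun y => Im (f y)) x.
Proof. intros H; apply (continuous_comp f (fun z : C => Im z)); trivial. apply continuous_snd. Qed.

Lemma continuous_Rplus {U : UniformSpace} (f g : U -> R) x :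
  continuous f x -> continuous g x -> continuous (fun y => f y + g y) x.
Proof. intros; apply (continuous_plus f g); assumption. Qed.
Lemma continuous_Rminus {U : UniformSpace} (f g : U -> R) x :
  continuous f x -> continuous g x -> continuous (fun y => f y - g y) x.
Proof. intros; apply (continuous_minus f g); assumption. Qed.
Lemma continuous_Ropp {U : UniformSpace} (f : U -> R) x :
  continuous f x -> continuous (fun y => - f y) x.
Proof. intros; apply (continuous_opp f); assumption. Qed.
Lemma continuous_Rmult {U : UniformSpace} (f g : U -> R) x :
  continuous f x -> continuous g x -> continuous (fun y => f y * g y) x.
Proof. intros; apply (continuous_mult f g); assumption. Qed.

Lemma continuous_Cplus {U : UniformSpace} (f g : U -> C) x :
  continuous f x -> continuous g x -> continuous (fun y => (f y + g y)%C) x.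
Proof.
  intros Hf Hg; apply continuous_Re_Im.
  - apply (continuous_Rplus (fun y => Re (f y)) (fun y => Re (g y))); apply continuous_Re; assumption.
  - apply (continuous_Rplus (fun y => Im (f y)) (fun y => Im (g y))); apply continuous_Im; assumption.
Qed.
Lemma continuous_Copp {U : UniformSpace} (f : U -> C) x :
  continuous f x -> continuous (fun y => (- f y)%C) x.
Proof.
  intros Hf; apply continuous_Re_Im.
  - apply (continuous_Ropp (fun y => Re (f y))), continuous_Re; assumption.
  - apply (continuous_Ropp (fun y => Im (f y))), continuous_Im; assumption.
Qed.
Lemma continuous_Cminus {U : UniformSpace} (f g : U -> C) x :
  continuous f x -> continuous g x -> continuous (fun y => (f y - g y)%C) x.
Proof. intros; apply continuous_Cplus; [|apply continuous_Copp]; assumption. Qed.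
Lemma continuous_Cmult {U : UniformSpace} (f g : U -> C) x :
  continuous f x -> continuous g x -> continuous (fun y => (f y * g y)%C) x.
Proof.
  intros Hf Hg.
  generalize (continuous_Re f x Hf) (continuous_Im f x Hf)
    (continuous_Re g x Hg) (continuous_Im g x Hg); intros.
  apply continuous_Re_Im.
  - apply (continuous_Rminus (fun y => Re (f y) * Re (g y)) (fun y => Im (f y) * Im (g y)));
      apply continuous_Rmult; assumption.
  - apply (continuous_Rplus (fun y => Re (f y) * Im (g y)) (fun y => Im (f y) * Re (g y)));
      apply continuous_Rmult; assumption.
Qed.
Lemma continuous_RtoC {U : UniformSpace} (f : U -> R) x :
  continuous f x -> continuous (fun y => RtoC (f y)) x.
Proof. intros H; apply continuous_Re_Im; simpl; trivial; apply continuous_const. Qed.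

Lemma continuous_C_eps (f : C -> C) (z : C) :
  continuous f z <->
  forall eps, 0 < eps -> exists eta, 0 < eta /\
    forall w, Cmod (w - z) < eta -> Cmod (f w - f z) < eps.
Proof.
  split.
  - intros H eps He.
    apply (locally_Cmod z (fun w => Cmod (f w - f z) < eps)).
    apply (H (fun y => Cmod (y - f z) < eps)).
    apply locally_Cmod; exists eps; split; trivial.
  - intros H P HP.
    apply locally_Cmod in HP; destruct HP as [e [He HP]].
    destruct (H e He) as [eta [Heta Hw]].
    apply locally_Cmod; exists eta; split; trivial; intros; apply HP, Hw; assumption.
Qed.

Lemma continuous_R_eps (f : C -> R) (z : C) :
  continuous f z <->
  forall eps, 0 < eps -> exists eta, 0 < eta /\
    forall w, Cmod (w - z) < eta -> Rabs (f w - f z) < eps.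
Proof.
  split.
  - intros H eps He.
    apply (locally_Cmod z (fun w => Rabs (f w - f z) < eps)).
    apply (H (fun y => Rabs (y - f z) < eps)).
    exists (mkposreal _ He); intros y Hy; apply Hy.
  - intros H P [e HP].
    destruct (H e (cond_pos e)) as [eta [Heta Hw]].
    apply locally_Cmod; exists eta; split; trivial; intros; apply HP, Hw; assumption.
Qed.

Lemma continuous_Cmod (z : C) : continuous Cmod z.
Proof.
  apply continuous_R_eps; intros eps He; exists eps; split; trivial; intros w Hw.
  apply Rle_lt_trans with (2 := Hw), Rabs_le.
  generalize (Cmod_triangle_rev w z) (Cmod_triangle_rev z w).
  rewrite (Cmod_minus_sym z w); lra.
Qed.

Lemma continuous_Cinv (z : C) : z <> 0 -> continuous Cinv z.
Proof.
  intros Hz; apply Cmod_gt_0 in Hz.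
  assert (Hn : Re z ^ 2 + Im z ^ 2 <> 0).
  { rewrite <- Cmod2_alt; apply pow_nonzero; lra. }
  assert (Hc : continuous (fun y : C => / (Re y ^ 2 + Im y ^ 2)) z).
  { apply (continuous_comp (fun y : C => Re y ^ 2 + Im y ^ 2) Rinv).
    - assert (Hsq : forall f : C -> R, continuous f z -> continuous (fun y => f y ^ 2) z).
      { intros f Hf; apply (continuous_comp f (fun r => r ^ 2)); trivial.
        apply (ex_derive_continuous (fun r : R => r ^ 2)); auto_derive; trivial. }
      apply (continuous_Rplus (fun y => Re y ^ 2) (fun y => Im y ^ 2)); apply Hsq;
        [apply continuous_fst|apply continuous_snd].
    - apply continuity_pt_filterlim.
      apply (continuity_pt_inv (fun x => x)); trivial.
      apply derivable_continuous_pt, derivable_pt_id. }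
  apply continuous_Re_Im.
  - apply (continuous_Rmult (fun y : C => Re y)); trivial; apply continuous_fst.
  - apply (continuous_Rmult (fun y : C => - Im y)); trivial.
    apply continuous_Ropp, continuous_snd.
Qed.

Lemma continuous_comp_Cinv {U : UniformSpace} (f : U -> C) x :
  f x <> 0 -> continuous f x -> continuous (fun y => (/ f y)%C) x.
Proof. intros; apply (continuous_comp f Cinv); trivial; apply continuous_Cinv; trivial. Qed.

(** * Differentiation *)

Definition D1 (f : R -> C) (t : R) (l : C) : Prop :=
  is_derive (fun s => Re (f s)) t (Re l) /\ is_derive (fun s => Im (f s)) t (Im l).

(* Strict complex differentiability: at every point of an open set it amounts to
   being holomorphic with continuous derivative. *)
Definition sd (F : C -> C) (z l : C) : Prop :=
  forall eps, 0 < eps -> exists eta, 0 < eta /\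
    forall w w', Cmod (w - z) < eta -> Cmod (w' - z) < eta ->
      Cmod (F w' - F w - l * (w' - w)) <= eps * Cmod (w' - w).

Lemma sd_ext_loc F G z l :
  (exists r, 0 < r /\ forall w, Cmod (w - z) < r -> F w = G w) -> sd F z l -> sd G z l.
Proof.
  intros [r [Hr HE]] H eps He; destruct (H eps He) as [eta [Heta Hw]].
  exists (Rmin r eta); split; [apply Rmin_pos; trivial|].
  intros w w' H1 H2.
  generalize (Rmin_l r eta) (Rmin_r r eta); intros.
  rewrite <- !HE by lra; apply Hw; lra.
Qed.

Lemma sd_ext F G z l : (forall w, F w = G w) -> sd F z l -> sd G z l.
Proof. intros H; apply sd_ext_loc; exists 1; split; [lra|auto]. Qed.

Lemma sd_eq F z l l' : sd F z l -> l = l' -> sd F z l'.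
Proof. intros H <-; exact H. Qed.

Lemma sd_lipschitz F z l : sd F z l ->
  exists eta, 0 < eta /\ forall w w', Cmod (w - z) < eta -> Cmod (w' - z) < eta ->
    Cmod (F w' - F w) <= (Cmod l + 1) * Cmod (w' - w).
Proof.
  intros H; destruct (H 1 Rlt_0_1) as [eta [He Hw]]; exists eta; split; trivial.
  intros w w' H1 H2; generalize (Hw w w' H1 H2).
  generalize (Cmod_triangle_rev' (F w' - F w) (l * (w' - w))).
  rewrite (Cmod_mult l); lra.
Qed.

Lemma Cmod_self (z : C) : Cmod (z - z) = 0.
Proof. replace (z - z)%C with (RtoC 0) by ring; apply Cmod_0. Qed.

Lemma sd_continuous F z l : sd F z l -> continuous F z.
Proof.
  intros H; apply continuous_C_eps; intros eps He.
  destruct (sd_lipschitz _ _ _ H) as [eta [Heta Hw]].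
  generalize (Cmod_ge_0 l); intros Hl.
  assert (Hp : 0 < eps / (Cmod l + 1)) by (apply Rdiv_lt_0_compat; lra).
  exists (Rmin eta (eps / (Cmod l + 1))); split; [apply Rmin_pos; trivial|].
  intros w Hd; generalize (Rmin_l eta (eps / (Cmod l + 1))) (Rmin_r eta (eps / (Cmod l + 1))).
  intros.
  eapply Rle_lt_trans; [apply (Hw z w); [rewrite Cmod_self|]; lra|].
  apply Rlt_le_trans with ((Cmod l + 1) * (eps / (Cmod l + 1))).
  - apply Rmult_lt_compat_l; lra.
  - right; field; lra.
Qed.

Lemma sd_const c z : sd (fun _ => c) z 0.
Proof.
  intros eps He; exists 1; split; [lra|]; intros w w' _ _.
  replace (c - c - 0 * (w' - w))%C with (RtoC 0) by ring.
  rewrite Cmod_0; generalize (Cmod_ge_0 (w' - w)); nra.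
Qed.

Lemma sd_id z : sd (fun w => w) z 1.
Proof.
  intros eps He; exists 1; split; [lra|]; intros w w' _ _.
  replace (w' - w - 1 * (w' - w))%C with (RtoC 0) by ring.
  rewrite Cmod_0; generalize (Cmod_ge_0 (w' - w)); nra.
Qed.

Lemma sd_plus F G z l m : sd F z l -> sd G z m -> sd (fun w => F w + G w)%C z (l + m).
Proof.
  intros HF HG eps He.
  destruct (HF (eps / 2)) as [e1 [He1 H1]]; [lra|].
  destruct (HG (eps / 2)) as [e2 [He2 H2]]; [lra|].
  exists (Rmin e1 e2); split; [apply Rmin_pos; trivial|].
  intros w w' Hw Hw'; generalize (Rmin_l e1 e2) (Rmin_r e1 e2); intros.
  replace (F w' + G w' - (F w + G w) - (l + m) * (w' - w))%C with
    ((F w' - F w - l * (w' - w)) + (G w' - G w - m * (w' - w)))%C by ring.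
  eapply Rle_trans; [apply Cmod_triangle|].
  generalize (H1 w w' ltac:(lra) ltac:(lra)) (H2 w w' ltac:(lra) ltac:(lra)); lra.
Qed.

Lemma sd_comp F G z l m :
  sd F z l -> sd G (F z) m -> sd (fun w => G (F w)) z (m * l).
Proof.
  intros HF HG eps He.
  generalize (Cmod_ge_0 l) (Cmod_ge_0 m); intros Hl Hm.
  set (e' := eps / (Cmod l + Cmod m + 2)).
  assert (He' : 0 < e') by (apply Rdiv_lt_0_compat; lra).
  assert (Hee : e' * (Cmod l + Cmod m + 2) = eps) by (unfold e'; field; lra).
  destruct (HF e' He') as [e1 [He1 H1]].
  destruct (HG e' He') as [e2 [He2 H2]].
  destruct (sd_lipschitz _ _ _ HF) as [e3 [He3 H3]].
  generalize (proj1 (continuous_C_eps _ _) (sd_continuous _ _ _ HF) e2 He2).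
  intros [e4 [He4 H4]].
  exists (Rmin (Rmin e1 e3) e4); split; [repeat apply Rmin_pos; trivial|].
  intros w w' Hw Hw'.
  generalize (Rmin_l (Rmin e1 e3) e4) (Rmin_r (Rmin e1 e3) e4) (Rmin_l e1 e3) (Rmin_r e1 e3); intros.
  replace (G (F w') - G (F w) - m * l * (w' - w))%C with
    ((G (F w') - G (F w) - m * (F w' - F w)) + m * (F w' - F w - l * (w' - w)))%C by ring.
  eapply Rle_trans; [apply Cmod_triangle|]; rewrite Cmod_mult.
  generalize (H1 w w' ltac:(lra) ltac:(lra)) (H3 w w' ltac:(lra) ltac:(lra))
    (H2 (F w) (F w') (H4 w ltac:(lra)) (H4 w' ltac:(lra))).
  generalize (Cmod_ge_0 (w' - w)) (Cmod_ge_0 (F w' - F w)); intros.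
  rewrite <- Hee.
  assert (e' * Cmod (F w' - F w) <= e' * ((Cmod l + 1) * Cmod (w' - w)))
   by (apply Rmult_le_compat_l; lra).
  assert (Cmod m * Cmod (F w' - F w - l * (w' - w)) <= Cmod m * (e' * Cmod (w' - w)))
   by (apply Rmult_le_compat_l; lra).
  nra.
Qed.

Lemma sd_square z : sd (fun w => w * w)%C z (2 * z).
Proof.
  intros eps He; exists (eps / 2); split; [lra|]; intros w w' H1 H2.
  replace (w' * w' - w * w - 2 * z * (w' - w))%C with
    (((w - z) + (w' - z)) * (w' - w))%C by ring.
  rewrite Cmod_mult; apply Rmult_le_compat_r; [apply Cmod_ge_0|].
  eapply Rle_trans; [apply Cmod_triangle|]; lra.
Qed.

Lemma sd_scal c F z l : sd F z l -> sd (fun w => c * F w)%C z (c * l).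
Proof.
  intros H; apply (sd_comp F (fun w => c * w)%C); trivial.
  intros eps He; exists 1; split; [lra|]; intros w w' _ _.
  replace (c * w' - c * w - c * (w' - w))%C with (RtoC 0) by ring.
  rewrite Cmod_0; generalize (Cmod_ge_0 (w' - w)); nra.
Qed.

Lemma sd_opp F z l : sd F z l -> sd (fun w => - F w)%C z (- l).
Proof.
  intros H; replace (- l)%C with (- (1) * l)%C by ring.
  apply (sd_ext (fun w => - (1) * F w)%C); [intros; ring|apply sd_scal, H].
Qed.

Lemma sd_minus F G z l m : sd F z l -> sd G z m -> sd (fun w => F w - G w)%C z (l - m).
Proof. intros; apply sd_plus; [|apply sd_opp]; assumption. Qed.

(* Polarization reduces products to squares. *)
Lemma sd_mult F G z l m :
  sd F z l -> sd G z m -> sd (fun w => F w * G w)%C z (l * G z + F z * m).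
Proof.
  intros HF HG.
  assert (H2 : RtoC 2 <> 0) by (intros E; injection E; lra).
  apply (sd_ext (fun w => / 2 * ((F w + G w) * (F w + G w) - F w * F w - G w * G w))%C).
  - intros; field; exact H2.
  - replace (l * G z + F z * m)%C with
      (/ 2 * ((2 * (F z + G z)) * (l + m) - (2 * F z) * l - (2 * G z) * m))%C by (field; exact H2).
    apply sd_scal; repeat apply sd_minus.
    + apply (sd_comp (fun w => F w + G w)%C (fun w => w * w)%C); [apply sd_plus; assumption|apply sd_square].
    + apply (sd_comp F (fun w => w * w)%C); [assumption|apply sd_square].
    + apply (sd_comp G (fun w => w * w)%C); [assumption|apply sd_square].
Qed.

(** The increment from [w] to [w'] is split at the corner [(u', v)], and the mean value theorem is
    applied to the horizontal and to the vertical leg. *)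
Lemma strict_of_partials (f p q : C -> R) (z : C) :
  (exists r, 0 < r /\ forall w, Cmod (w - z) < r ->
     is_derive (fun t => f (t, snd w)) (fst w) (p w) /\
     is_derive (fun t => f (fst w, t)) (snd w) (q w)) ->
  continuous p z -> continuous q z ->
  forall eps, 0 < eps -> exists eta, 0 < eta /\
    forall w w', Cmod (w - z) < eta -> Cmod (w' - z) < eta ->
      Rabs (f w' - f w - p z * Re (w' - w) - q z * Im (w' - w)) <= eps * Cmod (w' - w).
Proof.
  intros [r [Hr Hd]] Hp Hq eps He.
  destruct (proj1 (continuous_R_eps _ _) Hp (eps / 2)) as [e1 [He1 H1]]; [lra|].
  destruct (proj1 (continuous_R_eps _ _) Hq (eps / 2)) as [e2 [He2 H2]]; [lra|].
  set (e := Rmin r (Rmin e1 e2)).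
  assert (He0 : 0 < e) by (repeat apply Rmin_pos; trivial).
  assert (Hle : e <= r /\ e <= e1 /\ e <= e2).
  { unfold e; generalize (Rmin_l r (Rmin e1 e2)) (Rmin_r r (Rmin e1 e2)) (Rmin_l e1 e2) (Rmin_r e1 e2).
    lra. }
  (* Points of the two legs are only known to be close to [z] in each coordinate; [e / 2] per
     coordinate gives modulus below [e]. *)
  exists (e / 2); split; [lra|].
  intros [u v] [u' v'] Hw Hw'.
  destruct z as [x y].
  generalize (re_le_Cmod ((u,v) - (x,y))) (Im_le_Cmod ((u,v) - (x,y)))
   (re_le_Cmod ((u',v') - (x,y))) (Im_le_Cmod ((u',v') - (x,y))); simpl; intros A1 A2 A3 A4.
  assert (Hsq : forall a b, Rabs (a - x) < e / 2 -> Rabs (b - y) < e / 2 -> Cmod ((a, b) - (x, y)) < e).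
  { intros a b Ha Hb; eapply Rle_lt_trans; [apply Cmod_le_Re_Im|]; simpl; unfold Rminus in *; lra. }
  assert (B1 : Rabs (u - x) < e / 2) by (unfold Rminus in *; lra).
  assert (B2 : Rabs (v - y) < e / 2) by (unfold Rminus in *; lra).
  assert (B3 : Rabs (u' - x) < e / 2) by (unfold Rminus in *; lra).
  assert (B4 : Rabs (v' - y) < e / 2) by (unfold Rminus in *; lra).
  assert (Hbt : forall a b c d t, Rabs (a - c) < d -> Rabs (b - c) < d ->
     Rmin a b <= t <= Rmax a b -> Rabs (t - c) < d).
  { intros a b c d t Ha Hb [Ht1 Ht2]; apply Rabs_def2 in Ha; apply Rabs_def2 in Hb.
    apply Rabs_def1; unfold Rmin, Rmax in *; destruct (Rle_dec a b); lra. }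
  destruct (MVT_gen (fun t => f (t, v)) u u' (fun t => p (t, v))) as [t1 [Ht1 E1]].
  { intros t Ht; apply (fun H => proj1 (Hd (t, v) H)).
    eapply Rlt_le_trans; [apply Hsq|]; try apply Hle; trivial. apply (Hbt u u'); trivial; lra. }
  { intros t Ht; apply continuity_pt_filterlim, (ex_derive_continuous (fun t => f (t, v)) t).
    exists (p (t, v)); apply (fun H => proj1 (Hd (t, v) H)).
    eapply Rlt_le_trans; [apply Hsq|]; try apply Hle; trivial. apply (Hbt u u'); trivial; lra. }
  destruct (MVT_gen (fun t => f (u', t)) v v' (fun t => q (u', t))) as [t2 [Ht2 E2]].
  { intros t Ht; apply (fun H => proj2 (Hd (u', t) H)).
    eapply Rlt_le_trans; [apply Hsq|]; try apply Hle; trivial. apply (Hbt v v'); trivial; lra. }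
  { intros t Ht; apply continuity_pt_filterlim, (ex_derive_continuous (fun t => f (u', t)) t).
    exists (q (u', t)); apply (fun H => proj2 (Hd (u', t) H)).
    eapply Rlt_le_trans; [apply Hsq|]; try apply Hle; trivial. apply (Hbt v v'); trivial; lra. }
  assert (F1 : Rabs (p (t1, v) - p (x, y)) < eps / 2).
  { apply H1; eapply Rlt_le_trans; [apply Hsq|]; try apply Hle; trivial. apply (Hbt u u'); trivial; lra. }
  assert (F2 : Rabs (q (u', t2) - q (x, y)) < eps / 2).
  { apply H2; eapply Rlt_le_trans; [apply Hsq|]; try apply Hle; trivial. apply (Hbt v v'); trivial; lra. }
  assert (E : f (u', v') - f (u, v) - p (x, y) * Re ((u', v') - (u, v)) - q (x, y) * Im ((u', v') - (u, v))
    = (p (t1, v) - p (x, y)) * Re ((u', v') - (u, v)) + (q (u', t2) - q (x, y)) * Im ((u', v') - (u, v))).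
  { unfold Re, Im; simpl; change (u' + - u) with (u' - u); change (v' + - v) with (v' - v); lra. }
  change (Rabs (f (u', v') - f (u, v) - p (x, y) * Re ((u', v') - (u, v)) - q (x, y) * Im ((u', v') - (u, v)))
    <= eps * Cmod ((u', v') - (u, v))).
  rewrite E; eapply Rle_trans; [apply Rabs_triang|]; rewrite !Rabs_mult.
  generalize (re_le_Cmod ((u',v') - (u,v))) (Im_le_Cmod ((u',v') - (u,v))).
  set (m := Cmod ((u', v') - (u, v))); set (a := Re ((u', v') - (u, v))); set (b := Im ((u', v') - (u, v))).
  intros G1 G2.
  generalize (Rabs_pos a) (Rabs_pos b) (Rabs_pos (p (t1, v) - p (x, y))) (Rabs_pos (q (u', t2) - q (x, y))).
  intros.
  apply Rle_trans with (eps / 2 * m + eps / 2 * m); [|lra].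
  apply Rplus_le_compat; apply Rmult_le_compat; lra.
Qed.

(** The factor [Ci] in the vertical derivative encodes the Cauchy-Riemann equations, so
    [strict_of_partials] applied to the real and the imaginary part yields one complex
    derivative. *)
Lemma sd_of_partials (F G : C -> C) (z : C) :
  (exists r, 0 < r /\ forall w, Cmod (w - z) < r ->
     D1 (fun t => F (t, snd w)) (fst w) (G w) /\
     D1 (fun t => F (fst w, t)) (snd w) (Ci * G w)) ->
  continuous G z -> sd F z (G z).
Proof.
  intros [r [Hr Hd]] HG eps He.
  destruct (strict_of_partials (fun w => Re (F w)) (fun w => Re (G w)) (fun w => - Im (G w)) z)
    with (eps := eps / 2) as [e1 [He1 H1]].
  - exists r; split; trivial; intros w Hw; destruct (Hd w Hw) as [[A _] [B _]]; split; trivial.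
    simpl in B; replace (- Im (G w)) with (0 * fst (G w) - 1 * snd (G w)) by (unfold Im; ring); exact B.
  - apply continuous_Re, HG.
  - apply continuous_Ropp, continuous_Im, HG.
  - lra.
  - destruct (strict_of_partials (fun w => Im (F w)) (fun w => Im (G w)) (fun w => Re (G w)) z)
    with (eps := eps / 2) as [e2 [He2 H2]].
    + exists r; split; trivial; intros w Hw; destruct (Hd w Hw) as [[_ A] [_ B]]; split; trivial.
      simpl in B; replace (Re (G w)) with (0 * snd (G w) + 1 * fst (G w)) by (unfold Re; ring); exact B.
    + apply continuous_Im, HG.
    + apply continuous_Re, HG.
    + lra.
    + exists (Rmin e1 e2); split; [apply Rmin_pos; trivial|].
      intros w w' Hw Hw'; generalize (Rmin_l e1 e2) (Rmin_r e1 e2); intros.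
      eapply Rle_trans; [apply Cmod_le_Re_Im|].
      generalize (H1 w w' ltac:(lra) ltac:(lra)) (H2 w w' ltac:(lra) ltac:(lra)).
      set (d := (w' - w)%C); intros K1 K2.
      replace (Re (F w' - F w - G z * d)) with
        (Re (F w') - Re (F w) - Re (G z) * Re d - - Im (G z) * Im d)
        by (unfold Re, Im; simpl; ring).
      replace (Im (F w' - F w - G z * d)) with
        (Im (F w') - Im (F w) - Im (G z) * Re d - Re (G z) * Im d)
        by (unfold Re, Im; simpl; ring).
      lra.
Qed.

Lemma is_derive_eps (f : R -> R) (x l : R) :
  (forall eps, 0 < eps -> exists eta, 0 < eta /\ forall y, Rabs (y - x) < eta ->
     Rabs (f y - f x - l * (y - x)) <= eps * Rabs (y - x)) -> is_derive f x l.
Proof.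
  intros H; apply is_derive_Reals; intros eps He.
  destruct (H (eps / 2)) as [eta [Heta K]]; [lra|].
  exists (mkposreal _ Heta); intros h Hh Hd; simpl in Hd.
  specialize (K (x + h)); replace (x + h - x) with h in K by ring.
  specialize (K Hd).
  replace ((f (x + h) - f x) / h - l) with ((f (x + h) - f x - l * h) / h) by (field; trivial).
  unfold Rdiv at 1; rewrite Rabs_mult, Rabs_inv.
  apply Rabs_pos_lt in Hh.
  apply Rle_lt_trans with (eps / 2 * Rabs h * / Rabs h).
  - apply Rmult_le_compat_r; trivial; left; apply Rinv_0_lt_compat; trivial.
  - rewrite Rmult_assoc, Rinv_r by lra; lra.
Qed.

Lemma eps_of_is_derive (f : R -> R) (x l : R) : is_derive f x l ->
  forall eps, 0 < eps -> exists eta, 0 < eta /\ forall y, Rabs (y - x) < eta ->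
     Rabs (f y - f x - l * (y - x)) <= eps * Rabs (y - x).
Proof.
  intros H eps He; apply is_derive_Reals in H; destruct (H eps He) as [d Hd].
  exists d; split; [apply cond_pos|]; intros y Hy.
  destruct (Req_dec y x) as [->|Hn].
  - replace (f x - f x - l * (x - x)) with 0 by ring.
    rewrite Rminus_diag, Rabs_R0; lra.
  - assert (Hyx : y - x <> 0) by lra.
    specialize (Hd (y - x) Hyx Hy); replace (x + (y - x)) with y in Hd by ring.
    replace (f y - f x - l * (y - x)) with (((f y - f x) / (y - x) - l) * (y - x)) by (field; trivial).
    rewrite Rabs_mult; apply Rmult_le_compat_r; [apply Rabs_pos|lra].
Qed.

Lemma D1_eps (f : R -> C) (t : R) (l : C) :
  (forall eps, 0 < eps -> exists eta, 0 < eta /\ forall s, Rabs (s - t) < eta ->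
     Cmod (f s - f t - l * (s - t)) <= eps * Rabs (s - t)) <-> D1 f t l.
Proof.
  split.
  - intros H; split; apply is_derive_eps; intros eps He; destruct (H eps He) as [eta [Heta K]];
     exists eta; split; trivial; intros s Hs; eapply Rle_trans; [|apply K, Hs| |apply K, Hs].
    + eapply Rle_trans; [|apply re_le_Cmod]; right; f_equal; unfold Re; simpl; ring.
    + eapply Rle_trans; [|apply Im_le_Cmod]; right; f_equal; unfold Im; simpl; ring.
  - intros [H1 H2] eps He.
    destruct (eps_of_is_derive _ _ _ H1 (eps / 2)) as [e1 [He1 K1]]; [lra|].
    destruct (eps_of_is_derive _ _ _ H2 (eps / 2)) as [e2 [He2 K2]]; [lra|].
    exists (Rmin e1 e2); split; [apply Rmin_pos; trivial|].
    intros s Hs; generalize (Rmin_l e1 e2) (Rmin_r e1 e2); intros.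
    eapply Rle_trans; [apply Cmod_le_Re_Im|].
    generalize (K1 s ltac:(lra)) (K2 s ltac:(lra)); intros L1 L2.
    replace (Re (f s - f t - l * (s - t))) with (Re (f s) - Re (f t) - Re l * (s - t))
      by (unfold Re; simpl; ring).
    replace (Im (f s - f t - l * (s - t))) with (Im (f s) - Im (f t) - Im l * (s - t))
      by (unfold Im; simpl; ring).
    lra.
Qed.

Lemma D1_comp (F : C -> C) (g : R -> C) (t : R) (l m : C) :
  sd F (g t) l -> D1 g t m -> D1 (fun s => F (g s)) t (l * m).
Proof.
  intros HF Hg; apply D1_eps; intros eps He.
  generalize (Cmod_ge_0 l) (Cmod_ge_0 m); intros Hl Hm.
  set (e' := Rmin 1 (eps / (Cmod l + Cmod m + 1))).
  assert (He' : 0 < e') by (apply Rmin_pos; [lra|apply Rdiv_lt_0_compat; lra]).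
  assert (Hee : e' * (Cmod l + Cmod m + 1) <= eps).
  { apply Rle_trans with (eps / (Cmod l + Cmod m + 1) * (Cmod l + Cmod m + 1)).
    - apply Rmult_le_compat_r; [lra|apply Rmin_r].
    - right; field; lra. }
  assert (He1 : e' <= 1) by apply Rmin_l.
  destruct (HF e' He') as [e1 [Hp1 H1]].
  destruct (proj2 (D1_eps g t m) Hg e' He') as [e2 [Hp2 H2]].
  assert (Hp3 : 0 < e1 / (Cmod m + 1)) by (apply Rdiv_lt_0_compat; lra).
  exists (Rmin e2 (e1 / (Cmod m + 1))); split; [apply Rmin_pos; trivial|].
  intros s Hs.
  generalize (Rmin_l e2 (e1 / (Cmod m + 1))) (Rmin_r e2 (e1 / (Cmod m + 1))); intros.
  generalize (H2 s ltac:(lra)); intros K2.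
  generalize (Rabs_pos (s - t)); intros Hst.
  assert (Hc : Cmod (s - t) = Rabs (s - t)) by (rewrite <- RtoC_minus; apply Cmod_R).
  assert (Hgs : Cmod (g s - g t) <= (Cmod m + e') * Rabs (s - t)).
  { generalize (Cmod_triangle_rev' (g s - g t) (m * (s - t))).
    rewrite Cmod_mult, Hc; lra. }
  assert (Hgs1 : Cmod (g s - g t) < e1).
  { apply Rle_lt_trans with ((Cmod m + 1) * Rabs (s - t)); [nra|].
    apply Rlt_le_trans with ((Cmod m + 1) * (e1 / (Cmod m + 1))).
    - apply Rmult_lt_compat_l; lra.
    - right; field; lra. }
  generalize (H1 (g t) (g s) ltac:(rewrite Cmod_self; lra) Hgs1); intros K1.
  replace (F (g s) - F (g t) - l * m * (s - t))%C with
    ((F (g s) - F (g t) - l * (g s - g t)) + l * (g s - g t - m * (s - t)))%C by ring.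
  eapply Rle_trans; [apply Cmod_triangle|]; rewrite (Cmod_mult l).
  assert (Cmod l * Cmod (g s - g t - m * (s - t)) <= Cmod l * (e' * Rabs (s - t)))
    by (apply Rmult_le_compat_l; trivial).
  assert (e' * Cmod (g s - g t) <= e' * ((Cmod m + 1) * Rabs (s - t))).
  { apply Rmult_le_compat_l; [lra|]. eapply Rle_trans; [exact Hgs|]. apply Rmult_le_compat_r; lra. }
  apply Rle_trans with (e' * (Cmod l + Cmod m + 1) * Rabs (s - t)); [nra|].
  apply Rmult_le_compat_r; trivial.
Qed.

Lemma D1_horizontal (x v : R) : D1 (fun t => (t, v)) x 1.
Proof. split; simpl; auto_derive; trivial. Qed.
Lemma D1_vertical (x v : R) : D1 (fun t => (x, t)) v Ci.
Proof. split; simpl; auto_derive; trivial. Qed.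

Lemma sd_partials (F : C -> C) (z l : C) : sd F z l ->
  D1 (fun t => F (t, snd z)) (fst z) l /\ D1 (fun t => F (fst z, t)) (snd z) (Ci * l).
Proof.
  intros H; split.
  - replace l with (l * 1)%C by ring.
    apply (D1_comp F (fun t => (t, snd z))); [destruct z; exact H|apply D1_horizontal].
  - rewrite Cmult_comm.
    apply (D1_comp F (fun t => (fst z, t))); [destruct z; exact H|apply D1_vertical].
Qed.

Lemma D1_mult_const (c : C) f t l : D1 f t l -> D1 (fun s => c * f s)%C t (c * l).
Proof.
  intros H; apply (D1_comp (fun w => c * w)%C f); trivial.
  generalize (sd_scal c (fun w => w) (f t) 1 (sd_id _)); rewrite Cmult_1_r; trivial.
Qed.

(** * The complex exponential *)

Definition Cexp (z : C) : C := (exp (Re z) * cos (Im z), exp (Re z) * sin (Im z)).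

Lemma continuous_Cexp (z : C) : continuous Cexp z.
Proof.
  assert (He : continuous (fun y : C => exp (Re y)) z).
  { apply (continuous_comp (fun y : C => Re y) exp); [apply continuous_fst|].
    apply (ex_derive_continuous exp); exists (exp (Re z)); apply is_derive_exp. }
  apply continuous_Re_Im; simpl; apply continuous_Rmult; trivial.
  - apply (continuous_comp (fun y : C => Im y) cos); [apply continuous_snd|].
    apply (ex_derive_continuous cos); eexists; apply is_derive_cos.
  - apply (continuous_comp (fun y : C => Im y) sin); [apply continuous_snd|].
    apply (ex_derive_continuous sin); eexists; apply is_derive_sin.
Qed.

Lemma sd_Cexp z : sd Cexp z (Cexp z).
Proof.
  apply sd_of_partials; [|apply continuous_Cexp].
  exists 1; split; [lra|]; intros [x y] _; split; split; unfold Cexp, Re, Im; simpl;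
   auto_derive; trivial; ring.
Qed.

Lemma Cmod_Cexp z : Cmod (Cexp z) = exp (Re z).
Proof.
  generalize (exp_pos (Re z)) (Cmod_ge_0 (Cexp z)) (Cmod2_alt (Cexp z)); simpl; intros H1 H2 H3.
  generalize (sin2_cos2 (Im z)); unfold Rsqr; intros H4.
  assert (Cmod (Cexp z) * Cmod (Cexp z) = exp (Re z) * exp (Re z)) by nra.
  nra.
Qed.

Lemma Cexp_plus z w : Cexp (z + w) = (Cexp z * Cexp w)%C.
Proof.
  unfold Cexp; apply C_ext; unfold Re, Im; simpl; rewrite exp_plus, ?cos_plus, ?sin_plus; ring.
Qed.

Lemma Cexp_0 : Cexp 0 = 1.
Proof. apply C_ext; unfold Cexp, Re, Im; simpl; rewrite exp_0, ?cos_0, ?sin_0; ring. Qed.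

Lemma Cexp_opp z : (Cexp z * Cexp (- z))%C = 1.
Proof. rewrite <- Cexp_plus, <- Cexp_0; f_equal; ring. Qed.

(** * Compactness and exhaustion *)

(** A gauge is put on a square containing [K]: around each point it fits either inside one open set
    of the cover or inside the complement of [K]. Finitely many gauge boxes cover the square. *)
Lemma compact_closed_bounded (K : C -> Prop) (r : R) :
  (forall z, K z -> Cmod z <= r) ->
  (forall z, ~ K z -> exists d, 0 < d /\ forall w, Cmod (w - z) < d -> ~ K w) ->
  compact_set K.
Proof.
  intros Hb Hcl I U HU Hc.
  (* The radius is doubled because the boxes of [compactness_list] bound each coordinate by [d],
     hence the modulus by [2 * d]. *)
  assert (Hd : forall z : C, exists d : posreal,
    (K z -> exists i, forall w, Cmod (w - z) < 2 * d -> U i w) /\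
    (~ K z -> forall w, Cmod (w - z) < 2 * d -> ~ K w)).
  { intros z; destruct (classic (K z)) as [Kz|Kz].
    - destruct (Hc z Kz) as [i Hi].
      destruct (proj1 (locally_Cmod z _) (HU i z Hi)) as [e [He H]].
      exists (mkposreal (e / 2) ltac:(lra)); split; [|tauto].
      intros _; exists i; intros w; simpl; intros; apply H; lra.
    - destruct (Hcl z Kz) as [e [He H]].
      exists (mkposreal (e / 2) ltac:(lra)); split; [tauto|].
      intros _ w; simpl; intros; apply H; lra. }
  set (delta := fun t : Compactness.Tn 2 R =>
    proj1_sig (constructive_indefinite_description _ (Hd (fst t, fst (snd t))))).
  assert (Hdel : forall x y : R,
    (K (x, y) -> exists i, forall w, Cmod (w - (x, y)) < 2 * delta (x, (y, tt)) -> U i w) /\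
    (~ K (x, y) -> forall w, Cmod (w - (x, y)) < 2 * delta (x, (y, tt)) -> ~ K w)).
  { intros x y; unfold delta; simpl.
    destruct (constructive_indefinite_description _ (Hd (x, y))) as [d Hdd]; exact Hdd. }
  (* [compactness_list] gives its finite list only under a double negation. *)
  apply NNPP; intros Hno.
  apply (compactness_list 2 (- r, (- r, tt)) (r, (r, tt)) delta); intros [l Hl]; apply Hno.
  assert (HI : forall m : list (Compactness.Tn 2 R), exists li : list I,
    forall x y w, In (x, (y, tt)) m -> K w -> Cmod (w - (x, y)) < 2 * delta (x, (y, tt)) ->
      exists i, In i li /\ U i w).
  { induction m as [|[x [y []]] m [li IH]].
    - exists nil; intros x y w [].
    - destruct (classic (K (x, y))) as [Kz|Kz].
      + destruct (proj1 (Hdel x y) Kz) as [i Hi].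
        exists (i :: li); intros x' y' w [E|Hin] Kw Hw.
        * injection E; intros; subst; exists i; split; [left; trivial|apply Hi, Hw].
        * destruct (IH x' y' w Hin Kw Hw) as [j [Hj1 Hj2]]; exists j; split; [right|]; trivial.
      + exists li; intros x' y' w [E|Hin] Kw Hw.
        * injection E; intros; subst; destruct (proj2 (Hdel x' y') Kz w Hw Kw).
        * apply (IH x' y' w Hin Kw Hw). }
  destruct (HI l) as [li Hli]; exists li; intros [u v] Kz.
  generalize (Hb _ Kz) (re_le_Cmod (u, v)) (Im_le_Cmod (u, v)); simpl; intros B1 B2 B3.
  destruct (Hl (u, (v, tt))) as [[x [y []]] [Hin [_ Hcl2]]].
  { simpl; split; [|split; trivial]; apply Rabs_le_between; lra. }
  simpl in Hcl2; destruct Hcl2 as [C1 [C2 _]].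
  apply (Hli x y (u, v) Hin Kz).
  eapply Rle_lt_trans; [apply Cmod_le_Re_Im|]; simpl; unfold Rminus in *; lra.
Qed.

(** A finite subcover has a largest index, and monotonicity carries every point to it. Bounds on
    compact sets and the exhaustion by disks are instances. *)
Lemma compact_local (K : C -> Prop) (P : nat -> C -> Prop) :
  compact_set K -> (forall n m z, (n <= m)%nat -> P n z -> P m z) ->
  (forall z, K z -> exists n, locally z (P n)) ->
  exists n, forall z, K z -> P n z.
Proof.
  intros HK Hm Hl.
  destruct (HK nat (fun n z => locally z (P n))) as [l Hl'].
  - intros n z Hz; apply locally_locally, Hz.
  - exact Hl.
  - assert (HN : forall l : list nat, exists N, forall n, In n l -> (n <= N)%nat).
    { induction l0 as [|a l0 [N IH]]; [exists 0%nat; intros n []|].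
      exists (a + N)%nat; intros n [<-|Hn]; [lia|]. specialize (IH n Hn); lia. }
    destruct (HN l) as [N H]; exists N; intros z Kz.
    destruct (Hl' z Kz) as [n [Hn Hz]]; apply (Hm n N z (H n Hn)).
    apply (locally_singleton _ _ Hz).
Qed.

Lemma inv_INR_small (e : R) : 0 < e -> exists n, / (INR n + 1) < e.
Proof.
  intros He; destruct (archimed_cor1 e He) as [N [HN HN0]]; exists N.
  apply Rlt_trans with (2 := HN), Rinv_lt_contravar; [|lra].
  apply lt_0_INR in HN0; nra.
Qed.

Lemma inv_INR_le n m : (n <= m)%nat -> / (INR m + 1) <= / (INR n + 1).
Proof.
  intros H; apply le_INR in H; generalize (pos_INR n); intros.
  apply Rinv_le_contravar; lra.
Qed.

Lemma inv_INR_pos n : 0 < / (INR n + 1).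
Proof. apply Rinv_0_lt_compat; generalize (pos_INR n); lra. Qed.

Lemma compact_pos_lower_bound (K : C -> Prop) (f : C -> R) :
  compact_set K -> (forall z, K z -> continuous f z) -> (forall z, K z -> 0 < f z) ->
  exists m, 0 < m /\ forall z, K z -> m < f z.
Proof.
  intros HK Hc Hp.
  destruct (compact_local K (fun n z => / (INR n + 1) < f z) HK) as [n Hn].
  - intros n m z Hnm H; apply Rle_lt_trans with (2 := H), inv_INR_le, Hnm.
  - intros z Kz; destruct (inv_INR_small (f z) (Hp z Kz)) as [n Hn]; exists n.
    apply (Hc z Kz (fun y => / (INR n + 1) < y)), (open_gt (/ (INR n + 1)) (f z) Hn).
  - exists (/ (INR n + 1)); split; [apply inv_INR_pos|exact Hn].
Qed.

Lemma compact_upper_bound (K : C -> Prop) (f : C -> R) :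
  compact_set K -> (forall z, K z -> continuous f z) ->
  exists m, 0 < m /\ forall z, K z -> f z < m.
Proof.
  intros HK Hc.
  destruct (compact_local K (fun n z => f z < INR n) HK) as [n Hn].
  - intros n m z Hnm H; apply Rlt_le_trans with (1 := H), le_INR, Hnm.
  - intros z Kz; destruct (INR_unbounded (f z)) as [n Hn]; exists n.
    apply (Hc z Kz (fun y => y < INR n)), (open_lt (INR n) (f z) Hn).
  - exists (INR n + 1); split; [generalize (pos_INR n); lra|].
    intros z Kz; specialize (Hn z Kz); lra.
Qed.

Lemma compact_annulus (s r : R) : compact_set (fun z => s <= Cmod z <= r).
Proof.
  apply (compact_closed_bounded _ r); [tauto|].
  intros z Hz.
  destruct (Rlt_le_dec (Cmod z) s) as [H|H].
  - exists (s - Cmod z); split; [lra|]; intros w Hw [H1 H2].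
    generalize (Cmod_triangle_rev' w z); lra.
  - assert (r < Cmod z) by (apply Rnot_le_lt; intros ?; apply Hz; lra).
    exists (Cmod z - r); split; [lra|]; intros w Hw [H1 H2].
    generalize (Cmod_triangle_rev' z w); rewrite Cmod_minus_sym; lra.
Qed.

Lemma compact_disk (r : R) : compact_set (fun z => Cmod z <= r).
Proof.
  apply (compact_closed_bounded _ r); [tauto|].
  intros z Hz; apply Rnot_le_lt in Hz.
  exists (Cmod z - r); split; [lra|]; intros w Hw H1.
  generalize (Cmod_triangle_rev' z w); rewrite Cmod_minus_sym; lra.
Qed.

(** The shifts make [rad D 0] positive for both domains; this number is the gap abscissa [c] of
    every labyrinth. *)
Definition rad (D : sdomain) (n : nat) : R :=
  match D with Plane => INR n + 1 | Disk => 1 - / (INR n + 2) end.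

Lemma rad_pos D n : 0 < rad D n.
Proof.
  generalize (pos_INR n); intros; destruct D; simpl; [lra|].
  assert (/ (INR n + 2) <= / 2) by (apply Rinv_le_contravar; lra); lra.
Qed.

Lemma rad_lt D n m : (n < m)%nat -> rad D n < rad D m.
Proof.
  intros H; apply lt_INR in H; generalize (pos_INR n); intros; destruct D; simpl; [lra|].
  assert (/ (INR m + 2) < / (INR n + 2)); [|lra].
  apply Rinv_lt_contravar; [apply Rmult_lt_0_compat|]; lra.
Qed.

Lemma rad_le D n m : (n <= m)%nat -> rad D n <= rad D m.
Proof.
  intros H; destruct (Nat.eq_dec n m) as [->|]; [lra|].
  left; apply rad_lt; lia.
Qed.

Lemma rad_in_dom D n z : Cmod z <= rad D n -> in_dom D z.
Proof.
  destruct D; simpl; trivial; intros H.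
  assert (0 < / (INR n + 2)) by (apply Rinv_0_lt_compat; generalize (pos_INR n); lra); lra.
Qed.

Lemma in_dom_rad D z : in_dom D z -> exists n, Cmod z < rad D n.
Proof.
  destruct D; simpl; intros H.
  - destruct (INR_unbounded (Cmod z)) as [n Hn]; exists n; lra.
  - destruct (inv_INR_small (1 - Cmod z)) as [n Hn]; [lra|]; exists n.
    assert (/ (INR n + 2) <= / (INR n + 1)); [|lra].
    generalize (pos_INR n); intros; apply Rinv_le_contravar; lra.
Qed.

Lemma in_dom_open D z : in_dom D z ->
  exists r, 0 < r /\ forall w, Cmod (w - z) < r -> in_dom D w.
Proof.
  intros H; destruct (in_dom_rad D z H) as [n Hn].
  exists (rad D n - Cmod z); split; [lra|]; intros w Hw.
  apply (rad_in_dom D n); generalize (Cmod_triangle_rev' w z); lra.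
Qed.

Lemma compact_in_rad D (K : C -> Prop) :
  compact_set K -> (forall z, K z -> in_dom D z) ->
  exists n, forall z, K z -> Cmod z < rad D n.
Proof.
  intros HK Hd; apply (compact_local K (fun n z => Cmod z < rad D n) HK).
  - intros n m z Hnm H; generalize (rad_le D n m Hnm); lra.
  - intros z Kz; destruct (in_dom_rad D z (Hd z Kz)) as [n Hn]; exists n.
    apply (continuous_Cmod z (fun y => y < rad D n)), (open_lt (rad D n) (Cmod z) Hn).
Qed.

Lemma subinterval_avoiding_list (l : list R) (r r' : R) : r < r' ->
  exists s s', r < s /\ s < s' /\ s' < r' /\ forall x, In x l -> ~ (s <= x <= s').
Proof.
  intros H; induction l as [|a l (s & s' & H1 & H2 & H3 & H4)].
  - exists (r + (r' - r) / 3), (r + 2 * (r' - r) / 3).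
    repeat split; try lra; intros x [].
  - destruct (Rle_lt_dec a ((s + s') / 2)).
    + exists ((s + 3 * s') / 4), s'; repeat split; try lra.
      intros x [<-|Hx]; [lra|]; specialize (H4 x Hx); lra.
    + exists s, ((3 * s + s') / 4); repeat split; try lra.
      intros x [<-|Hx]; [lra|]; specialize (H4 x Hx); lra.
Qed.

(** * Lengths of polygons *)

Lemma poly_len_snoc c t0 l t t' :
  poly_len c t0 (l ++ t :: t' :: nil) =
  poly_len c t0 (l ++ t :: nil) + norm3 (sub3 (c t') (c t)).
Proof. revert t0; induction l as [|a l IH]; intros t0; simpl; [|rewrite IH]; ring. Qed.

Lemma increasing_from_snoc t0 l t t' :
  increasing_from t0 (l ++ t :: nil) -> t <= t' ->
  increasing_from t0 (l ++ t :: t' :: nil).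
Proof.
  revert t0; induction l as [|a l IH]; intros t0; simpl; [tauto|].
  intros [H1 H2] H; split; auto.
Qed.

(** A supremum argument: the times reachable by a polygon at least as long as the increase of [psi]
    form a set that cannot stop before [t1]. *)
Lemma poly_len_lower_bound (c : R -> R3) (psi : R -> R) (t1 : R) :
  0 <= t1 ->
  (forall t, 0 <= t <= t1 -> exists d, 0 < d /\ forall s s',
     Rabs (s - t) < d -> Rabs (s' - t) < d -> psi s' - psi s <= norm3 (sub3 (c s') (c s))) ->
  exists l, increasing_from 0 l /\ List.Forall (fun t => t <= t1) l /\
    psi t1 - psi 0 <= poly_len c 0 l.
Proof.
  intros Ht1 Hloc.
  (* The polygon is required to end at [t], so that it can be prolonged by one more edge. *)
  pose (good := fun t => exists l, increasing_from 0 (l ++ t :: nil) /\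
    List.Forall (fun s => s <= t) (l ++ t :: nil) /\ psi t - psi 0 <= poly_len c 0 (l ++ t :: nil)).
  assert (Hstep : forall t t', good t -> t <= t' ->
    psi t' - psi t <= norm3 (sub3 (c t') (c t)) -> good t').
  { intros t t' (l & L1 & L2 & L3) Htt Hp; exists (l ++ t :: nil).
    rewrite <- app_assoc; simpl; split; [apply increasing_from_snoc; trivial|split].
    - apply Forall_app in L2; destruct L2 as [L2 L2']; apply Forall_app; split.
      + eapply Forall_impl; [|exact L2]; simpl; intros; lra.
      + apply Forall_cons; [lra|apply Forall_cons; [lra|apply Forall_nil]].
    - rewrite poly_len_snoc; lra. }
  assert (H0 : good 0).
  { destruct (Hloc 0) as [d [Hd H]]; [lra|].
    specialize (H 0 0); rewrite Rminus_diag, Rabs_R0 in H.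
    exists nil; simpl; split; [lra|split]; [apply Forall_cons; [lra|apply Forall_nil]|].
    specialize (H Hd Hd); lra. }
  destruct (completeness (fun t => 0 <= t <= t1 /\ good t)) as [tau [Hub Hlub]].
  { exists t1; intros t [? _]; lra. }
  { exists 0; split; [lra|trivial]. }
  assert (Htau : 0 <= tau <= t1).
  { split; [apply Hub; split; [lra|trivial]|apply Hlub; intros t [? _]; lra]. }
  destruct (Hloc tau Htau) as [d [Hd H]].
  assert (Ht : exists t, 0 <= t <= t1 /\ good t /\ tau - d < t <= tau).
  { apply NNPP; intros Hn.
    assert (tau <= tau - d); [|lra].
    apply Hlub; intros t [Ht Hg]; apply Rnot_lt_le; intros Hlt; apply Hn.
    exists t; repeat split; try lra; trivial; apply Hub; split; trivial. }
  destruct Ht as (t & Ht & Hg & Htd).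
  (* One edge from a good time just below [tau] overshoots the supremum, unless it is stopped by the
     cap [t1]. *)
  assert (Hg' : good (Rmin (tau + d / 2) t1)).
  { apply (Hstep t); trivial.
    - apply Rmin_glb; lra.
    - apply H.
      + apply Rabs_def1; lra.
      + apply Rabs_def1; unfold Rmin; destruct (Rle_dec (tau + d / 2) t1); lra. }
  assert (E : Rmin (tau + d / 2) t1 = t1).
  { unfold Rmin in *; destruct (Rle_dec (tau + d / 2) t1); trivial.
    assert (tau + d / 2 <= tau); [|lra].
    apply Hub; split; [lra|trivial]. }
  rewrite E in Hg'; destruct Hg' as (l & L1 & L2 & L3).
  exists (l ++ t1 :: nil); auto.
Qed.

(** * Complex integrals of functions of a real variable *)

Definition CInt (f : R -> C) (a b : R) : C :=
  (RInt (fun t => Re (f t)) a b, RInt (fun t => Im (f t)) a b).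

Lemma ex_CInt (f : R -> C) (a b : R) :
  a <= b -> (forall t, a <= t <= b -> continuous f t) ->
  ex_RInt (fun t => Re (f t)) a b /\ ex_RInt (fun t => Im (f t)) a b.
Proof.
  intros Hab Hf; split; apply (ex_RInt_continuous (V := R_CompleteNormedModule));
   rewrite Rmin_left, Rmax_right by trivial; intros t Ht;
   [apply (continuous_Re f)|apply (continuous_Im f)]; apply Hf, Ht.
Qed.

Lemma CInt_ext (f g : R -> C) (a b : R) :
  a <= b -> (forall t, a <= t <= b -> f t = g t) -> CInt f a b = CInt g a b.
Proof.
  intros Hab H; unfold CInt; f_equal; apply RInt_ext; rewrite Rmin_left, Rmax_right by trivial;
   intros t Ht; rewrite H by lra; trivial.
Qed.

Lemma CInt_plus (f g : R -> C) (a b : R) :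
  a <= b -> (forall t, a <= t <= b -> continuous f t) -> (forall t, a <= t <= b -> continuous g t) ->
  CInt (fun t => f t + g t)%C a b = (CInt f a b + CInt g a b)%C.
Proof.
  intros Hab Hf Hg; destruct (ex_CInt f a b Hab Hf), (ex_CInt g a b Hab Hg).
  apply C_ext.
  - apply (RInt_plus (V := R_CompleteNormedModule) (fun t => Re (f t)) (fun t => Re (g t))); trivial.
  - apply (RInt_plus (V := R_CompleteNormedModule) (fun t => Im (f t)) (fun t => Im (g t))); trivial.
Qed.

Lemma CInt_mult_const (c : C) (f : R -> C) (a b : R) :
  a <= b -> (forall t, a <= t <= b -> continuous f t) ->
  CInt (fun t => c * f t)%C a b = (c * CInt f a b)%C.
Proof.
  intros Hab Hf; destruct (ex_CInt f a b Hab Hf) as [H1 H2].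
  assert (Hs : forall (k : R) g, ex_RInt g a b -> ex_RInt (fun t => k * g t) a b)
    by (intros; apply (ex_RInt_scal (V := R_NormedModule)); trivial).
  assert (Hs' : forall (k : R) g, ex_RInt g a b -> RInt (fun t => k * g t) a b = k * RInt g a b)
    by (intros; apply (RInt_scal (V := R_CompleteNormedModule)); trivial).
  apply C_ext.
  - transitivity (RInt (fun t => Re c * Re (f t)) a b - RInt (fun t => Im c * Im (f t)) a b).
    + apply (RInt_minus (V := R_CompleteNormedModule) (fun t => Re c * Re (f t)) (fun t => Im c * Im (f t))); auto.
    + rewrite !Hs' by trivial; reflexivity.
  - transitivity (RInt (fun t => Re c * Im (f t)) a b + RInt (fun t => Im c * Re (f t)) a b).
    + apply (RInt_plus (V := R_CompleteNormedModule) (fun t => Re c * Im (f t)) (fun t => Im c * Re (f t))); auto.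
    + rewrite !Hs' by trivial; reflexivity.
Qed.

Lemma CInt_bound (f : R -> C) (a b M : R) :
  a <= b -> (forall t, a <= t <= b -> continuous f t) -> (forall t, a <= t <= b -> Cmod (f t) <= M) ->
  Cmod (CInt f a b) <= 2 * M * (b - a).
Proof.
  intros Hab Hf HM; destruct (ex_CInt f a b Hab Hf) as [H1 H2].
  eapply Rle_trans; [apply Cmod_le_Re_Im|].
  assert (Rabs (RInt (fun t => Re (f t)) a b) <= (b - a) * M).
  { apply abs_RInt_le_const; trivial; intros t Ht.
    eapply Rle_trans; [apply re_le_Cmod|apply HM, Ht]. }
  assert (Rabs (RInt (fun t => Im (f t)) a b) <= (b - a) * M).
  { apply abs_RInt_le_const; trivial; intros t Ht.
    eapply Rle_trans; [apply Im_le_Cmod|apply HM, Ht]. }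
  simpl; lra.
Qed.

Lemma CInt_derive (f g : R -> C) (a b : R) :
  a <= b -> (forall t, a <= t <= b -> D1 f t (g t)) -> (forall t, a <= t <= b -> continuous g t) ->
  CInt g a b = (f b - f a)%C.
Proof.
  intros Hab Hd Hc; apply C_ext; apply is_RInt_unique.
  - apply (is_RInt_derive (V := R_CompleteNormedModule) (fun t => Re (f t)));
     rewrite Rmin_left, Rmax_right by trivial; intros t Ht;
     [apply Hd, Ht|apply (continuous_Re g), Hc, Ht].
  - apply (is_RInt_derive (V := R_CompleteNormedModule) (fun t => Im (f t)));
     rewrite Rmin_left, Rmax_right by trivial; intros t Ht;
     [apply Hd, Ht|apply (continuous_Im g), Hc, Ht].
Qed.

Lemma RInt_param_derive (f g : R -> R -> R) (x0 a b d : R) :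
  0 < d -> a <= b ->
  (forall x t, Rabs (x - x0) < d -> a - d < t < b + d -> is_derive (fun y => f y t) x (g x t)) ->
  (forall t, a <= t <= b -> continuous (fun p : R * R => g (fst p) (snd p)) (x0, t)) ->
  (forall x t, Rabs (x - x0) < d -> a <= t <= b -> continuous (f x) t) ->
  is_derive (fun x => RInt (f x) a b) x0 (RInt (g x0) a b).
Proof.
  intros Hd Hab H1 H2 H3.
  assert (E : RInt (fun t => Derive (fun u => f u t) x0) a b = RInt (g x0) a b).
  { apply RInt_ext; rewrite Rmin_left, Rmax_right by trivial; intros t Ht.
    apply is_derive_unique, H1; [rewrite Rminus_diag, Rabs_R0|]; lra. }
  rewrite <- E; apply (is_derive_RInt_param f a b x0).
  - exists (mkposreal _ Hd); intros x Hx t; rewrite Rmin_left, Rmax_right by trivial; intros Ht.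
    exists (g x t); apply H1; [exact Hx|lra].
  - rewrite Rmin_left, Rmax_right by trivial; intros t Ht.
    apply continuity_2d_pt_ext_loc with g.
    + exists (mkposreal _ Hd); simpl; intros u v Hu Hv; symmetry.
      apply is_derive_unique, H1; trivial; apply Rabs_def2 in Hv; lra.
    + apply continuity_2d_pt_filterlim, (H2 t Ht).
  - exists (mkposreal _ Hd); intros x Hx; apply (ex_RInt_continuous (V := R_CompleteNormedModule)).
    rewrite Rmin_left, Rmax_right by trivial; intros t Ht; apply H3; trivial.
Qed.

(** If the derivative in the parameter is also a derivative in [t], the differentiated integral is a
    boundary term. For a closed circle it vanishes, which gives Cauchy's formula; for a radial
    segment it gives primitives. *)
Lemma CInt_param_derive (f g : R -> R -> C) (h : R -> C) (x0 a b d : R) :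
  0 < d -> a <= b ->
  (forall x t, Rabs (x - x0) < d -> a - d < t < b + d -> D1 (fun y => f y t) x (g x t)) ->
  (forall t, a <= t <= b -> continuous (fun p : R * R => g (fst p) (snd p)) (x0, t)) ->
  (forall x t, Rabs (x - x0) < d -> a <= t <= b -> continuous (f x) t) ->
  (forall t, a <= t <= b -> D1 h t (g x0 t)) ->
  D1 (fun x => CInt (f x) a b) x0 (h b - h a).
Proof.
  intros Hd Hab H1 H2 H3 H4.
  rewrite <- (CInt_derive h (g x0) a b Hab H4).
  - split.
    + apply (RInt_param_derive (fun x t => Re (f x t)) (fun x t => Re (g x t)) x0 a b d Hd Hab).
      * intros x t Hx Ht; apply (H1 x t Hx Ht).
      * intros t Ht; apply (continuous_Re (fun p : R * R => g (fst p) (snd p))), H2, Ht.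
      * intros x t Hx Ht; apply (continuous_Re (f x)), H3; trivial.
    + apply (RInt_param_derive (fun x t => Im (f x t)) (fun x t => Im (g x t)) x0 a b d Hd Hab).
      * intros x t Hx Ht; apply (H1 x t Hx Ht).
      * intros t Ht; apply (continuous_Im (fun p : R * R => g (fst p) (snd p))), H2, Ht.
      * intros x t Hx Ht; apply (continuous_Im (f x)), H3; trivial.
  - intros t Ht.
    apply (continuous_comp_2 (fun _ : R => x0) (fun s : R => s) g); [apply continuous_const|apply continuous_id|].
    apply (H2 t Ht).
Qed.

(** * Cauchy's formula and zeros of holomorphic functions *)

Definition cis (t : R) : C := (cos t, sin t).

Lemma Cmod_cis t : Cmod (cis t) = 1.
Proof.
  generalize (Cmod_ge_0 (cis t)) (Cmod2_alt (cis t)) (sin2_cos2 t); unfold Rsqr; simpl; nra.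
Qed.

Lemma cis_neq_0 t : cis t <> 0.
Proof. apply Cmod_gt_0; rewrite Cmod_cis; lra. Qed.

Lemma D1_cis t : D1 cis t (Ci * cis t).
Proof. split; unfold cis, Re, Im; simpl; auto_derive; trivial; ring. Qed.

Lemma D1_continuous f t l : D1 f t l -> continuous f t.
Proof.
  intros [H1 H2]; apply continuous_Re_Im;
   [apply (ex_derive_continuous (fun s => Re (f s)))|apply (ex_derive_continuous (fun s => Im (f s)))];
   eexists; eassumption.
Qed.

Lemma continuous_cis t : continuous cis t.
Proof. eapply D1_continuous, D1_cis. Qed.

Lemma cis_plus s t : cis (s + t) = (cis s * cis t)%C.
Proof. unfold cis; apply C_ext; unfold Re, Im; simpl; rewrite ?cos_plus, ?sin_plus; ring. Qed.

Lemma D1_affine (c m : C) (t : R) : D1 (fun s => c + s * m)%C t m.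
Proof. split; simpl; auto_derive; trivial; unfold Re, Im; ring. Qed.

Lemma D1_const_eq (G : R -> C) (a b : R) :
  a < b -> (forall x, a <= x <= b -> D1 G x 0) -> G a = G b.
Proof.
  intros Hab H; apply C_ext.
  - apply (eq_is_derive (fun s => Re (G s)) a b); trivial; intros; apply H; trivial.
  - apply (eq_is_derive (fun s => Im (G s)) a b); trivial; intros; apply H; trivial.
Qed.

Section Cauchy.

Variables (F F' : C -> C) (p : C) (r : R).
Hypothesis Hr : 0 < r.
Hypothesis HF : forall z, Cmod (z - p) < 3 * r -> sd F z (F' z).
Hypothesis HF' : forall z, Cmod (z - p) < 3 * r -> continuous F' z.

(** With [w = r * cis t], [dw / (w - a)] equals [Ci * r * ker a t * dt]: this is the Cauchy kernel
    up to a constant. *)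
Let ker (a : C) (t : R) : C := (cis t / (r * cis t - a))%C.

Lemma Cmod_r_cis t : Cmod (r * cis t) = r.
Proof. rewrite Cmod_mult, Cmod_cis, Cmod_R_pos by lra; ring. Qed.

Lemma ker_den a t : Cmod a < r -> (r * cis t - a)%C <> 0.
Proof.
  intros Ha; apply C_nonzero_of_Cmod.
  generalize (Cmod_triangle_rev (r * cis t) a); rewrite Cmod_r_cis; lra.
Qed.

Lemma continuous_r_cis t : continuous (fun s => r * cis s)%C t.
Proof. apply continuous_Cmult; [apply continuous_const|apply continuous_cis]. Qed.

Lemma continuous_ker a t : Cmod a < r -> continuous (ker a) t.
Proof.
  intros Ha; apply continuous_Cmult; [apply continuous_cis|].
  apply continuous_comp_Cinv; [apply ker_den, Ha|].
  apply continuous_Cminus; [apply continuous_r_cis|apply continuous_const].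
Qed.

(** The parameter runs over a neighbourhood of [[0, 1]] because the integral is differentiated at
    both ends; two terms of size at most [5 / 4 * r] explain the radius [3 * r] of the
    hypotheses. *)
Lemma homotopy_in_disk a x t : Cmod a < r -> - (1 / 4) < x < 5 / 4 ->
  Cmod (p + a + x * (r * cis t - a) - p) < 3 * r.
Proof.
  intros Ha Hx.
  replace (p + a + x * (r * cis t - a) - p)%C with ((1 - x)%R * a + x * (r * cis t))%C
    by (rewrite RtoC_minus; ring).
  eapply Rle_lt_trans; [apply Cmod_triangle|].
  rewrite !(Cmod_mult (RtoC _)), Cmod_cis, !Cmod_R, (Rabs_pos_eq r) by lra.
  assert (Rabs (1 - x) < 5 / 4) by (apply Rabs_def1; lra).
  assert (Rabs x < 5 / 4) by (apply Rabs_def1; lra).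
  generalize (Cmod_ge_0 a) (Rabs_pos (1 - x)) (Rabs_pos x); intros; nra.
Qed.

(** The circle is contracted to [p + a]. Along the contraction the integral is constant, since its
    derivative in [x] is the integral over a period of the derivative of a periodic function. The
    integral of the kernel remains as a factor and will only have to be nonzero. *)
Lemma cauchy_formula a : Cmod a < r ->
  CInt (fun t => F (p + r * cis t) * ker a t)%C 0 (2 * PI) = (F (p + a) * CInt (ker a) 0 (2 * PI))%C.
Proof.
  intros Ha.
  assert (HPI : 0 <= 2 * PI) by (generalize PI_RGT_0; lra).
  assert (H2PI : cis (2 * PI) = cis 0) by (unfold cis; rewrite cos_2PI, sin_2PI, cos_0, sin_0; trivial).
  set (f := fun x t : R => (F (p + a + x * (r * cis t - a)) * ker a t)%C).
  set (g := fun x t : R => (F' (p + a + x * (r * cis t - a)) * cis t)%C).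
  assert (Hin : forall x t, - (1 / 4) < x < 5 / 4 -> Cmod (p + a + x * (r * cis t - a) - p) < 3 * r)
    by (intros; apply homotopy_in_disk; trivial).
  assert (Hconst : CInt (f 0) 0 (2 * PI) = CInt (f 1) 0 (2 * PI)).
  { apply (D1_const_eq (fun x => CInt (f x) 0 (2 * PI))); [lra|]; intros x Hx.
    assert (Hxd : forall y, Rabs (y - x) < 1 / 4 -> - (1 / 4) < y < 5 / 4)
      by (intros y Hy; apply Rabs_def2 in Hy; lra).
    assert (Hh : exists h, h (2 * PI) = h 0 /\ forall t, D1 h t (g x t)).
    { destruct (Req_dec x 0) as [->|Hx0].
      - exists (fun t => F' (p + a) / Ci * cis t)%C; split; [rewrite H2PI; trivial|].
        intros t; replace (g 0 t) with (F' (p + a) / Ci * (Ci * cis t))%C.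
        + apply D1_mult_const, D1_cis.
        + unfold g; replace (p + a + 0 * (r * cis t - a))%C with (p + a)%C by ring.
          field; apply Ci_nz.
      - assert (Hxc : RtoC x <> 0) by (intros E; apply Hx0, RtoC_inj, E).
        assert (Hrc : RtoC r <> 0) by (intros E; apply RtoC_inj in E; lra).
        exists (fun t => / (Ci * x * r) * F (p + a + x * (r * cis t - a)))%C; split.
        + rewrite H2PI; trivial.
        + intros t.
          replace (g x t) with (/ (Ci * x * r) * (F' (p + a + x * (r * cis t - a)) * (x * r * (Ci * cis t))))%C
            by (unfold g; field; repeat split; trivial; apply Ci_nz).
          apply D1_mult_const.
          apply (D1_comp F (fun t => p + a + x * (r * cis t - a))%C).
          * apply HF, Hin; lra.
          * apply (D1_comp (fun w => p + a + x * (r * w - a))%C cis); [|apply D1_cis].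
            apply (sd_ext (fun w => x * r * w + (p + a - x * a))%C); [intros; ring|].
            apply (sd_eq _ _ (x * r * 1 + 0)%C); [|ring].
            apply sd_plus; [apply sd_scal, sd_id|apply sd_const]. }
    destruct Hh as [h [Hper Hh]].
    replace (RtoC 0) with (h (2 * PI)%R - h 0)%C by (rewrite Hper; ring).
    apply (CInt_param_derive f g h x 0 (2 * PI) (1 / 4)); trivial; try lra.
    - intros y t Hy Ht; unfold f, g.
      replace (F' (p + a + y * (r * cis t - a)) * cis t)%C with
        (ker a t * (F' (p + a + y * (r * cis t - a)) * (r * cis t - a)))%C
        by (unfold ker; field; apply ker_den, Ha).
      assert (HD := D1_mult_const (ker a t) (fun y => F (p + a + y * (r * cis t - a))) y
         (F' (p + a + y * (r * cis t - a)) * (r * cis t - a))%C).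
      assert (Hext : forall u v : R -> C, (forall s, u s = v s) -> forall s l, D1 u s l -> D1 v s l).
      { intros u v Huv s l [K1 K2]; split; eapply is_derive_ext; try eassumption;
         intros; simpl; rewrite Huv; trivial. }
      eapply Hext; [|apply HD]; [intros; simpl; ring|].
      apply (D1_comp F (fun y => p + a + y * (r * cis t - a))%C); [apply HF, Hin, Hxd, Hy|].
      apply D1_affine.
    - intros t Ht; unfold g.
      assert (Hc2 : continuous (fun q : R * R => cis (snd q)) (x, t)).
      { apply (continuous_comp snd cis); [apply continuous_snd|apply continuous_cis]. }
      apply continuous_Cmult; trivial.
      apply (continuous_comp (fun q : R * R => p + a + fst q * (r * cis (snd q) - a))%C F').
      + apply continuous_Cplus; [apply continuous_const|].
        apply continuous_Cmult; [apply continuous_RtoC, continuous_fst|].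
        apply continuous_Cminus; [|apply continuous_const].
        apply continuous_Cmult; [apply continuous_const|trivial].
      + apply HF', Hin; simpl; lra.
    - intros y t Hy Ht; unfold f; apply continuous_Cmult; [|apply continuous_ker, Ha].
      apply (continuous_comp (fun t => p + a + y * (r * cis t - a))%C F).
      + apply continuous_Cplus; [apply continuous_const|].
        apply continuous_Cmult; [apply continuous_const|].
        apply continuous_Cminus; [apply continuous_r_cis|apply continuous_const].
      + eapply sd_continuous, HF, Hin, Hxd, Hy. }
  transitivity (CInt (f 1) 0 (2 * PI)).
  - apply CInt_ext; trivial; intros t _; unfold f; do 2 f_equal; ring.
  - rewrite <- Hconst, <- CInt_mult_const by (trivial; intros; apply continuous_ker, Ha).
    apply CInt_ext; trivial; intros t _; unfold f; do 2 f_equal; ring.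
Qed.

(** Up to the factor coming from the kernel, [cf n] is the Taylor coefficient of [F] at [p], and
    [a ^ n * T n a] is the remainder after the first [n] terms. *)
Let T (n : nat) (a : C) : C :=
  CInt (fun t => F (p + r * cis t) * (/ (r * cis t)) ^ n * ker a t)%C 0 (2 * PI).
Let cf (n : nat) : C :=
  CInt (fun t => F (p + r * cis t) * (/ (r * cis t)) ^ n * / r)%C 0 (2 * PI).

Lemma r_cis_neq_0 t : (r * cis t)%C <> 0.
Proof. apply C_nonzero_of_Cmod; rewrite Cmod_r_cis; lra. Qed.

Lemma circle_in_disk t : Cmod (p + r * cis t - p) < 3 * r.
Proof. replace (p + r * cis t - p)%C with (r * cis t)%C by ring; rewrite Cmod_r_cis; lra. Qed.

Lemma continuous_F_circle t : continuous (fun t => F (p + r * cis t)) t.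
Proof.
  apply (continuous_comp (fun t => p + r * cis t)%C F).
  - apply continuous_Cplus; [apply continuous_const|apply continuous_r_cis].
  - eapply sd_continuous, HF, circle_in_disk.
Qed.

Lemma continuous_coef n t : continuous (fun t => F (p + r * cis t) * (/ (r * cis t)) ^ n)%C t.
Proof.
  apply continuous_Cmult; [apply continuous_F_circle|].
  induction n as [|n IH]; simpl; [apply continuous_const|].
  apply continuous_Cmult; trivial.
  apply continuous_comp_Cinv; [apply r_cis_neq_0|apply continuous_r_cis].
Qed.

(** This integrates the identity [ker a t = / r + a * / (r * cis t) * ker a t]. *)
Lemma T_rec n a : Cmod a < r -> T n a = (cf n + a * T (S n) a)%C.
Proof.
  intros Ha.
  assert (HPI : 0 <= 2 * PI) by (generalize PI_RGT_0; lra).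
  assert (Hrc : RtoC r <> 0) by (intros E; apply RtoC_inj in E; lra).
  unfold T, cf; rewrite <- CInt_mult_const, <- CInt_plus; trivial.
  - apply CInt_ext; trivial; intros t _.
    rewrite Cpow_S; unfold ker; field; repeat split; first [exact Hrc|apply cis_neq_0|apply ker_den; lra].
  - intros t _; apply continuous_Cmult; [apply continuous_coef|apply continuous_const].
  - intros t _; apply continuous_Cmult; [apply continuous_const|].
    apply continuous_Cmult; [apply (continuous_coef (S n))|apply continuous_ker, Ha].
  - intros t _; apply continuous_Cmult; [apply (continuous_coef (S n))|apply continuous_ker, Ha].
Qed.

Lemma Cmod_ker a t : Cmod a <= r / 10 -> Cmod (ker a t) <= 10 / (9 * r).
Proof.
  intros Ha; unfold ker; rewrite Cmod_div by (apply ker_den; lra).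
  rewrite Cmod_cis; unfold Rdiv; rewrite Rmult_1_l.
  replace (10 * / (9 * r)) with (/ (9 * r / 10)) by (field; lra).
  apply Rinv_le_contravar; [lra|].
  generalize (Cmod_triangle_rev (r * cis t) a); rewrite Cmod_r_cis; lra.
Qed.

Lemma T_bound : exists M, 0 < M /\ forall n a, Cmod a <= r / 10 -> Cmod (T n a) <= M * (/ r) ^ n.
Proof.
  assert (HPI : 0 < 2 * PI) by (generalize PI_RGT_0; lra).
  destruct (compact_upper_bound (fun z => Cmod z <= r) (fun z => Cmod (F (p + z)))) as [M [HM HF1]].
  - apply compact_disk.
  - intros z Hz; apply (continuous_comp (fun z => F (p + z)%C) Cmod); [|apply continuous_Cmod].
    apply (continuous_comp (fun z : C => (p + z)%C) F).
    + apply continuous_Cplus; [apply continuous_const|apply continuous_id].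
    + eapply sd_continuous, HF; replace (p + z - p)%C with z by ring; lra.
  - exists (2 * (M * (10 / (9 * r))) * (2 * PI)); split.
    + repeat (apply Rmult_lt_0_compat; try lra); apply Rinv_0_lt_compat; lra.
    + intros n a Ha.
      replace (2 * (M * (10 / (9 * r))) * (2 * PI) * (/ r) ^ n)
        with (2 * (M * (/ r) ^ n * (10 / (9 * r))) * (2 * PI - 0)) by ring.
      apply CInt_bound; [lra| |].
      * intros t _; apply continuous_Cmult; [apply continuous_coef|apply continuous_ker; lra].
      * intros t _; rewrite !Cmod_mult, Cmod_pow, Cmod_inv by apply r_cis_neq_0.
        rewrite Cmod_r_cis.
        assert (0 < (/ r) ^ n) by (apply pow_lt, Rinv_0_lt_compat; lra).
        apply Rmult_le_compat; [| apply Cmod_ge_0| |apply Cmod_ker, Ha].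
        { apply Rmult_le_pos; [apply Cmod_ge_0|lra]. }
        apply Rmult_le_compat_r; [lra|]; left; apply HF1; rewrite Cmod_r_cis; lra.
Qed.

(** The same splitting of the kernel gives [2 * PI / r] plus an error which, for [a] of modulus at
    most [r / 10], is at most [4 / 9 * (PI / r)]. *)
Lemma ker_integral_neq_0 a : Cmod a <= r / 10 -> CInt (ker a) 0 (2 * PI) <> 0.
Proof.
  intros Ha.
  assert (HPI : 0 < 2 * PI) by (generalize PI_RGT_0; lra).
  assert (Hrc : RtoC r <> 0) by (intros E; apply RtoC_inj in E; lra).
  assert (E : CInt (ker a) 0 (2 * PI) =
     (CInt (fun _ => / r)%C 0 (2 * PI) + CInt (fun t => a * / (r * cis t) * ker a t)%C 0 (2 * PI))%C).
  { rewrite <- CInt_plus.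
    - apply CInt_ext; [lra|]; intros t _; unfold ker; field; repeat split; first [exact Hrc|apply cis_neq_0|apply ker_den; lra].
    - lra.
    - intros; apply continuous_const.
    - intros t _; apply continuous_Cmult; [|apply continuous_ker; lra].
      apply continuous_Cmult; [apply continuous_const|].
      apply continuous_comp_Cinv; [apply r_cis_neq_0|apply continuous_r_cis]. }
  assert (E1 : CInt (fun _ => / r)%C 0 (2 * PI) = RtoC (2 * PI / r)).
  { rewrite <- RtoC_inv by lra.
    apply C_ext; simpl; rewrite RInt_const; unfold scal; simpl; unfold mult; simpl; field; lra. }
  assert (B : Cmod (CInt (fun t => a * / (r * cis t) * ker a t)%C 0 (2 * PI)) <=
     2 * (1 / 10 * (10 / (9 * r))) * (2 * PI - 0)).
  { apply CInt_bound; [lra| |].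
    - intros t _; apply continuous_Cmult; [|apply continuous_ker; lra].
      apply continuous_Cmult; [apply continuous_const|].
      apply continuous_comp_Cinv; [apply r_cis_neq_0|apply continuous_r_cis].
    - intros t _; rewrite !Cmod_mult, Cmod_inv, Cmod_r_cis by apply r_cis_neq_0.
      assert (0 < / r) by (apply Rinv_0_lt_compat; lra).
      apply Rmult_le_compat; [|apply Cmod_ge_0| |apply Cmod_ker, Ha].
      + apply Rmult_le_pos; [apply Cmod_ge_0|lra].
      + replace (1 / 10) with (r / 10 * / r) by (field; lra); apply Rmult_le_compat_r; lra. }
  intros E0; rewrite E0, E1 in E.
  assert (E2 : CInt (fun t => a * / (r * cis t) * ker a t)%C 0 (2 * PI) = (- RtoC (2 * PI / r))%C).
  { transitivity (0 - RtoC (2 * PI / r))%C; [rewrite E|]; ring. }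
  rewrite E2, Cmod_opp, Cmod_R, Rabs_pos_eq in B.
  - assert (2 * PI / r <= 4 / 9 * (PI / r)).
    { replace (4 / 9 * (PI / r)) with (2 * (1 / 10 * (10 / (9 * r))) * (2 * PI - 0)); [trivial|field; lra]. }
    assert (0 < PI / r) by (apply Rdiv_lt_0_compat; lra).
    unfold Rdiv in *; lra.
  - left; apply Rdiv_lt_0_compat; lra.
Qed.

(** If every [cf k] vanishes, the value at [a] is bounded by a constant times [(1 / 10) ^ N] for all
    [N]. Otherwise, with [m] the first index where [cf m] is nonzero, the value is
    [a ^ m * (cf m + a * T (S m) a)] up to the kernel factor, and [cf m] dominates for small [a]. *)
Lemma isolated_zero_aux :
  (forall a, Cmod a <= r / 10 -> F (p + a) = 0) \/
  exists d, 0 < d /\ forall a, 0 < Cmod a < d -> F (p + a) <> 0.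
Proof.
  destruct T_bound as [M [HM HT]].
  assert (HT0 : forall a, Cmod a <= r / 10 -> (F (p + a) * CInt (ker a) 0 (2 * PI))%C = T 0 a).
  { intros a Ha; rewrite <- cauchy_formula by lra; unfold T.
    apply CInt_ext; [generalize PI_RGT_0; lra|]; intros; simpl; ring. }
  assert (Hpow : forall m, (forall k, (k < m)%nat -> cf k = 0) ->
    forall a, Cmod a <= r / 10 -> T 0 a = (a ^ m * T m a)%C).
  { induction m as [|m IH]; intros Hk a Ha; [simpl; ring|].
    rewrite IH by (trivial; intros; apply Hk; lia).
    rewrite (T_rec m a) by lra; rewrite Hk by lia; rewrite Cpow_S; ring. }
  destruct (classic (exists n, cf n <> 0)) as [Hex|Hno].
  - right.
    destruct (dec_inh_nat_subset_has_unique_least_element (fun n => cf n <> 0)) as [m [[Hm Hmin] _]];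
      [intros; apply classic|trivial|].
    assert (Hk : forall k, (k < m)%nat -> cf k = 0).
    { intros k Hk; apply NNPP; intros H; specialize (Hmin k H); lia. }
    assert (Hc : 0 < Cmod (cf m)) by (apply Cmod_gt_0, Hm).
    set (B := M * (/ r) ^ S m).
    assert (HB : 0 < B) by (apply Rmult_lt_0_compat; trivial; apply pow_lt, Rinv_0_lt_compat; lra).
    exists (Rmin (r / 10) (Cmod (cf m) / B)); split.
    + apply Rmin_pos; [lra|apply Rdiv_lt_0_compat; lra].
    + intros a [Ha0 Ha] HF0.
      assert (Ha1 : Cmod a <= r / 10) by (generalize (Rmin_l (r / 10) (Cmod (cf m) / B)); lra).
      assert (Ha2 : Cmod a < Cmod (cf m) / B) by (generalize (Rmin_r (r / 10) (Cmod (cf m) / B)); lra).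
      generalize (HT0 a Ha1); rewrite HF0, Cmult_0_l, (Hpow m Hk a Ha1); intros E.
      assert (E' : (cf m + a * T (S m) a)%C = 0).
      { rewrite <- T_rec by lra; apply NNPP; intros Hn; symmetry in E; revert E.
        apply Cmult_neq_0; trivial; apply Cpow_nz, C_nonzero_of_Cmod, Ha0. }
      assert (E2 : cf m = (- (a * T (S m) a))%C)
        by (transitivity (cf m + a * T (S m) a - a * T (S m) a)%C; [ring|rewrite E'; ring]).
      assert (Cmod (cf m) <= Cmod a * B).
      { rewrite E2, Cmod_opp, Cmod_mult; apply Rmult_le_compat_l; [lra|apply HT, Ha1]. }
      assert (Cmod a * B < Cmod (cf m)); [|lra].
      replace (Cmod (cf m)) with (Cmod (cf m) / B * B) by (field; lra).
      apply Rmult_lt_compat_r; trivial.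
  - left; intros a Ha.
    assert (Hz : (F (p + a) * CInt (ker a) 0 (2 * PI))%C = 0).
    { apply Cmod_eq_0, Rle_antisym; [|apply Cmod_ge_0]; apply Rnot_lt_le; intros Hpos.
      set (x := Cmod (F (p + a) * CInt (ker a) 0 (2 * PI))%C) in *.
      destruct (pow_lt_1_zero (1 / 10)) with (y := x / M) as [N HN].
      - rewrite Rabs_pos_eq; lra.
      - apply Rdiv_lt_0_compat; lra.
      - specialize (HN N (le_n N)).
        assert (x <= M * (1 / 10) ^ N).
        { unfold x; rewrite HT0, (Hpow N) by (trivial; intros k _; apply NNPP; intros Hc; apply Hno; exists k; trivial).
          rewrite Cmod_mult, Cmod_pow.
          apply Rle_trans with (Cmod a ^ N * (M * (/ r) ^ N)).
          - apply Rmult_le_compat_l; [apply pow_le, Cmod_ge_0|apply HT, Ha].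
          - replace (Cmod a ^ N * (M * (/ r) ^ N)) with (M * (Cmod a * / r) ^ N) by (rewrite Rpow_mult_distr; ring).
            apply Rmult_le_compat_l; [lra|]; apply pow_incr; split.
            + apply Rmult_le_pos; [apply Cmod_ge_0|left; apply Rinv_0_lt_compat; lra].
            + replace (1 / 10) with (r / 10 * / r) by (field; lra).
              apply Rmult_le_compat_r; [left; apply Rinv_0_lt_compat; lra|trivial]. }
        rewrite Rabs_pos_eq in HN by (apply pow_le; lra).
        assert (M * (1 / 10) ^ N < x); [|lra].
        replace x with (M * (x / M)) by (field; lra).
        apply Rmult_lt_compat_l; trivial. }
    apply NNPP; intros Hn; revert Hz; apply Cmult_neq_0; trivial; apply ker_integral_neq_0, Ha.
Qed.

End Cauchy.

Lemma isolated_zeros (F F' : C -> C) (p : C) (R0 : R) :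
  0 < R0 -> (forall z, Cmod (z - p) < R0 -> sd F z (F' z)) ->
  (forall z, Cmod (z - p) < R0 -> continuous F' z) ->
  (forall z, Cmod (z - p) <= R0 / 30 -> F z = 0) \/
  exists d, 0 < d /\ forall z, 0 < Cmod (z - p) < d -> F z <> 0.
Proof.
  intros HR HF HF'.
  destruct (isolated_zero_aux F F' p (R0 / 3)) as [H|[d [Hd H]]].
  - lra.
  - intros z Hz; apply HF; lra.
  - intros z Hz; apply HF'; lra.
  - left; intros z Hz; replace z with (p + (z - p))%C by ring; apply H; lra.
  - right; exists d; split; trivial; intros z Hz; replace z with (p + (z - p))%C by ring; apply H; lra.
Qed.

Definition holo (D : sdomain) (F F' : C -> C) : Prop :=
  forall z, in_dom D z -> sd F z (F' z) /\ continuous F' z.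

(** The radius [R0 / 30] is the same for all [q] in the disk of radius [rho], so vanishing can be
    propagated by steps of fixed length. *)
Lemma holo_locally_zero D F F' (rho R0 : R) q :
  holo D F F' -> 0 < R0 -> (forall z, Cmod z < rho + R0 -> in_dom D z) -> Cmod q <= rho ->
  (exists d, 0 < d /\ forall z, Cmod (z - q) < d -> F z = 0) ->
  forall z, Cmod (z - q) <= R0 / 30 -> F z = 0.
Proof.
  intros HF HR HD Hq [d [Hd Hz]].
  assert (HB : forall z, Cmod (z - q) < R0 -> in_dom D z).
  { intros z H; apply HD; generalize (Cmod_triangle_rev' z q); lra. }
  destruct (isolated_zeros F F' q R0) as [H|[e [He H]]]; trivial.
  - intros z H; apply HF, HB, H.
  - intros z H; apply HF, HB, H.
  - exfalso; set (m := Rmin d e); assert (Hm : 0 < m) by (apply Rmin_pos; trivial).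
    assert (E : Cmod (q + (m / 2)%R - q) = m / 2).
    { replace (q + (m / 2)%R - q)%C with (RtoC (m / 2)) by ring; apply Cmod_R_pos; lra. }
    apply (H (q + (m / 2)%R)%C).
    + rewrite E; generalize (Rmin_r d e); unfold m in *; lra.
    + apply Hz; rewrite E; generalize (Rmin_l d e); unfold m in *; lra.
Qed.

(** Vanishing is propagated along the segment from [p] to [z], which stays in a disk by convexity,
    through finitely many equally spaced points. *)
Lemma holo_identity D F F' p :
  holo D F F' -> in_dom D p -> (exists d, 0 < d /\ forall z, Cmod (z - p) < d -> F z = 0) ->
  forall z, in_dom D z -> F z = 0.
Proof.
  intros HF Hp H0 z Hz.
  destruct (in_dom_rad D p Hp) as [n Hn], (in_dom_rad D z Hz) as [m Hm].
  set (rho := Rmax (Cmod p) (Cmod z)); set (k := (n + m)%nat).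
  assert (Hk1 : rad D n <= rad D k) by (apply rad_le; unfold k; lia).
  assert (Hk2 : rad D m <= rad D k) by (apply rad_le; unfold k; lia).
  assert (Hrho : rho < rad D k) by (apply Rmax_lub_lt; lra).
  set (R0 := rad D k - rho).
  assert (HR0 : 0 < R0) by (unfold R0; lra).
  assert (HD : forall w, Cmod w < rho + R0 -> in_dom D w).
  { intros w Hw; apply (rad_in_dom D k); unfold R0 in Hw; lra. }
  (* [R0 / 60] makes the steps strictly shorter than [R0 / 30], leaving a neighbourhood of the next
     point where [F] vanishes. *)
  destruct (INR_unbounded (Cmod (z - p) / (R0 / 60))) as [N0 HN0].
  set (N := INR N0 + 1); assert (HN : 0 < N) by (generalize (pos_INR N0); unfold N; lra).
  assert (Hstep : Cmod (z - p) / N < R0 / 30).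
  { assert (Cmod (z - p) < N * (R0 / 60)); [|apply Rmult_lt_reg_r with N; [lra|]; field_simplify; [nra|lra]].
    apply Rle_lt_trans with (Cmod (z - p) / (R0 / 60) * (R0 / 60)); [right; field; lra|].
    apply Rmult_lt_compat_r; [|unfold N]; lra. }
  pose (q := fun i : nat => (p + (INR i / N)%R * (z - p))%C).
  assert (Hq : forall i, INR i <= N -> Cmod (q i) <= rho).
  { intros i Hi; unfold q.
    assert (Hx : 0 <= INR i / N <= 1).
    { split; [apply Rmult_le_pos; [apply pos_INR|left; apply Rinv_0_lt_compat; lra]|].
      apply Rmult_le_reg_r with N; [lra|]; field_simplify; lra. }
    set (x := INR i / N) in *.
    replace (p + x * (z - p))%C with ((1 - x)%R * p + x * z)%C by (rewrite RtoC_minus; ring).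
    eapply Rle_trans; [apply Cmod_triangle|].
    rewrite !Cmod_mult, !Cmod_R_pos by lra.
    generalize (Rmax_l (Cmod p) (Cmod z)) (Rmax_r (Cmod p) (Cmod z)); fold rho; intros; nra. }
  assert (Hall : forall i, INR i <= N -> exists d, 0 < d /\ forall w, Cmod (w - q i) < d -> F w = 0).
  { induction i as [|i IH]; intros Hi.
    - replace (q 0%nat) with p; [exact H0|].
      unfold q; simpl; replace (0 / N) with 0 by (field; lra); ring.
    - rewrite S_INR in Hi.
      assert (Hqq : Cmod (q (S i) - q i) = Cmod (z - p) / N).
      { replace (q (S i) - q i)%C with ((/ N)%R * (z - p))%C.
        - rewrite Cmod_mult, Cmod_R_pos by (left; apply Rinv_0_lt_compat; lra).
          unfold Rdiv; ring.
        - unfold q; rewrite S_INR; replace ((INR i + 1) / N) with (INR i / N + / N) by (field; lra).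
          rewrite RtoC_plus; ring. }
      exists (R0 / 30 - Cmod (q (S i) - q i)); split; [lra|].
      intros w Hw; apply (holo_locally_zero D F F' rho R0 (q i)); trivial.
      + apply Hq; lra.
      + apply IH; lra.
      + generalize (Cmod_triangle_rev' (w - q i) (q (S i) - q i)).
        replace (w - q i - (q (S i) - q i))%C with (w - q (S i))%C by ring; lra. }
  destruct (Hall (S N0)) as [d [Hd H]]; [rewrite S_INR; unfold N; lra|].
  apply H; replace (q (S N0)) with z; [rewrite Cmod_self; trivial|].
  unfold q; rewrite S_INR; fold N; replace (N / N) with 1 by (field; lra); ring.
Qed.

(** A closed disk contains finitely many zeros, and a subinterval of radii can be chosen to miss all
    their moduli. *)
Lemma nonvanishing_annulus D F F' n r r' :
  holo D F F' -> (exists z, in_dom D z /\ F z <> 0) -> r < r' -> r' <= rad D n ->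
  exists s s' m, r < s /\ s < s' /\ s' < r' /\ 0 < m /\
    forall z, s <= Cmod z <= s' -> m < Cmod (F z).
Proof.
  intros HF [z0 [Hz0 HF0]] Hr Hn.
  (* The cover is indexed by points [p]: a member consists of the [w] near which [p] is the only
     possible zero. A finite subcover lists all zeros. *)
  destruct (compact_disk r' C (fun p w => locally w (fun v => F v = 0 -> v = p))) as [l Hl].
  - intros p w Hw; apply locally_locally, Hw.
  - intros z Hz; exists z.
    assert (HDz : in_dom D z) by (apply (rad_in_dom D n); lra).
    destruct (in_dom_open D z HDz) as [R0 [HR0 HD]].
    apply locally_Cmod.
    destruct (isolated_zeros F F' z R0 HR0) as [H|[d [Hd H]]].
    + intros w Hw; apply HF, HD, Hw.
    + intros w Hw; apply HF, HD, Hw.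
    + exfalso; apply HF0, (holo_identity D F F' z HF HDz); trivial.
      exists (R0 / 30); split; [lra|]; intros w Hw; apply H; lra.
    + exists d; split; trivial; intros w Hw Hw0.
      apply NNPP; intros Hne; apply (H w); trivial; split; trivial.
      apply Cmod_gt_0, Cminus_eq_contra, Hne.
  - destruct (subinterval_avoiding_list (map Cmod l) r r' Hr) as (s & s' & H1 & H2 & H3 & H4).
    destruct (compact_pos_lower_bound (fun z => s <= Cmod z <= s') (fun z => Cmod (F z))) as [m [Hm HmF]].
    + apply compact_annulus.
    + intros z Hz; apply (continuous_comp F Cmod); [|apply continuous_Cmod].
      eapply sd_continuous, HF, (rad_in_dom D n); lra.
    + intros z Hz; apply Cmod_gt_0; intros E.
      destruct (Hl z) as [p [Hp Hloc]]; [lra|].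
      apply locally_singleton in Hloc.
      apply (H4 (Cmod z)); trivial; rewrite (Hloc E); apply in_map, Hp.
    + exists s, s', m; repeat split; trivial.
Qed.

(** * Holomorphic functions and harmonic functions *)

(** Twice the Wirtinger derivative; for harmonic [g], [dz'] below is its complex derivative. *)
Definition dz (g : C -> R) (z : C) : C := (pu g z, - pv g z).
Definition dz' (g : C -> R) (z : C) : C := (pu (pu g) z, - pu (pv g) z).

Lemma continuous_pair (f g : C -> R) z :
  continuous f z -> continuous g z -> continuous (fun w => (f w, g w) : C) z.
Proof. intros; apply (continuous_Re_Im (fun w => (f w, g w) : C)); trivial. Qed.

Lemma mixed_partials D g z : C2_on (in_dom D) g -> in_dom D z -> pv (pu g) z = pu (pv g) z.
Proof.
  intros (H & Hu & Hv) Hz; destruct z as [x y].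
  symmetry; apply (Schwarz (fun u v => g (u, v)) x y).
  - destruct (in_dom_open D _ Hz) as [r [Hr Hd]].
    assert (Hr2 : 0 < r / 2) by lra.
    exists (mkposreal _ Hr2); simpl; intros u v Hu1 Hv1.
    assert (Huv : in_dom D (u, v)).
    { apply Hd; eapply Rle_lt_trans; [apply Cmod_le_Re_Im|]; simpl; unfold Rminus in *; lra. }
    split; [apply (H _ Huv)|split; [apply (H _ Huv)|split]].
    + apply (Hv _ Huv).
    + apply (Hu _ Huv).
  - apply continuity_2d_pt_filterlim; destruct (Hv _ Hz) as (_ & _ & _ & K & _).
    exact (continuous_ext _ (pu (pv g)) (x, y) (fun p => eq_refl) K).
  - apply continuity_2d_pt_filterlim; destruct (Hu _ Hz) as (_ & _ & _ & _ & K).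
    exact (continuous_ext _ (pv (pu g)) (x, y) (fun p => eq_refl) K).
Qed.

(** Of the two Cauchy-Riemann equations for [dz g], one is Laplace's equation and the other the
    symmetry of the mixed partials. *)
Lemma holo_of_harmonic D g : harmonic_on (in_dom D) g -> holo D (dz g) (dz' g).
Proof.
  intros [HC2 Hlap]; assert (HC2' := HC2); destruct HC2 as (H & Hu & Hv).
  assert (Hc : forall z, in_dom D z -> continuous (dz' g) z).
  { intros z Hz; apply continuous_pair.
    - apply (Hu z Hz).
    - apply continuous_Ropp, (Hv z Hz). }
  intros z Hz; split; [|apply Hc, Hz].
  apply sd_of_partials; [|apply Hc, Hz].
  destruct (in_dom_open D z Hz) as [r [Hr Hd]]; exists r; split; trivial.
  intros w Hw; specialize (Hd w Hw).
  destruct (Hu w Hd) as (U1 & U2 & _), (Hv w Hd) as (V1 & V2 & _).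
  split; split; simpl.
  - apply Derive_correct, U1.
  - apply (is_derive_opp (fun t => pv g (t, snd w))), Derive_correct, V1.
  - replace (0 * pu (pu g) w - 1 * - pu (pv g) w) with (pv (pu g) w)
      by (rewrite (mixed_partials D g w HC2' Hd); ring).
    apply Derive_correct, U2.
  - replace (0 * - pu (pv g) w + 1 * pu (pu g) w) with (- pv (pv g) w)
      by (generalize (Hlap w Hd); lra).
    apply (is_derive_opp (fun t => pv g (fst w, t))), Derive_correct, V2.
Qed.

Lemma Cmod_horizontal (t : R) (z : C) : Cmod ((t, snd z) - z) = Rabs (t - fst z).
Proof. rewrite <- Cmod_R; f_equal; apply C_ext; unfold Re, Im; simpl; ring. Qed.

Lemma Cmod_vertical (t : R) (z : C) : Cmod ((fst z, t) - z) = Rabs (t - snd z).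
Proof.
  rewrite <- Cmod_R, <- (Rmult_1_l (Cmod (RtoC _))), <- Cmod_Ci, <- Cmod_mult; f_equal.
  apply C_ext; unfold Re, Im; simpl; ring.
Qed.

(** [g] is compared with a model [h] on the domain only, because the lemma is applied again to
    [pu g] and [pv g], whose formulas hold only there. Openness of the domain makes this enough for
    derivatives. *)
Lemma C1_of_partials D (g h p q : C -> R) :
  (forall z, in_dom D z -> g z = h z) ->
  (forall z, in_dom D z -> is_derive (fun t => h (t, snd z)) (fst z) (p z) /\
     is_derive (fun t => h (fst z, t)) (snd z) (q z)) ->
  (forall z, in_dom D z -> continuous h z /\ continuous p z /\ continuous q z) ->
  C1_on (in_dom D) g /\ forall z, in_dom D z -> pu g z = p z /\ pv g z = q z.
Proof.
  intros Hgh Hd Hc.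
  assert (Hloc : forall z, in_dom D z -> locally z (in_dom D))
    by (intros z Hz; apply locally_Cmod, in_dom_open, Hz).
  assert (Hd' : forall z, in_dom D z -> is_derive (fun t => g (t, snd z)) (fst z) (p z) /\
     is_derive (fun t => g (fst z, t)) (snd z) (q z)).
  { intros z Hz; destruct (in_dom_open D z Hz) as [r [Hr Hb]]; split.
    - apply (is_derive_ext_loc (fun t => h (t, snd z))); [|apply Hd, Hz].
      exists (mkposreal _ Hr); intros t Ht; symmetry; apply Hgh, Hb.
      eapply Rle_lt_trans; [right; apply Cmod_horizontal|apply Ht].
    - apply (is_derive_ext_loc (fun t => h (fst z, t))); [|apply Hd, Hz].
      exists (mkposreal _ Hr); intros t Ht; symmetry; apply Hgh, Hb.
      eapply Rle_lt_trans; [right; apply Cmod_vertical|apply Ht]. }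
  assert (Hpq : forall z, in_dom D z -> pu g z = p z /\ pv g z = q z).
  { intros z Hz; destruct (Hd' z Hz); split; apply is_derive_unique; trivial. }
  assert (Hext : forall f1 f2 : C -> R, (forall z, in_dom D z -> f1 z = f2 z) ->
    forall z, in_dom D z -> continuous f1 z -> continuous f2 z).
  { intros f1 f2 H z Hz; apply continuous_ext_loc.
    apply filter_imp with (2 := Hloc z Hz); intros; apply H; trivial. }
  split; trivial; intros z Hz; destruct (Hc z Hz) as (C1 & C2 & C3); repeat split.
  - exists (p z); apply Hd', Hz.
  - exists (q z); apply Hd', Hz.
  - apply (Hext h g); trivial; intros; symmetry; auto.
  - apply (Hext p (pu g)); trivial; intros; symmetry; apply Hpq; trivial.
  - apply (Hext q (pv g)); trivial; intros; symmetry; apply Hpq; trivial.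
Qed.

Lemma sd_partials_Re P z l : sd P z l ->
  is_derive (fun t => Re (P (t, snd z))) (fst z) (Re l) /\
  is_derive (fun t => Re (P (fst z, t))) (snd z) (- Im l).
Proof.
  intros H; destruct (sd_partials P z l H) as [[A _] [B _]]; split; trivial.
  replace (- Im l) with (Re (Ci * l)); trivial; unfold Re, Im; simpl; ring.
Qed.

Lemma sd_partials_Im P z l : sd P z l ->
  is_derive (fun t => Im (P (t, snd z))) (fst z) (Im l) /\
  is_derive (fun t => Im (P (fst z, t))) (snd z) (Re l).
Proof.
  intros H; destruct (sd_partials P z l H) as [[_ A] [_ B]]; split; trivial.
  replace (Re l) with (Im (Ci * l)); trivial; unfold Re, Im; simpl; ring.
Qed.

Lemma harmonic_Re D P F F' :
  (forall z, in_dom D z -> sd P z (F z)) -> holo D F F' ->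
  harmonic_on (in_dom D) (fun z => Re (P z)) /\
  forall z, in_dom D z -> pu (fun z => Re (P z)) z = Re (F z) /\ pv (fun z => Re (P z)) z = - Im (F z).
Proof.
  intros HP HF.
  assert (HcF : forall z, in_dom D z -> continuous F z)
    by (intros z Hz; eapply sd_continuous, HF, Hz).
  assert (HcF' : forall z, in_dom D z -> continuous F' z) by (intros z Hz; apply HF, Hz).
  destruct (C1_of_partials D (fun z => Re (P z)) (fun z => Re (P z)) (fun z => Re (F z)) (fun z => - Im (F z)))
    as [G1 G2]; trivial.
  { intros z Hz; apply sd_partials_Re, HP, Hz. }
  { intros z Hz; repeat split.
    - eapply continuous_Re, sd_continuous, HP, Hz.
    - apply continuous_Re, HcF, Hz.
    - apply continuous_Ropp, continuous_Im, HcF, Hz. }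
  destruct (C1_of_partials D (pu (fun z => Re (P z))) (fun z => Re (F z))
     (fun z => Re (F' z)) (fun z => - Im (F' z))) as [U1 U2].
  { intros z Hz; apply G2, Hz. }
  { intros z Hz; apply sd_partials_Re, HF, Hz. }
  { intros z Hz; repeat split.
    - apply continuous_Re, HcF, Hz.
    - apply continuous_Re, HcF', Hz.
    - apply continuous_Ropp, continuous_Im, HcF', Hz. }
  destruct (C1_of_partials D (pv (fun z => Re (P z))) (fun z => - Im (F z))
     (fun z => - Im (F' z)) (fun z => - Re (F' z))) as [V1 V2].
  { intros z Hz; apply G2, Hz. }
  { intros z Hz; destruct (sd_partials_Im F z _ (proj1 (HF z Hz))) as [K1 K2]; split.
    - apply (is_derive_opp (fun t => Im (F (t, snd z)))), K1.
    - apply (is_derive_opp (fun t => Im (F (fst z, t)))), K2. }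
  { intros z Hz; repeat split; apply continuous_Ropp.
    - apply continuous_Im, HcF, Hz.
    - apply continuous_Im, HcF', Hz.
    - apply continuous_Re, HcF', Hz. }
  split; [split; [exact (conj G1 (conj U1 V1))|]|exact G2].
  intros z Hz; rewrite (proj1 (U2 z Hz)), (proj2 (V2 z Hz)); ring.
Qed.

(** * Primitives *)

(** The integral of [F] along the segment from 0 to [z]; both domains are star-shaped about 0. *)
Definition Cprimitive (F : C -> C) (z : C) : C := CInt (fun t => z * F (t * z))%C 0 1.

Lemma D1_ext (u v : R -> C) s l : (forall t, u t = v t) -> D1 u s l -> D1 v s l.
Proof. intros H [K1 K2]; split; eapply is_derive_ext; try eassumption; intros; simpl; rewrite H; trivial. Qed.

(** Moving [z] in the direction [m], the derivative of the integrand is the derivative in [t] of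
    [m * (t * F (t * z))], and the boundary term is [m * F z]. The directions [1] and [Ci] give the
    two partial derivatives. *)
Lemma primitive_direction D F F' z m (x0 : R) :
  holo D F F' -> in_dom D z -> Cmod m = 1 ->
  D1 (fun x : R => Cprimitive F (z + (x - x0) * m)%C) x0 (m * F z).
Proof.
  intros HF Hz Hm.
  destruct (in_dom_rad D z Hz) as [n Hn].
  (* Chosen so that [(1 + d) * (Cmod z + d)] stays below [rad D n]: the integrand is needed for [t]
     slightly outside [[0, 1]]. *)
  set (d := Rmin 1 ((rad D n - Cmod z) / (Cmod z + 3))).
  assert (Hz0 := Cmod_ge_0 z).
  assert (Hd : 0 < d) by (apply Rmin_pos; [lra|apply Rdiv_lt_0_compat; lra]).
  assert (Hd1 : d <= 1) by apply Rmin_l.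
  assert (Hd2 : d * (Cmod z + 3) <= rad D n - Cmod z).
  { apply Rle_trans with ((rad D n - Cmod z) / (Cmod z + 3) * (Cmod z + 3)).
    - apply Rmult_le_compat_r; [lra|apply Rmin_r].
    - right; field; lra. }
  pose (zeta := fun x : R => (z + (x - x0) * m)%C).
  assert (Hin : forall x t, Rabs (x - x0) < d -> - d < t < 1 + d -> in_dom D (t * zeta x)).
  { intros x t Hx Ht; apply (rad_in_dom D n); rewrite Cmod_mult, Cmod_R.
    assert (Cmod (zeta x) <= Cmod z + d).
    { eapply Rle_trans; [apply Cmod_triangle|].
      rewrite Cmod_mult, Hm, <- RtoC_minus, Cmod_R; lra. }
    assert (Rabs t <= 1 + d) by (apply Rabs_le; lra).
    generalize (Rabs_pos t) (Cmod_ge_0 (zeta x)); intros; nra. }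
  assert (Hin0 : forall t, 0 <= t <= 1 -> in_dom D (t * z)).
  { intros t Ht; replace z with (zeta x0) by (unfold zeta; ring).
    apply Hin; [rewrite Rminus_diag, Rabs_R0|]; lra. }
  assert (HD1 : forall x, D1 zeta x m).
  { intros x; split; unfold zeta, Re, Im; simpl; auto_derive; trivial; ring. }
  replace (m * F z)%C with (m * (1 * F (1 * z)) - m * (0 * F (0 * z)))%C
    by (rewrite !Cmult_1_l; ring).
  apply (CInt_param_derive (fun x t => zeta x * F (t * zeta x))%C
    (fun x t => m * (F (t * zeta x) + t * zeta x * F' (t * zeta x)))%C
    (fun t => m * (t * F (t * z)))%C x0 0 1 d); try lra.
  - intros x t Hx Ht.
    replace (m * (F (t * zeta x) + t * zeta x * F' (t * zeta x)))%C
      with ((1 * F (t * zeta x) + zeta x * (F' (t * zeta x) * (t * 1))) * m)%C by ring.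
    apply (D1_comp (fun w => w * F (t * w))%C zeta); [|apply HD1].
    apply (sd_mult (fun w => w) (fun w => F (t * w)%C)); [apply sd_id|].
    apply (sd_comp (fun w => t * w)%C F); [apply (sd_scal t (fun w => w)), sd_id|].
    apply HF, Hin; trivial; lra.
  - intros t Ht.
    assert (Hc : continuous (fun p : R * R => snd p * zeta (fst p))%C (x0, t)).
    { apply continuous_Cmult; [apply continuous_RtoC, continuous_snd|].
      apply (continuous_comp fst zeta); [apply continuous_fst|eapply D1_continuous, HD1]. }
    assert (Hd0 : in_dom D (t * zeta x0)%C) by (apply Hin; [rewrite Rminus_diag, Rabs_R0|]; lra).
    apply continuous_Cmult; [apply continuous_const|apply continuous_Cplus].
    + apply (continuous_comp (fun p : R * R => snd p * zeta (fst p))%C F); trivial.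
      eapply sd_continuous, HF, Hd0.
    + apply continuous_Cmult; trivial.
      apply (continuous_comp (fun p : R * R => snd p * zeta (fst p))%C F'); trivial.
      apply HF, Hd0.
  - intros x t Hx Ht; apply continuous_Cmult; [apply continuous_const|].
    apply (continuous_comp (fun t : R => t * zeta x)%C F).
    + apply continuous_Cmult; [apply continuous_RtoC, continuous_id|apply continuous_const].
    + eapply sd_continuous, HF, Hin; trivial; lra.
  - intros t Ht; replace (zeta x0) with z by (unfold zeta; ring).
    apply D1_mult_const.
    apply (D1_ext (fun s => (fun w => w * F (w * z))%C (RtoC s))); [trivial|].
    replace (F (t * z) + t * z * F' (t * z))%C
      with ((1 * F (t * z) + t * (F' (t * z) * z)) * 1)%C by ring.
    apply (D1_comp (fun w => w * F (w * z))%C RtoC).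
    + apply (sd_mult (fun w => w) (fun w => F (w * z)%C)); [apply sd_id|].
      apply (sd_comp (fun w => w * z)%C F).
      * apply (sd_ext (fun w => z * w)%C); [intros; ring|].
        eapply sd_eq; [apply (sd_scal z (fun w => w)), sd_id|ring].
      * apply HF, Hin0, Ht.
    + split; simpl; auto_derive; trivial.
Qed.

Lemma sd_primitive D F F' z : holo D F F' -> in_dom D z -> sd (Cprimitive F) z (F z).
Proof.
  intros HF Hz; apply sd_of_partials.
  - destruct (in_dom_open D z Hz) as [r [Hr Hd]]; exists r; split; trivial.
    intros w Hw; specialize (Hd w Hw); split.
    + rewrite <- (Cmult_1_l (F w)).
      apply (D1_ext (fun x : R => Cprimitive F (w + (x - fst w) * 1)%C)).
      * intros t; f_equal; apply C_ext; unfold Re, Im; simpl; ring.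
      * apply (primitive_direction D F F'); trivial; apply Cmod_1.
    + apply (D1_ext (fun x : R => Cprimitive F (w + (x - snd w) * Ci)%C)).
      * intros t; f_equal; apply C_ext; unfold Re, Im; simpl; ring.
      * apply (primitive_direction D F F'); trivial; apply Cmod_Ci.
  - eapply sd_continuous, HF, Hz.
Qed.

Lemma holo_plus D F F' G G' : holo D F F' -> holo D G G' ->
  holo D (fun z => F z + G z)%C (fun z => F' z + G' z)%C.
Proof.
  intros HF HG z Hz; destruct (HF z Hz), (HG z Hz); split;
   [apply sd_plus|apply continuous_Cplus]; trivial.
Qed.

Lemma holo_scal D c F F' : holo D F F' -> holo D (fun z => c * F z)%C (fun z => c * F' z)%C.
Proof.
  intros HF z Hz; destruct (HF z Hz); split;
   [apply sd_scal|apply continuous_Cmult; [apply continuous_const|]]; trivial.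
Qed.

Lemma holo_minus D F F' G G' : holo D F F' -> holo D G G' ->
  holo D (fun z => F z - G z)%C (fun z => F' z - G' z)%C.
Proof.
  intros HF HG z Hz; destruct (HF z Hz), (HG z Hz); split;
   [apply sd_minus|apply continuous_Cminus]; trivial.
Qed.

Lemma holo_mult_exp D F F' H H' : holo D F F' -> holo D H H' ->
  holo D (fun z => F z * Cexp (H z))%C (fun z => F' z * Cexp (H z) + F z * (Cexp (H z) * H' z))%C.
Proof.
  intros HF HH z Hz; destruct (HF z Hz) as [F1 F2], (HH z Hz) as [H1 H2].
  assert (He : continuous (fun z => Cexp (H z)) z).
  { apply (continuous_comp H Cexp); [eapply sd_continuous, H1|apply continuous_Cexp]. }
  split.
  - apply (sd_mult F (fun z => Cexp (H z))); trivial; apply (sd_comp H Cexp); trivial; apply sd_Cexp.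
  - apply continuous_Cplus; apply continuous_Cmult; trivial.
    + eapply sd_continuous, F1.
    + apply continuous_Cmult; trivial.
Qed.

(** * Weierstrass data *)

(** Isotropy says that [f3 ^ 2] is minus the product of the two combinations, so [Cmod f3 ^ 2] is
    the cross term that completes the parallelogram identity to a square. *)
Lemma weierstrass_norm (f1 f2 f3 : C) :
  (f1 * f1 + f2 * f2 + f3 * f3)%C = 0 ->
  Cmod f1 ^ 2 + Cmod f2 ^ 2 + Cmod f3 ^ 2 = (Cmod (f1 - Ci * f2) + Cmod (f1 + Ci * f2)) ^ 2 / 2.
Proof.
  intros H.
  assert (E : (f3 * f3)%C = (- ((f1 - Ci * f2) * (f1 + Ci * f2)))%C).
  { transitivity (f1 * f1 + f2 * f2 + f3 * f3 - (f1 * f1 + f2 * f2))%C; [ring|].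
    rewrite H; apply C_ext; unfold Re, Im; simpl; ring. }
  apply (f_equal Cmod) in E; rewrite Cmod_opp, !Cmod_mult in E.
  assert (P : Cmod (f1 - Ci * f2) ^ 2 + Cmod (f1 + Ci * f2) ^ 2 = 2 * (Cmod f1 ^ 2 + Cmod f2 ^ 2)).
  { rewrite !Cmod2_alt; unfold Re, Im; simpl; ring. }
  nra.
Qed.

(** Isotropy means that the real and imaginary parts of the vector [f] are orthogonal and of equal
    length, so [d] is mapped to [Re (f * d)] by a similarity. *)
Lemma Re_mult_isotropic (f1 f2 f3 d : C) :
  (f1 * f1 + f2 * f2 + f3 * f3)%C = 0 ->
  Re (f1 * d) ^ 2 + Re (f2 * d) ^ 2 + Re (f3 * d) ^ 2
    = (Cmod f1 ^ 2 + Cmod f2 ^ 2 + Cmod f3 ^ 2) * Cmod d ^ 2 / 2.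
Proof.
  intros H; rewrite !Cmod2_alt.
  assert (H1 := f_equal Re H); assert (H2 := f_equal Im H).
  destruct f1 as [a1 b1], f2 as [a2 b2], f3 as [a3 b3], d as [x y].
  unfold Re, Im in *; simpl in *.
  assert (E1 : a1 * a1 + a2 * a2 + a3 * a3 = b1 * b1 + b2 * b2 + b3 * b3) by lra.
  assert (E2 : a1 * b1 + a2 * b2 + a3 * b3 = 0) by lra.
  transitivity ((a1 * a1 + a2 * a2 + a3 * a3) * (x * x) + (b1 * b1 + b2 * b2 + b3 * b3) * (y * y)
    - 2 * (a1 * b1 + a2 * b2 + a3 * b3) * (x * y)); [ring|].
  rewrite E2.
  replace ((a1 * (a1 * 1) + b1 * (b1 * 1) + (a2 * (a2 * 1) + b2 * (b2 * 1)) + (a3 * (a3 * 1) + b3 * (b3 * 1))) *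
   (x * (x * 1) + y * (y * 1)) / 2) with
    (((a1 * a1 + a2 * a2 + a3 * a3) + (b1 * b1 + b2 * b2 + b3 * b3)) * (x * x + y * y) / 2) by field.
  rewrite E1; field.
Qed.

Lemma norm3_sq p : norm3 p ^ 2 = x1 p ^ 2 + x2 p ^ 2 + x3 p ^ 2.
Proof.
  unfold norm3; rewrite pow2_sqrt; trivial.
  generalize (pow2_ge_0 (x1 p)) (pow2_ge_0 (x2 p)) (pow2_ge_0 (x3 p)); lra.
Qed.

Lemma norm3_ge_0 p : 0 <= norm3 p.
Proof. apply sqrt_pos. Qed.

Lemma norm3_perturb (p : R3) (v1 v2 v3 e : R) :
  Rabs (x1 p - v1) <= e -> Rabs (x2 p - v2) <= e -> Rabs (x3 p - v3) <= e ->
  sqrt (v1 ^ 2 + v2 ^ 2 + v3 ^ 2) - 3 * e <= norm3 p.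
Proof.
  intros H1 H2 H3.
  assert (He : 0 <= e) by (generalize (Rabs_pos (x1 p - v1)); lra).
  assert (Hn := norm3_ge_0 p); assert (Hs := norm3_sq p).
  assert (Hb : forall x, x ^ 2 <= norm3 p ^ 2 -> - norm3 p <= x <= norm3 p)
    by (intros x Hx; split; nra).
  generalize (pow2_ge_0 (x1 p)) (pow2_ge_0 (x2 p)) (pow2_ge_0 (x3 p)); intros.
  destruct (Hb (x1 p)) as [A1 B1]; [lra|]; destruct (Hb (x2 p)) as [A2 B2]; [lra|];
  destruct (Hb (x3 p)) as [A3 B3]; [lra|].
  set (n := norm3 p) in *.
  apply Rabs_le_between in H1; apply Rabs_le_between in H2; apply Rabs_le_between in H3.
  assert (sqrt (v1 ^ 2 + v2 ^ 2 + v3 ^ 2) <= n + 3 * e); [|lra].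
  rewrite <- (sqrt_pow2 (n + 3 * e)) by lra; apply sqrt_le_1_alt.
  assert (Hv : forall v x, - e <= x - v <= e -> - n <= x <= n -> v ^ 2 <= x ^ 2 + 2 * n * e + e ^ 2).
  { intros v x Hvx Hx; set (t := v - x); replace v with (x + t) by (unfold t; ring).
    assert (- e <= t <= e) by (unfold t; lra).
    assert (t ^ 2 <= e ^ 2) by nra.
    assert (x * t <= n * e); [|nra].
    destruct (Rle_dec 0 x), (Rle_dec 0 t); nra. }
  generalize (Hv v1 (x1 p)) (Hv v2 (x2 p)) (Hv v3 (x3 p)); intros.
  assert (0 <= e ^ 2) by nra; assert (0 <= n * e) by nra; nra.
Qed.

Section Weierstrass.

Variables (D : sdomain) (Y : C -> R3) (f1 f2 f3 : C -> C).
Hypothesis H1 : harmonic_on (in_dom D) (fun z => x1 (Y z)).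
Hypothesis H2 : harmonic_on (in_dom D) (fun z => x2 (Y z)).
Hypothesis H3 : harmonic_on (in_dom D) (fun z => x3 (Y z)).
Hypothesis E1 : forall z, in_dom D z -> dz (fun z => x1 (Y z)) z = f1 z.
Hypothesis E2 : forall z, in_dom D z -> dz (fun z => x2 (Y z)) z = f2 z.
Hypothesis E3 : forall z, in_dom D z -> dz (fun z => x3 (Y z)) z = f3 z.
Hypothesis Hiso : forall z, in_dom D z -> (f1 z * f1 z + f2 z * f2 z + f3 z * f3 z)%C = 0.
Hypothesis Hpos : forall z, in_dom D z -> 0 < Cmod (f1 z - Ci * f2 z) + Cmod (f1 z + Ci * f2 z).

Let lam (z : C) : R := (Cmod (f1 z - Ci * f2 z) + Cmod (f1 z + Ci * f2 z)) / 2.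

Lemma weierstrass_immersion : conformal_minimal_immersion (in_dom D) Y.
Proof.
  split; [|auto].
  split; [apply H1|split; [apply H2|split; [apply H3|]]].
  intros z Hz; specialize (Hiso z Hz); specialize (Hpos z Hz).
  generalize (weierstrass_norm _ _ _ Hiso); intros N.
  rewrite <- (E1 z Hz), <- (E2 z Hz), <- (E3 z Hz) in *.
  assert (I1 := f_equal Re Hiso); assert (I2 := f_equal Im Hiso).
  rewrite !Cmod2_alt in N.
  unfold dz, Re, Im in I1, I2, N; simpl in I1, I2, N.
  unfold dot3, Xu, Xv, x1, x2, x3; simpl.
  unfold x1, x2, x3 in *.
  split; [lra|split; [lra|]].
  unfold norm3, x1, x2, x3; simpl; apply sqrt_lt_R0.
  set (S := Cmod (dz (fun z => fst (fst (Y z))) z - Ci * dz (fun z => snd (fst (Y z))) z) +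
    Cmod (dz (fun z => fst (fst (Y z))) z + Ci * dz (fun z => snd (fst (Y z))) z)) in *.
  unfold dz in S; fold S in N.
  assert (0 < S * S) by (apply Rmult_lt_0_compat; trivial).
  lra.
Qed.

(** Strict differentiability bounds the chord for all pairs of points near [z], not only for pairs
    containing [z]; inscribed polygons require this. *)
Lemma weierstrass_lower_bound z L : in_dom D z -> L < lam z ->
  exists eta, 0 < eta /\ forall w w', Cmod (w - z) < eta -> Cmod (w' - z) < eta ->
    L * Cmod (w' - w) <= norm3 (sub3 (Y w') (Y w)).
Proof.
  intros Hz HL.
  destruct (in_dom_open D z Hz) as [r [Hr Hd]].
  (* The three coordinate errors together cost [3 * e] in [norm3_perturb]. *)
  set (e := (lam z - L) / 3); assert (He : 0 < e) by (unfold e; lra).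
  assert (Hst : forall g : C -> R, harmonic_on (in_dom D) g -> exists eta, 0 < eta /\
    forall w w', Cmod (w - z) < eta -> Cmod (w' - z) < eta ->
      Rabs (g w' - g w - Re (dz g z * (w' - w))) <= e * Cmod (w' - w)).
  { intros g [[Hg _] _].
    destruct (strict_of_partials g (pu g) (pv g) z) with (eps := e) as [eta [Heta H]]; trivial.
    - exists r; split; trivial; intros w Hw; destruct (Hg w (Hd w Hw)) as (K1 & K2 & _).
      split; apply Derive_correct; trivial.
    - apply (Hg z Hz).
    - apply (Hg z Hz).
    - exists eta; split; trivial; intros w w' Hw Hw'; eapply Rle_trans; [|apply (H w w' Hw Hw')].
      right; f_equal; unfold dz, Re, Im; simpl; ring. }
  destruct (Hst _ H1) as [e1 [P1 K1]], (Hst _ H2) as [e2 [P2 K2]], (Hst _ H3) as [e3 [P3 K3]].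
  exists (Rmin e1 (Rmin e2 e3)); split; [repeat apply Rmin_pos; trivial|].
  intros w w' Hw Hw'.
  generalize (Rmin_l e1 (Rmin e2 e3)) (Rmin_r e1 (Rmin e2 e3)) (Rmin_l e2 e3) (Rmin_r e2 e3); intros.
  specialize (K1 w w' ltac:(lra) ltac:(lra)); specialize (K2 w w' ltac:(lra) ltac:(lra)).
  specialize (K3 w w' ltac:(lra) ltac:(lra)).
  rewrite (E1 z Hz) in K1; rewrite (E2 z Hz) in K2; rewrite (E3 z Hz) in K3.
  eapply Rle_trans; [|apply (norm3_perturb (sub3 (Y w') (Y w)) _ _ _ _ K1 K2 K3)].
  rewrite (Re_mult_isotropic _ _ _ _ (Hiso z Hz)), (weierstrass_norm _ _ _ (Hiso z Hz)).
  replace ((Cmod (f1 z - Ci * f2 z) + Cmod (f1 z + Ci * f2 z)) ^ 2 / 2 * Cmod (w' - w) ^ 2 / 2)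
    with ((lam z * Cmod (w' - w)) ^ 2) by (unfold lam; field).
  rewrite sqrt_pow2.
  - right; unfold e; field.
  - apply Rmult_le_pos; [unfold lam; specialize (Hpos z Hz); lra|apply Cmod_ge_0].
Qed.

End Weierstrass.

Lemma isotropic_of_immersion D X z :
  conformal_minimal_immersion (in_dom D) X -> in_dom D z ->
  let f1 := dz (fun z => x1 (X z)) z in
  let f2 := dz (fun z => x2 (X z)) z in
  let f3 := dz (fun z => x3 (X z)) z in
  (f1 * f1 + f2 * f2 + f3 * f3)%C = 0 /\ 0 < Cmod (f1 - Ci * f2) + Cmod (f1 + Ci * f2).
Proof.
  intros [(_ & _ & _ & H) _] Hz f1 f2 f3; destruct (H z Hz) as (Ha & Hb & Hc).
  assert (Hiso : (f1 * f1 + f2 * f2 + f3 * f3)%C = 0).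
  { unfold dot3, Xu, Xv, x1, x2, x3 in Ha, Hb; simpl in Ha, Hb.
    apply C_ext; unfold f1, f2, f3, dz, Re, Im, x1, x2, x3; simpl; lra. }
  split; trivial.
  generalize (weierstrass_norm _ _ _ Hiso); intros N.
  generalize (Cmod_ge_0 (f1 - Ci * f2)) (Cmod_ge_0 (f1 + Ci * f2)); intros.
  apply Rnot_le_lt; intros Hle.
  assert (E : Cmod (f1 - Ci * f2) + Cmod (f1 + Ci * f2) = 0) by lra.
  rewrite E in N; rewrite !Cmod2_alt in N.
  assert (Hn := norm3_sq (Xu X z)).
  unfold Xu, x1, x2, x3 in Hn; simpl in Hn.
  unfold f1, f2, f3, dz, Re, Im, x1, x2, x3 in N; simpl in N.
  assert (0 < norm3 (Xu X z) * norm3 (Xu X z)) by (apply Rmult_lt_0_compat; trivial).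
  unfold Xu, x1, x2, x3 in *.
  nra.
Qed.

(** The path from 0 runs along the real axis and then vertically. Its points have coordinates
    bounded by those of the endpoint, so it stays in the disk. *)
Lemma mean_value_disk (g p q : C -> R) (rho m : R) :
  (forall z, Cmod z <= rho -> is_derive (fun t => g (t, snd z)) (fst z) (p z) /\
     is_derive (fun t => g (fst z, t)) (snd z) (q z)) ->
  (forall z, Cmod z <= rho -> Rabs (p z) <= m /\ Rabs (q z) <= m) ->
  forall z, Cmod z <= rho -> Rabs (g z - g 0) <= 2 * rho * m.
Proof.
  intros Hd Hm [u v] Hz.
  generalize (re_le_Cmod (u, v)) (Im_le_Cmod (u, v)); simpl; intros Hu Hv.
  assert (Hbt : forall a t, Rmin 0 a <= t <= Rmax 0 a -> t ^ 2 <= a ^ 2).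
  { intros a t; unfold Rmin, Rmax; destruct (Rle_dec 0 a); intros; nra. }
  assert (Hmono : forall z w, Cmod z <= rho -> Re w ^ 2 <= Re z ^ 2 -> Im w ^ 2 <= Im z ^ 2 -> Cmod w <= rho).
  { intros z w Hzr K1 K2; apply Rle_trans with (2 := Hzr).
    generalize (Cmod2_alt z) (Cmod2_alt w) (Cmod_ge_0 z) (Cmod_ge_0 w); intros; nra. }
  assert (Hseg1 : forall t, Rmin 0 u <= t <= Rmax 0 u -> Cmod (t, 0) <= rho).
  { intros t Ht; apply (Hmono (u, v)); simpl; trivial; [apply (Hbt u t Ht)|nra]. }
  assert (Hseg2 : forall t, Rmin 0 v <= t <= Rmax 0 v -> Cmod (u, t) <= rho).
  { intros t Ht; apply (Hmono (u, v)); simpl; trivial; [nra|apply (Hbt v t Ht)]. }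
  destruct (MVT_gen (fun t => g (t, 0)) 0 u (fun t => p (t, 0))) as [t1 [Ht1 X1]].
  { intros t Ht; apply (Hd (t, 0)), Hseg1; lra. }
  { intros t Ht; apply continuity_pt_filterlim, (ex_derive_continuous (fun t => g (t, 0)) t).
    exists (p (t, 0)); apply (Hd (t, 0)), Hseg1, Ht. }
  destruct (MVT_gen (fun t => g (u, t)) 0 v (fun t => q (u, t))) as [t2 [Ht2 X2]].
  { intros t Ht; apply (Hd (u, t)), Hseg2; lra. }
  { intros t Ht; apply continuity_pt_filterlim, (ex_derive_continuous (fun t => g (u, t)) t).
    exists (q (u, t)); apply (Hd (u, t)), Hseg2, Ht. }
  change (RtoC 0) with (0, 0).
  replace (g (u, v) - g (0, 0)) with (p (t1, 0) * (u - 0) + q (u, t2) * (v - 0)) by lra.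
  eapply Rle_trans; [apply Rabs_triang|]; rewrite !Rabs_mult, !Rminus_0_r.
  destruct (Hm _ (Hseg1 _ Ht1)) as [M1 _], (Hm _ (Hseg2 _ Ht2)) as [_ M2].
  generalize (Rabs_pos (p (t1, 0))) (Rabs_pos (q (u, t2))) (Rabs_pos u) (Rabs_pos v); intros.
  assert (Rabs (p (t1, 0)) * Rabs u <= m * rho) by (apply Rmult_le_compat; lra).
  assert (Rabs (q (u, t2)) * Rabs v <= m * rho) by (apply Rmult_le_compat; lra).
  lra.
Qed.

(** * Approximation by entire functions *)

Definition entire (f f' : C -> C) : Prop := holo Plane f f'.

(* [F'] plays the role of the derivative of [F]; it is approximated along with [F]
   so that no Cauchy estimate is needed later on. *)
Definition appr (E : C -> Prop) (F F' : C -> C) : Prop :=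
  (exists B, 0 < B /\ forall z, E z -> Cmod (F z) <= B /\ Cmod (F' z) <= B) /\
  forall eps, 0 < eps -> exists f f', entire f f' /\
    forall z, E z -> Cmod (F z - f z) <= eps /\ Cmod (F' z - f' z) <= eps.

Lemma entire_id : entire (fun z => z) (fun _ => 1).
Proof. intros z _; split; [apply sd_id|apply continuous_const]. Qed.

Lemma entire_const c : entire (fun _ => c) (fun _ => 0).
Proof. intros z _; split; [apply sd_const|apply continuous_const]. Qed.

Lemma entire_mult f f' g g' : entire f f' -> entire g g' ->
  entire (fun z => f z * g z)%C (fun z => f' z * g z + f z * g' z)%C.
Proof.
  intros Hf Hg z Hz; destruct (Hf z Hz) as [F1 F2], (Hg z Hz) as [G1 G2].
  split; [apply (sd_mult f g); trivial|].
  apply continuous_Cplus; apply continuous_Cmult; trivial; eapply sd_continuous; eassumption.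
Qed.

Section Appr.

Variable E : C -> Prop.

Lemma appr_ext F F' G G' :
  (forall z, E z -> F z = G z /\ F' z = G' z) -> appr E F F' -> appr E G G'.
Proof.
  intros HE [[B [HB H1]] H2]; split.
  - exists B; split; trivial; intros z Hz; destruct (HE z Hz) as [<- <-]; auto.
  - intros eps He; destruct (H2 eps He) as (f & f' & Hf & H); exists f, f'; split; trivial.
    intros z Hz; destruct (HE z Hz) as [<- <-]; auto.
Qed.

Lemma appr_entire f f' :
  (exists r, forall z, E z -> Cmod z <= r) -> entire f f' -> appr E f f'.
Proof.
  intros [r Hr] Hf; split.
  - destruct (compact_upper_bound (fun z => Cmod z <= r) (fun z => Cmod (f z))) as [B [HB H1]].
    { apply compact_disk. }
    { intros z _; apply (continuous_comp f Cmod); [eapply sd_continuous, Hf; exact I|apply continuous_Cmod]. }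
    destruct (compact_upper_bound (fun z => Cmod z <= r) (fun z => Cmod (f' z))) as [B' [HB' H1']].
    { apply compact_disk. }
    { intros z _; apply (continuous_comp f' Cmod); [apply Hf; exact I|apply continuous_Cmod]. }
    exists (B + B'); split; [lra|]; intros z Hz.
    specialize (H1 z (Hr z Hz)); specialize (H1' z (Hr z Hz)); lra.
  - intros eps He; exists f, f'; split; trivial; intros z _; rewrite !Cmod_self; lra.
Qed.

Lemma appr_plus F F' G G' : appr E F F' -> appr E G G' ->
  appr E (fun z => F z + G z)%C (fun z => F' z + G' z)%C.
Proof.
  intros [[A [HA F1]] F2] [[B [HB G1]] G2]; split.
  - exists (A + B); split; [lra|]; intros z Hz; destruct (F1 z Hz), (G1 z Hz).
    split; eapply Rle_trans; try apply Cmod_triangle; lra.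
  - intros eps He; destruct (F2 (eps / 2)) as (f & f' & Hf & Hf'); [lra|].
    destruct (G2 (eps / 2)) as (g & g' & Hg & Hg'); [lra|].
    exists (fun z => f z + g z)%C, (fun z => f' z + g' z)%C; split; [apply holo_plus; trivial|].
    intros z Hz; destruct (Hf' z Hz), (Hg' z Hz); split.
    + replace (F z + G z - (f z + g z))%C with ((F z - f z) + (G z - g z))%C by ring.
      eapply Rle_trans; [apply Cmod_triangle|lra].
    + replace (F' z + G' z - (f' z + g' z))%C with ((F' z - f' z) + (G' z - g' z))%C by ring.
      eapply Rle_trans; [apply Cmod_triangle|lra].
Qed.

Lemma Cmod_mult_diff (x y a b : C) (A e : R) : Cmod x <= A -> Cmod y <= A -> 0 <= e <= 1 ->
  Cmod (x - a) <= e -> Cmod (y - b) <= e -> Cmod (x * y - a * b) <= (2 * A + 1) * e.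
Proof.
  intros Hx Hy He Ha Hb.
  replace (x * y - a * b)%C with (x * (y - b) + (x - a) * y - (x - a) * (y - b))%C by ring.
  eapply Rle_trans; [apply Cmod_triangle_minus|].
  eapply Rle_trans; [apply Rplus_le_compat_r, Cmod_triangle|].
  rewrite !Cmod_mult.
  generalize (Cmod_ge_0 x) (Cmod_ge_0 y) (Cmod_ge_0 (x - a)) (Cmod_ge_0 (y - b)); intros.
  assert (Cmod x * Cmod (y - b) <= A * e) by (apply Rmult_le_compat; trivial).
  assert (Cmod (x - a) * Cmod y <= e * A) by (apply Rmult_le_compat; trivial).
  assert (Cmod (x - a) * Cmod (y - b) <= e * 1) by (apply Rmult_le_compat; lra).
  lra.
Qed.

Lemma appr_mult F F' G G' : appr E F F' -> appr E G G' ->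
  appr E (fun z => F z * G z)%C (fun z => F' z * G z + F z * G' z)%C.
Proof.
  intros [[A [HA F1]] F2] [[B [HB G1]] G2].
  set (M := A + B).
  assert (HM : forall z, E z -> (Cmod (F z) <= M /\ Cmod (F' z) <= M) /\ (Cmod (G z) <= M /\ Cmod (G' z) <= M)).
  { intros z Hz; destruct (F1 z Hz), (G1 z Hz); unfold M; repeat split; lra. }
  assert (HMM : 0 < M) by (unfold M; lra).
  split.
  - exists (2 * (M * M)); split; [nra|]; intros z Hz; destruct (HM z Hz) as [[K1 K2] [K3 K4]].
    generalize (Cmod_ge_0 (F z)) (Cmod_ge_0 (G z)) (Cmod_ge_0 (F' z)) (Cmod_ge_0 (G' z)); intros.
    assert (Cmod (F z) * Cmod (G z) <= M * M) by (apply Rmult_le_compat; trivial).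
    assert (Cmod (F' z) * Cmod (G z) <= M * M) by (apply Rmult_le_compat; trivial).
    assert (Cmod (F z) * Cmod (G' z) <= M * M) by (apply Rmult_le_compat; trivial).
    split; [rewrite Cmod_mult; nra|].
    eapply Rle_trans; [apply Cmod_triangle|]; rewrite !Cmod_mult; lra.
  - intros eps He.
    set (e := Rmin 1 (eps / (2 * (2 * M + 1)))).
    assert (He0 : 0 < e) by (apply Rmin_pos; [lra|apply Rdiv_lt_0_compat; lra]).
    assert (He1 : e <= 1) by apply Rmin_l.
    assert (He2 : 2 * ((2 * M + 1) * e) <= eps).
    { apply Rle_trans with (2 * ((2 * M + 1) * (eps / (2 * (2 * M + 1))))).
      - apply Rmult_le_compat_l; [lra|]; apply Rmult_le_compat_l; [lra|apply Rmin_r].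
      - right; field; lra. }
    destruct (F2 e He0) as (f & f' & Hf & Hf'), (G2 e He0) as (g & g' & Hg & Hg').
    exists (fun z => f z * g z)%C, (fun z => f' z * g z + f z * g' z)%C; split; [apply entire_mult; trivial|].
    intros z Hz; destruct (HM z Hz) as [[K1 K2] [K3 K4]], (Hf' z Hz) as [L1 L2], (Hg' z Hz) as [L3 L4].
    assert (X1 := Cmod_mult_diff (F z) (G z) (f z) (g z) M e K1 K3 ltac:(lra) L1 L3).
    assert (X2 := Cmod_mult_diff (F' z) (G z) (f' z) (g z) M e K2 K3 ltac:(lra) L2 L3).
    assert (X3 := Cmod_mult_diff (F z) (G' z) (f z) (g' z) M e K1 K4 ltac:(lra) L1 L4).
    split; [generalize (Cmod_ge_0 (F z * G z - f z * g z)); lra|].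
    replace (F' z * G z + F z * G' z - (f' z * g z + f z * g' z))%C
      with ((F' z * G z - f' z * g z) + (F z * G' z - f z * g' z))%C by ring.
    eapply Rle_trans; [apply Cmod_triangle|lra].
Qed.

Lemma appr_const c : appr E (fun _ => c) (fun _ => 0).
Proof.
  split.
  - exists (Cmod c + 1); generalize (Cmod_ge_0 c); intros; split; [lra|]; intros; rewrite Cmod_0; lra.
  - intros eps He; exists (fun _ => c), (fun _ => RtoC 0); split; [apply entire_const|].
    intros; rewrite !Cmod_self; lra.
Qed.

Lemma appr_scal c F F' : appr E F F' -> appr E (fun z => c * F z)%C (fun z => c * F' z)%C.
Proof.
  intros H; eapply appr_ext; [|apply (appr_mult _ _ _ _ (appr_const c) H)].
  intros z Hz; split; simpl; ring.
Qed.

(** Closure under uniform limits is what admits geometric series. *)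
Lemma appr_limit F F' :
  (exists B, 0 < B /\ forall z, E z -> Cmod (F z) <= B /\ Cmod (F' z) <= B) ->
  (forall eps, 0 < eps -> exists G G', appr E G G' /\
     forall z, E z -> Cmod (F z - G z) <= eps /\ Cmod (F' z - G' z) <= eps) ->
  appr E F F'.
Proof.
  intros HB H; split; trivial; intros eps He.
  destruct (H (eps / 2)) as (G & G' & [_ HG] & K); [lra|].
  destruct (HG (eps / 2)) as (g & g' & Hg & Kg); [lra|].
  exists g, g'; split; trivial; intros z Hz; destruct (K z Hz), (Kg z Hz); split.
  - replace (F z - g z)%C with ((F z - G z) + (G z - g z))%C by ring.
    eapply Rle_trans; [apply Cmod_triangle|lra].
  - replace (F' z - g' z)%C with ((F' z - G' z) + (G' z - g' z))%C by ring.
    eapply Rle_trans; [apply Cmod_triangle|lra].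
Qed.

(** * Geometric series and the displacement of poles *)

Lemma one_minus_neq_0 (x : C) : Cmod x <= 1 / 2 -> (1 - x)%C <> 0.
Proof.
  intros H; apply C_nonzero_of_Cmod; generalize (Cmod_triangle_rev 1 x); rewrite Cmod_1; lra.
Qed.

Lemma Cmod_inv_one_minus (x : C) : Cmod x <= 1 / 2 -> Cmod (/ (1 - x)) <= 2.
Proof.
  intros H; rewrite Cmod_inv by (apply one_minus_neq_0, H).
  replace 2 with (/ (1 / 2)) by field; apply Rinv_le_contravar; [lra|].
  generalize (Cmod_triangle_rev 1 x); rewrite Cmod_1; lra.
Qed.

(** Partial sums of the geometric series in Horner form; [geom'] is their derivative when [x'] is
    that of [x]. *)
Fixpoint geom (x : C) (n : nat) : C :=
  match n with O => 0 | S n => (1 + x * geom x n)%C end.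
Fixpoint geom' (x x' : C) (n : nat) : C :=
  match n with O => 0 | S n => (x' * geom x n + x * geom' x x' n)%C end.

(** The derivative of the series converges like [n / 2 ^ n], so a ratio above [1 / 2] is needed.
    With [3 / 4] the induction closes exactly: [2 * B + 1 / 2 * (8 * B) = 3 / 4 * (8 * B)]. *)
Lemma geom_error (x x' : C) (B : R) : 0 < B -> Cmod x <= 1 / 2 -> Cmod x' <= B -> forall n,
  Cmod (/ (1 - x) - geom x n) <= 2 * (3 / 4) ^ n /\
  Cmod (x' * (/ (1 - x) * / (1 - x)) - geom' x x' n) <= 8 * B * (3 / 4) ^ n.
Proof.
  intros HB Hx Hx' n.
  assert (Hi := Cmod_inv_one_minus x Hx); assert (Hn := one_minus_neq_0 x Hx).
  generalize (Cmod_ge_0 x) (Cmod_ge_0 x') (Cmod_ge_0 (/ (1 - x))); intros.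
  induction n as [|n [IH1 IH2]]; simpl.
  - replace (/ (1 - x) - 0)%C with (/ (1 - x))%C by ring.
    replace (x' * (/ (1 - x) * / (1 - x)) - 0)%C with (x' * (/ (1 - x) * / (1 - x)))%C by ring.
    rewrite !Cmod_mult.
    assert (Cmod (/ (1 - x)) * Cmod (/ (1 - x)) <= 2 * 2) by (apply Rmult_le_compat; trivial).
    split; [lra|].
    assert (Cmod x' * (Cmod (/ (1 - x)) * Cmod (/ (1 - x))) <= B * (2 * 2)); [|lra].
    apply Rmult_le_compat; trivial; apply Rmult_le_pos; trivial.
  - assert (Hp : 0 < (3 / 4) ^ n) by (apply pow_lt; lra).
    assert (X1 : Cmod x * Cmod (/ (1 - x) - geom x n) <= 1 / 2 * (2 * (3 / 4) ^ n))
      by (apply Rmult_le_compat; trivial; apply Cmod_ge_0).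
    assert (X2 : Cmod x' * Cmod (/ (1 - x) - geom x n) <= B * (2 * (3 / 4) ^ n))
      by (apply Rmult_le_compat; trivial; apply Cmod_ge_0).
    assert (X3 : Cmod x * Cmod (x' * (/ (1 - x) * / (1 - x)) - geom' x x' n) <= 1 / 2 * (8 * B * (3 / 4) ^ n))
      by (apply Rmult_le_compat; trivial; apply Cmod_ge_0).
    split.
    + replace (/ (1 - x) - (1 + x * geom x n))%C with (x * (/ (1 - x) - geom x n))%C by (field; trivial).
      rewrite Cmod_mult; lra.
    + replace (x' * (/ (1 - x) * / (1 - x)) - (x' * geom x n + x * geom' x x' n))%C
        with (x' * (/ (1 - x) - geom x n) + x * (x' * (/ (1 - x) * / (1 - x)) - geom' x x' n))%C
        by (field; trivial).
      eapply Rle_trans; [apply Cmod_triangle|]; rewrite !(Cmod_mult _ (_ - _)); lra.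
Qed.

Lemma appr_geometric x x' : appr E x x' -> (forall z, E z -> Cmod (x z) <= 1 / 2) ->
  appr E (fun z => / (1 - x z))%C (fun z => x' z * (/ (1 - x z) * / (1 - x z)))%C.
Proof.
  intros Hx Hs; assert (Hx2 := Hx); destruct Hx2 as [[B [HB HxB]] _].
  apply appr_limit.
  - exists (2 + B * (2 * 2)); split; [nra|]; intros z Hz.
    assert (Hi := Cmod_inv_one_minus _ (Hs z Hz)); destruct (HxB z Hz) as [_ Hb].
    rewrite !Cmod_mult; generalize (Cmod_ge_0 (/ (1 - x z))) (Cmod_ge_0 (x' z)); intros.
    split; [nra|].
    assert (Cmod (/ (1 - x z)) * Cmod (/ (1 - x z)) <= 2 * 2) by (apply Rmult_le_compat; trivial).
    assert (Cmod (x' z) * (Cmod (/ (1 - x z)) * Cmod (/ (1 - x z))) <= B * (2 * 2)); [|lra].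
    apply Rmult_le_compat; trivial; apply Rmult_le_pos; trivial.
  - intros eps He.
    assert (Ha : forall n, appr E (fun z => geom (x z) n) (fun z => geom' (x z) (x' z) n)).
    { induction n as [|n IH]; simpl; [apply appr_const|].
      eapply appr_ext; [|apply (appr_plus _ _ _ _ (appr_const 1) (appr_mult _ _ _ _ Hx IH))].
      intros z Hz; split; simpl; ring. }
    destruct (pow_lt_1_zero (3 / 4)) with (y := eps / (2 + 8 * B)) as [n Hn].
    { rewrite Rabs_pos_eq; lra. }
    { apply Rdiv_lt_0_compat; lra. }
    specialize (Hn n (le_n n)); assert (Hp : 0 < (3 / 4) ^ n) by (apply pow_lt; lra).
    rewrite Rabs_pos_eq in Hn by lra.
    assert (Hn2 : (2 + 8 * B) * (3 / 4) ^ n < eps).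
    { apply Rlt_le_trans with ((2 + 8 * B) * (eps / (2 + 8 * B))).
      - apply Rmult_lt_compat_l; lra.
      - right; field; lra. }
    exists (fun z => geom (x z) n), (fun z => geom' (x z) (x' z) n); split; [apply Ha|].
    intros z Hz; destruct (geom_error (x z) (x' z) B HB (Hs z Hz) (proj2 (HxB z Hz)) n).
    assert (0 < B * (3 / 4) ^ n) by (apply Rmult_lt_0_compat; trivial).
    split; nra.
Qed.

Definition pole (b : C) : Prop := appr E (fun z => / (z - b))%C (fun z => - (/ (z - b) * / (z - b)))%C.

(** [1 / (z - b')] is [1 / (z - b)] times a geometric series in [(b' - b) / (z - b)], of modulus at
    most [1 / 2] on [E]. *)
Lemma pole_move d b b' : 0 < d -> (forall z, E z -> d <= Cmod (z - b)) -> Cmod (b' - b) <= d / 2 ->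
  pole b -> pole b'.
Proof.
  intros Hd HE Hb Hp.
  assert (Hn : forall z, E z -> (z - b)%C <> 0).
  { intros z Hz; apply C_nonzero_of_Cmod; specialize (HE z Hz); lra. }
  assert (Hn' : forall z, E z -> (z - b')%C <> 0).
  { intros z Hz; apply C_nonzero_of_Cmod; specialize (HE z Hz).
    generalize (Cmod_triangle_rev (z - b) (b' - b)).
    replace (z - b - (b' - b))%C with (z - b')%C by ring; lra. }
  assert (Hx := appr_scal (b' - b)%C _ _ Hp).
  assert (Hsmall : forall z, E z -> Cmod ((b' - b) * / (z - b)) <= 1 / 2).
  { intros z Hz; specialize (HE z Hz); rewrite Cmod_mult, Cmod_inv by auto.
    apply Rle_trans with (d / 2 * / d).
    + apply Rmult_le_compat; trivial; [apply Cmod_ge_0|left; apply Rinv_0_lt_compat; lra|].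
      apply Rinv_le_contravar; trivial.
    + right; field; lra. }
  eapply appr_ext; [|apply (appr_mult _ _ _ _ Hp (appr_geometric _ _ Hx Hsmall))].
  - intros z Hz; simpl.
    assert (Hn2 : (1 - (b' - b) * / (z - b))%C <> 0).
    { intros K; apply (Hn' z Hz).
      transitivity ((z - b) * (1 - (b' - b) * / (z - b)))%C; [field; auto|rewrite K; ring]. }
    split; field; repeat split; auto; intros K; apply (Hn' z Hz); rewrite <- K; ring.
Qed.

(** The starting point for moving poles: [1 / (z - b)] is [- 1 / b] times a geometric series in
    [z / b], whose partial sums are polynomials. *)
Lemma pole_far r b : 0 < r -> (forall z, E z -> Cmod z <= r) -> 2 * r <= Cmod b -> pole b.
Proof.
  intros Hr HE Hb.
  assert (Hb0 : b <> 0) by (apply C_nonzero_of_Cmod; lra).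
  assert (Hn' : forall z, E z -> (z - b)%C <> 0).
  { intros z Hz; apply C_nonzero_of_Cmod; specialize (HE z Hz).
    generalize (Cmod_triangle_rev b z); rewrite Cmod_minus_sym; lra. }
  assert (Hx : appr E (fun z => / b * z)%C (fun z => / b * 1)%C).
  { apply appr_scal, appr_entire; [exists r; trivial|apply entire_id]. }
  assert (Hg := appr_geometric _ _ Hx).
  eapply appr_ext; [|apply (appr_scal (- / b)%C), Hg].
  - intros z Hz; simpl.
    assert (b - z <> 0)%C by (intros K; apply (Hn' z Hz); transitivity (- (b - z))%C; [ring|rewrite K; ring]).
    split; field; repeat split; auto.
  - intros z Hz; rewrite Cmod_mult, Cmod_inv by trivial; specialize (HE z Hz).
    apply Rle_trans with (/ (2 * r) * r); [|right; field; lra].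
    apply Rmult_le_compat; trivial; try apply Cmod_ge_0.
    + left; apply Rinv_0_lt_compat; lra.
    + apply Rinv_le_contravar; lra.
Qed.

End Appr.

(** * Rotations, and powers with exponent [2 ^ k] *)

Lemma cis_lipschitz s t : Cmod (cis s - cis t) <= 2 * Rabs (s - t).
Proof.
  eapply Rle_trans; [apply Cmod_le_Re_Im|]; simpl.
  assert (Rabs (cos s + - cos t) <= Rabs (s - t)).
  { destruct (MVT_gen cos t s (fun x => - sin x)) as [x [_ E]].
    - intros; apply is_derive_cos.
    - intros; apply continuity_cos.
    - change (cos s + - cos t) with (cos s - cos t); rewrite E, Rabs_mult.
      generalize (SIN_bound x) (Rabs_pos (s - t)); intros.
      assert (Rabs (- sin x) <= 1) by (apply Rabs_le; lra); nra. }
  assert (Rabs (sin s + - sin t) <= Rabs (s - t)).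
  { destruct (MVT_gen sin t s cos) as [x [_ E]].
    - intros; apply is_derive_sin.
    - intros; apply continuity_sin.
    - change (sin s + - sin t) with (sin s - sin t); rewrite E, Rabs_mult.
      generalize (COS_bound x) (Rabs_pos (s - t)); intros.
      assert (Rabs (cos x) <= 1) by (apply Rabs_le; lra); nra. }
  lra.
Qed.

Lemma exists_nat_mult (x y : R) : 0 < y -> exists n, x <= INR n * y.
Proof.
  intros Hy; destruct (INR_unbounded (x / y)) as [n Hn]; exists n.
  replace x with (x / y * y) by (field; lra); apply Rmult_le_compat_r; lra.
Qed.

(* Bernoulli's inequality for the square root of [q]. *)
Lemma nat_mult_pow_small (q e : R) : 0 < q < 1 -> 0 < e ->
  exists N, forall n, (N <= n)%nat -> INR n * q ^ n < e.
Proof.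
  intros [Hq0 Hq1] He.
  set (s := sqrt q).
  assert (Hs0 : 0 < s) by (apply sqrt_lt_R0; trivial).
  assert (Hss : s * s = q) by (apply sqrt_sqrt; lra).
  assert (Hs1 : s < 1) by nra.
  set (h := / s - 1).
  assert (Hh : 0 < h).
  { unfold h; apply Rlt_0_minus; rewrite <- Rinv_1; apply Rinv_lt_contravar; lra. }
  destruct (pow_lt_1_zero s) with (y := e * h) as [N HN].
  - rewrite Rabs_pos_eq; lra.
  - apply Rmult_lt_0_compat; trivial.
  - exists N; intros n Hn; specialize (HN n Hn).
    assert (Hp : 0 < s ^ n) by (apply pow_lt; trivial).
    rewrite Rabs_pos_eq in HN by lra.
    assert (Hb := poly n h Hh).
    assert (E : (1 + h) ^ n * s ^ n = 1).
    { rewrite <- Rpow_mult_distr; replace ((1 + h) * s) with 1 by (unfold h; field; lra); apply pow1. }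
    assert (Hns : INR n * h * s ^ n <= 1).
    { rewrite <- E; apply Rmult_le_compat_r; lra. }
    rewrite <- Hss, Rpow_mult_distr.
    apply Rmult_lt_reg_r with h; trivial.
    assert (INR n * h * s ^ n * s ^ n <= 1 * s ^ n) by (apply Rmult_le_compat_r; lra).
    lra.
Qed.

Lemma pow2_pow_small (q e : R) : 0 < q < 1 -> 0 < e ->
  exists N, forall k, (N <= k)%nat -> 2 ^ k * q ^ (2 ^ k)%nat < e.
Proof.
  intros Hq He; destruct (nat_mult_pow_small q e Hq He) as [N HN]; exists N; intros k Hk.
  replace (2 ^ k) with (INR (2 ^ k)%nat) by (rewrite pow_INR; f_equal).
  apply HN; assert (k < 2 ^ k)%nat by (apply Nat.pow_gt_lin_r; lia); lia.
Qed.

(** [z ^ (2 ^ k)] and its derivative. Exponents that are powers of two let the poles on a circle be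
    split by repeated square roots instead of a partial fraction over all roots of unity. *)
Fixpoint sqpow (k : nat) (z : C) : C :=
  match k with O => z | S k => (sqpow k z * sqpow k z)%C end.
Fixpoint sqpow' (k : nat) (z : C) : C :=
  match k with O => 1 | S k => (2 * sqpow k z * sqpow' k z)%C end.
Fixpoint rsqpow (k : nat) (x : R) : R :=
  match k with O => x | S k => rsqpow k x * rsqpow k x end.

Lemma rsqpow_pow k x : rsqpow k x = x ^ (2 ^ k)%nat.
Proof.
  induction k as [|k IH]; [simpl; ring|].
  simpl rsqpow; rewrite IH, <- pow_add; f_equal; simpl; lia.
Qed.

Lemma rsqpow_pos k x : 0 < x -> 0 < rsqpow k x.
Proof. intros H; rewrite rsqpow_pow; apply pow_lt, H. Qed.

Lemma rsqpow_nonneg k x : 0 <= x -> 0 <= rsqpow k x.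
Proof. intros H; rewrite rsqpow_pow; apply pow_le, H. Qed.

Lemma rsqpow_le k x y : 0 <= x <= y -> rsqpow k x <= rsqpow k y.
Proof. intros H; rewrite !rsqpow_pow; apply pow_incr, H. Qed.

Lemma rsqpow_lt k x y : 0 <= x < y -> rsqpow k x < rsqpow k y.
Proof.
  intros H; induction k as [|k IH]; simpl; [lra|].
  generalize (rsqpow_nonneg k x ltac:(lra)); intros; nra.
Qed.

Lemma Cmod_sqpow k z : Cmod (sqpow k z) = rsqpow k (Cmod z).
Proof. induction k as [|k IH]; simpl; [trivial|]; rewrite Cmod_mult, IH; trivial. Qed.

(** Multiplying by [r] avoids the exponent [2 ^ k - 1]. *)
Lemma Cmod_sqpow' k z r : Cmod z <= r -> r * Cmod (sqpow' k z) <= 2 ^ k * rsqpow k r.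
Proof.
  intros Hz; assert (Hr := Rle_trans _ _ _ (Cmod_ge_0 z) Hz).
  induction k as [|k IH]; simpl.
  - rewrite Cmod_1; lra.
  - rewrite !Cmod_mult, Cmod_sqpow, Cmod_R_pos by lra.
    assert (H1 := rsqpow_le k (Cmod z) r (conj (Cmod_ge_0 z) Hz)).
    assert (H2 := rsqpow_nonneg k _ (Cmod_ge_0 z)).
    assert (H3 := Cmod_ge_0 (sqpow' k z)).
    assert (rsqpow k (Cmod z) * (r * Cmod (sqpow' k z)) <= rsqpow k r * (2 ^ k * rsqpow k r)).
    { apply Rmult_le_compat; trivial; apply Rmult_le_pos; lra. }
    lra.
Qed.

(** * A holomorphic function that is small on a disk and large on a slit annulus *)

Section Layer.

Variables (r rho a b c sg : R).
Hypothesis Hr : 0 < r.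
Hypothesis Hrho : r < rho < a.
Hypothesis Hab : a <= b.
Hypothesis Hc : c < rho.
Hypothesis Hsg : sg = 1 \/ sg = -1.

(** The disk where the function is to be small and the slit ring where it is to be large. Poles come
    from infinity through the gap along a horizontal ray and then turn along the circle of radius
    [rho]; both stay at distance at least [d] from [E]. *)
Let E (z : C) : Prop := Cmod z <= r \/ (a <= Cmod z <= b /\ sg * Re z <= c).
Let d : R := Rmin (Rmin (rho - r) (a - rho)) (rho - c).

Lemma layer_d : 0 < d /\ d <= rho - r /\ d <= a - rho /\ d <= rho - c.
Proof.
  unfold d; generalize (Rmin_l (Rmin (rho - r) (a - rho)) (rho - c))
   (Rmin_r (Rmin (rho - r) (a - rho)) (rho - c)) (Rmin_l (rho - r) (a - rho)) (Rmin_r (rho - r) (a - rho)).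
  intros; split; [repeat apply Rmin_pos|]; lra.
Qed.

Lemma Rabs_sign : Rabs sg = 1.
Proof. destruct Hsg as [-> | ->]; [apply Rabs_R1|unfold Rabs; destruct (Rcase_abs (-1)); lra]. Qed.

Lemma layer_bounded z : E z -> Cmod z <= b.
Proof. intros [H|[H _]]; lra. Qed.

Lemma layer_dist_slit x z : rho <= x -> E z -> d <= Cmod (z - (sg * x)%R).
Proof.
  intros Hx Hz; destruct layer_d as (D0 & D1 & D2 & D3).
  assert (Hsx : Cmod (sg * x)%R = x).
  { rewrite Cmod_R, Rabs_mult, Rabs_sign, Rmult_1_l; apply Rabs_pos_eq; lra. }
  destruct Hz as [H|[_ H]].
  - generalize (Cmod_triangle_rev (sg * x)%R z); rewrite Cmod_minus_sym, Hsx; lra.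
  - generalize (re_le_Cmod (z - (sg * x)%R)); unfold Re in *; simpl; intros K.
    apply Rle_trans with (2 := K).
    destruct Hsg as [Es|Es]; rewrite Es in *; unfold Rabs; destruct (Rcase_abs _); lra.
Qed.

Lemma layer_dist_circle t z : E z -> d <= Cmod (z - rho * cis t).
Proof.
  intros Hz; destruct layer_d as (D0 & D1 & D2 & D3).
  assert (Ht : Cmod (rho * cis t) = rho) by (rewrite Cmod_mult, Cmod_cis, Cmod_R_pos; lra).
  generalize (Cmod_triangle_rev z (rho * cis t)) (Cmod_triangle_rev (rho * cis t) z).
  rewrite (Cmod_minus_sym (rho * cis t) z), Ht; destruct Hz as [H|[H _]]; lra.
Qed.

Lemma pole_slit : pole E (sg * rho)%R.
Proof.
  destruct layer_d as (D0 & D1 & D2 & D3).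
  (* Steps of length [d / 2] inwards from a far pole; [Rmax] stops the last one at [rho]. *)
  assert (Hn : forall n, pole E (sg * Rmax rho (2 * (b + rho) - INR n * (d / 2)))%R).
  { induction n as [|n IH].
    - simpl; rewrite Rmult_0_l, Rminus_0_r, Rmax_right by lra.
      apply (pole_far E (b + rho)); [lra| |].
      + intros z Hz; generalize (layer_bounded z Hz); lra.
      + rewrite Cmod_R, Rabs_mult, (Rabs_pos_eq (2 * (b + rho))) by lra.
        rewrite Rabs_sign; lra.
    - rewrite S_INR.
      apply (pole_move E d (sg * Rmax rho (2 * (b + rho) - INR n * (d / 2)))%R); trivial.
      + intros z Hz; apply layer_dist_slit; trivial; apply Rmax_l.
      + rewrite <- RtoC_minus, Cmod_R, <- Rmult_minus_distr_l, Rabs_mult.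
        rewrite Rabs_sign, Rmult_1_l; apply Rabs_le; unfold Rmax.
        destruct (Rle_dec rho (2 * (b + rho) - (INR n + 1) * (d / 2))),
          (Rle_dec rho (2 * (b + rho) - INR n * (d / 2))); lra. }
  destruct (exists_nat_mult (2 * (b + rho) - rho) (d / 2)) as [n Hnn]; [lra|].
  specialize (Hn n); rewrite Rmax_left in Hn by lra; trivial.
Qed.

Lemma pole_circle t : pole E (rho * cis t).
Proof.
  destruct layer_d as (D0 & D1 & D2 & D3).
  assert (H0 : exists t0, (rho * cis t0)%C = (sg * rho)%R).
  { destruct Hsg as [-> | ->].
    - exists 0; unfold cis; rewrite cos_0, sin_0; apply C_ext; unfold Re, Im; simpl; ring.
    - exists PI; unfold cis; rewrite cos_PI, sin_PI; apply C_ext; unfold Re, Im; simpl; ring. }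
  destruct H0 as [t0 Ht0].
  (* With [n] equal rotations the chord is at most [2 * rho * Rabs (t - t0) / n], which must not
     exceed [d / 2]. *)
  destruct (exists_nat_mult (Rabs (t - t0) * (4 * rho)) d D0) as [n0 Hn0].
  set (n := S n0).
  assert (HN : 0 < INR n) by (apply lt_0_INR; unfold n; lia).
  assert (Hall : forall i, pole E (rho * cis (t0 + INR i / INR n * (t - t0)))).
  { induction i as [|i IH].
    - replace (t0 + INR 0 / INR n * (t - t0)) with t0 by (change (INR 0) with 0; field; lra).
      rewrite Ht0; apply pole_slit.
    - apply (pole_move E d (rho * cis (t0 + INR i / INR n * (t - t0)))%C); trivial.
      + intros z Hz; apply layer_dist_circle, Hz.
      + match goal with |- Cmod (?x * ?u - ?x * ?v) <= _ => replace (x * u - x * v)%C with (x * (u - v))%C by ring end.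
        rewrite Cmod_mult, Cmod_R_pos by lra.
        eapply Rle_trans; [apply Rmult_le_compat_l; [lra|apply cis_lipschitz]|].
        replace (t0 + INR (S i) / INR n * (t - t0) - (t0 + INR i / INR n * (t - t0)))
          with ((t - t0) * / INR n) by (rewrite S_INR; field; lra).
        rewrite Rabs_mult, (Rabs_pos_eq (/ INR n)) by (left; apply Rinv_0_lt_compat; trivial).
        apply Rmult_le_reg_r with (INR n); trivial.
        replace (rho * (2 * (Rabs (t - t0) * / INR n)) * INR n) with (Rabs (t - t0) * (4 * rho) / 2)
          by (field; lra).
        unfold n; rewrite S_INR; lra. }
  specialize (Hall n); replace (t0 + INR n / INR n * (t - t0)) with t in Hall by (field; lra); trivial.
Qed.

Lemma sqpow_neq k t z : E z -> (rsqpow k rho * cis t - sqpow k z)%C <> 0.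
Proof.
  intros Hz K.
  assert (Hm : Cmod (sqpow k z) = rsqpow k rho).
  { replace (sqpow k z) with (rsqpow k rho * cis t - (rsqpow k rho * cis t - sqpow k z))%C by ring.
    rewrite K; replace (rsqpow k rho * cis t - 0)%C with (rsqpow k rho * cis t)%C by ring.
    rewrite Cmod_mult, Cmod_cis, Cmod_R_pos; [ring|apply rsqpow_nonneg; lra]. }
  rewrite Cmod_sqpow in Hm; destruct Hz as [H|[H _]].
  - assert (rsqpow k (Cmod z) < rsqpow k rho) by (apply rsqpow_lt; generalize (Cmod_ge_0 z); lra); lra.
  - assert (rsqpow k rho < rsqpow k (Cmod z)) by (apply rsqpow_lt; lra); lra.
Qed.

(* [1/(beta^2-w^2) = 1/(beta-w) * 1/(beta+w)], where [-beta] is again on the circle. *)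
Lemma appr_sqpow k : forall t, appr E (fun z => / (rsqpow k rho * cis t - sqpow k z))%C
  (fun z => sqpow' k z * (/ (rsqpow k rho * cis t - sqpow k z) * / (rsqpow k rho * cis t - sqpow k z)))%C.
Proof.
  induction k as [|k IH]; intros t.
  - eapply appr_ext; [|apply appr_scal, (pole_circle t)]; intros z Hz; simpl.
    assert (N := sqpow_neq 0 t z Hz); simpl in N.
    assert (N' : (z - rho * cis t)%C <> 0)
      by (intros K; apply N; transitivity (- (z - rho * cis t))%C; [ring|rewrite K; ring]).
    instantiate (1 := (- (1))%C); split; field; repeat split; trivial.
  - assert (Hg : forall z, E z -> (rsqpow k rho * cis (t / 2) - sqpow k z)%C <> 0) by (intros; apply sqpow_neq; trivial).
    assert (Hg2 : forall z, E z -> (rsqpow k rho * cis (t / 2 + PI) - sqpow k z)%C <> 0) by (intros; apply sqpow_neq; trivial).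
    assert (E1 : cis t = (cis (t / 2) * cis (t / 2))%C) by (rewrite <- cis_plus; f_equal; field).
    assert (E2 : cis (t / 2 + PI) = (- cis (t / 2))%C).
    { rewrite cis_plus; unfold cis at 2; rewrite cos_PI, sin_PI; apply C_ext; unfold Re, Im; simpl; ring. }
    eapply appr_ext; [|apply (appr_scal E (- (1))%C _ _ (appr_mult E _ _ _ _ (IH (t / 2)) (IH (t / 2 + PI))))].
    intros z Hz; simpl; specialize (Hg z Hz); specialize (Hg2 z Hz).
    assert (Hg3 := sqpow_neq (S k) t z Hz); simpl in Hg3.
    rewrite E2 in *; rewrite E1 in *; rewrite RtoC_mult in *.
    set (R := RtoC (rsqpow k rho)) in *; set (u := cis (t / 2)) in *; set (w := sqpow k z) in *.
    split; field; repeat split; trivial.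
Qed.

(** The model is [N * (1 - P / (P - z ^ (2 ^ k)))] with [P = rho ^ (2 ^ k)]: for large [k] it is
    close to 0 inside the circle of radius [rho] and close to [N] outside. Its poles lie on that
    circle, so it can be approximated on [E] by entire functions. *)
Lemma layer_function_aux (M eps : R) : 0 < M -> 0 < eps ->
  exists f f', entire f f' /\
    (forall z, Cmod z <= r -> Cmod (f z) <= eps /\ Cmod (f' z) <= eps) /\
    (forall z, a <= Cmod z <= b -> sg * Re z <= c -> M <= Re (f z)).
Proof.
  intros HM He.
  set (q := r / rho); set (v := rho / a).
  assert (Hq : 0 < q < 1).
  { unfold q; split; [apply Rdiv_lt_0_compat; lra|apply Rmult_lt_reg_r with rho; [lra|]; field_simplify; lra]. }
  assert (Hv : 0 < v < 1).
  { unfold v; split; [apply Rdiv_lt_0_compat; lra|apply Rmult_lt_reg_r with a; [lra|]; field_simplify; lra]. }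
  (* On the ring the real part is at least [N - N / 3 - 1], hence at least [M]. *)
  set (N := 2 * (M + 1)).
  (* [1 / 4] keeps the denominator away from 0; the other two bound the model and its derivative on
     the disk by [eps / 2], and the other half of [eps] is for the approximation. *)
  set (e := Rmin (1 / 4) (Rmin (eps / (4 * N)) (eps * r / (8 * N)))).
  assert (He0 : 0 < e).
  { unfold e, N; repeat apply Rmin_pos; try lra; apply Rdiv_lt_0_compat; try apply Rmult_lt_0_compat; lra. }
  assert (He1 : e <= 1 / 4) by apply Rmin_l.
  assert (He2 : e * (4 * N) <= eps).
  { apply Rle_trans with (eps / (4 * N) * (4 * N)); [|right; field; unfold N; lra].
    apply Rmult_le_compat_r; [unfold N; lra|]; unfold e; eapply Rle_trans; [apply Rmin_r|apply Rmin_l]. }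
  assert (He3 : e * (8 * N) <= eps * r).
  { apply Rle_trans with (eps * r / (8 * N) * (8 * N)); [|right; field; unfold N; lra].
    apply Rmult_le_compat_r; [unfold N; lra|]; unfold e; eapply Rle_trans; [apply Rmin_r|apply Rmin_r]. }
  (* The factor [2 ^ k] in front of the small power pays for the derivative of [z ^ (2 ^ k)]. *)
  destruct (pow2_pow_small q e Hq He0) as [k1 Hk1], (pow2_pow_small v e Hv He0) as [k2 Hk2].
  set (k := (k1 + k2)%nat).
  assert (Hqk := Hk1 k ltac:(unfold k; lia)); assert (Hvk := Hk2 k ltac:(unfold k; lia)).
  clear Hk1 Hk2.
  assert (H2k : 1 <= 2 ^ k) by (apply pow_R1_Rle; lra).
  set (P := rsqpow k rho); assert (HP : 0 < P) by (apply rsqpow_pos; lra).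
  assert (Hqr : rsqpow k r = q ^ (2 ^ k)%nat * P).
  { unfold P; rewrite !rsqpow_pow, <- Rpow_mult_distr; f_equal; unfold q; field; lra. }
  assert (Hva : P = v ^ (2 ^ k)%nat * rsqpow k a).
  { unfold P; rewrite !rsqpow_pow, <- Rpow_mult_distr; f_equal; unfold v; field; lra. }
  assert (Hqp : 0 < q ^ (2 ^ k)%nat) by (apply pow_lt; lra).
  assert (Hvp : 0 < v ^ (2 ^ k)%nat) by (apply pow_lt; lra).
  assert (Hap := appr_sqpow k 0); fold P in Hap.
  replace (cis 0) with (RtoC 1) in Hap
    by (unfold cis; rewrite cos_0, sin_0; apply C_ext; unfold Re, Im; simpl; ring).
  assert (Hne : forall z, E z -> (P * 1 - sqpow k z)%C <> 0).
  { intros z Hz; assert (K := sqpow_neq k 0 z Hz).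
    replace (cis 0) with (RtoC 1) in K
      by (unfold cis; rewrite cos_0, sin_0; apply C_ext; unfold Re, Im; simpl; ring); trivial. }
  assert (HPc : RtoC P <> 0) by (intros K; apply RtoC_inj in K; lra).
  assert (HF : appr E (fun z => N * (1 - P * / (P * 1 - sqpow k z)))%C
    (fun z => - (N * P * (sqpow' k z * (/ (P * 1 - sqpow k z) * / (P * 1 - sqpow k z)))))%C).
  { eapply appr_ext; [|apply (appr_plus E _ _ _ _ (appr_const E N) (appr_scal E (- (N * P))%C _ _ Hap))].
    intros z Hz; split; simpl; ring. }
  destruct HF as [_ HF]; destruct (HF (Rmin 1 (eps / 2))) as (f & f' & Hf & Hff).
  { apply Rmin_pos; lra. }
  exists f, f'; split; trivial.
  assert (Hm1 := Rmin_l 1 (eps / 2)); assert (Hm2 := Rmin_r 1 (eps / 2)).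
  split.
  - intros z Hz; assert (HEz : E z) by (left; trivial).
    destruct (Hff z HEz) as [K1 K2]; specialize (Hne z HEz).
    assert (Hne' : (P - sqpow k z)%C <> 0) by (rewrite <- (Cmult_1_r P); trivial).
    assert (Hw : Cmod (sqpow k z) <= e * P).
    { rewrite Cmod_sqpow; eapply Rle_trans; [apply (rsqpow_le k _ r); split; [apply Cmod_ge_0|trivial]|].
      rewrite Hqr; apply Rmult_le_compat_r; [lra|]; nra. }
    assert (Hden : P / 2 <= Cmod (P * 1 - sqpow k z)).
    { generalize (Cmod_triangle_rev (P * 1) (sqpow k z)); rewrite Cmult_1_r, Cmod_R_pos by lra; nra. }
    assert (Hi : Cmod (/ (P * 1 - sqpow k z)) <= 2 / P).
    { rewrite Cmod_inv by trivial; replace (2 / P) with (/ (P / 2)) by (field; lra).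
      apply Rinv_le_contravar; lra. }
    assert (HN : 0 < N) by (unfold N; lra).
    generalize (Cmod_ge_0 (/ (P * 1 - sqpow k z))) (Cmod_ge_0 (sqpow k z)) (Cmod_ge_0 (sqpow' k z)); intros Q1 Q2 Q3.
    split.
    + eapply Rle_trans; [apply (Cmod_triangle_rev' (f z) (N * (1 - P * / (P * 1 - sqpow k z))))|].
      rewrite Cmod_minus_sym in K1.
      replace (N * (1 - P * / (P * 1 - sqpow k z)))%C with (- (N * (sqpow k z * / (P * 1 - sqpow k z))))%C in *
        by (field; trivial).
      rewrite Cmod_opp, !Cmod_mult, Cmod_R_pos by lra.
      assert (Cmod (sqpow k z) * Cmod (/ (P * 1 - sqpow k z)) <= e * P * (2 / P))
        by (apply Rmult_le_compat; trivial).
      replace (e * P * (2 / P)) with (2 * e) in * by (field; lra).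
      assert (N * (Cmod (sqpow k z) * Cmod (/ (P * 1 - sqpow k z))) <= N * (2 * e))
        by (apply Rmult_le_compat_l; lra).
      lra.
    + eapply Rle_trans; [apply (Cmod_triangle_rev' (f' z)
        (- (N * P * (sqpow' k z * (/ (P * 1 - sqpow k z) * / (P * 1 - sqpow k z))))))|].
      rewrite Cmod_minus_sym in K2; rewrite Cmod_opp, !Cmod_mult, !Cmod_R_pos by lra.
      assert (Hw' : Cmod (sqpow' k z) <= e * P / r).
      { apply Rmult_le_reg_l with r; trivial.
        eapply Rle_trans; [apply Cmod_sqpow', Hz|].
        rewrite Hqr, <- Rmult_assoc.
        replace (r * (e * P / r)) with (e * P) by (field; lra).
        apply Rmult_le_compat_r; lra. }
      assert (Cmod (/ (P * 1 - sqpow k z)) * Cmod (/ (P * 1 - sqpow k z)) <= 2 / P * (2 / P))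
        by (apply Rmult_le_compat; trivial).
      assert (Cmod (sqpow' k z) * (Cmod (/ (P * 1 - sqpow k z)) * Cmod (/ (P * 1 - sqpow k z)))
         <= e * P / r * (2 / P * (2 / P))).
      { apply Rmult_le_compat; trivial; apply Rmult_le_pos; trivial. }
      assert (N * P * (Cmod (sqpow' k z) * (Cmod (/ (P * 1 - sqpow k z)) * Cmod (/ (P * 1 - sqpow k z))))
         <= N * P * (e * P / r * (2 / P * (2 / P)))).
      { apply Rmult_le_compat_l; trivial; apply Rmult_le_pos; lra. }
      replace (N * P * (e * P / r * (2 / P * (2 / P)))) with (e * (8 * N) / r / 2) in * by (field; lra).
      assert (e * (8 * N) / r <= eps).
      { apply Rmult_le_reg_r with r; trivial; field_simplify; lra. }
      lra.
  - intros z Hz Hs; assert (HEz : E z) by (right; split; trivial).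
    destruct (Hff z HEz) as [K1 _]; specialize (Hne z HEz).
    assert (Hw : P <= e * Cmod (sqpow k z)).
    { rewrite Cmod_sqpow, Hva; apply Rmult_le_compat.
      - lra.
      - apply rsqpow_nonneg; lra.
      - nra.
      - apply rsqpow_le; lra. }
    assert (HN : 0 < N) by (unfold N; lra).
    set (D := (P * 1 - sqpow k z)%C) in *.
    assert (HD : 3 * P <= Cmod D).
    { generalize (Cmod_triangle_rev (sqpow k z) (P * 1)).
      rewrite (Cmod_minus_sym (sqpow k z)); fold D; rewrite Cmult_1_r, Cmod_R_pos by lra.
      intros; nra. }
    assert (Hq1 : Cmod (N * (P * / D)) <= N * (1 / 3)).
    { rewrite !Cmod_mult, Cmod_inv, !Cmod_R_pos by (trivial; lra).
      apply Rmult_le_compat_l; [lra|].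
      apply Rmult_le_reg_r with (Cmod D); [lra|]; field_simplify; lra. }
    generalize (re_le_Cmod (N * (1 - P * / D) - f z)) (re_le_Cmod (N * (P * / D))).
    intros R1 R2; apply Rabs_le_between in R2.
    assert (R3 : Re (N * (1 - P * / D) - f z) = N - Re (N * (P * / D)) - Re (f z))
      by (unfold Re; simpl; ring).
    rewrite R3 in R1.
    assert (R4 : Rabs (N - Re (N * (P * / D)) - Re (f z)) <= 1) by lra.
    apply Rabs_le_between in R4; unfold N in *; lra.
Qed.

End Layer.

Lemma layer_function (r a b c sg M eps : R) :
  0 < r -> r < a -> a <= b -> c <= r -> (sg = 1 \/ sg = -1) -> 0 < eps ->
  exists f f', entire f f' /\
    (forall z, Cmod z <= r -> Cmod (f z) <= eps /\ Cmod (f' z) <= eps) /\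
    (forall z, a <= Cmod z <= b -> sg * Re z <= c -> M <= Re (f z)).
Proof.
  intros Hr Hra Hab Hc Hsg He.
  destruct (layer_function_aux r ((r + a) / 2) a b c sg) with (M := Rmax M 1) (eps := eps)
    as (f & f' & H1 & H2 & H3); trivial; try lra.
  - generalize (Rmax_r M 1); lra.
  - exists f, f'; split; [|split]; trivial.
    intros z Hz Hs; generalize (Rmax_l M 1) (H3 z Hz Hs); lra.
Qed.

(** * The labyrinth *)

Definition clamp (lo hi x : R) : R := Rmax lo (Rmin hi x).

Lemma clamp_bounds lo hi x : lo <= hi -> lo <= clamp lo hi x <= hi.
Proof.
  intros; unfold clamp, Rmax, Rmin; destruct (Rle_dec hi x); destruct (Rle_dec lo _); lra.
Qed.

Lemma clamp_lipschitz lo hi x y : lo <= hi -> Rabs (clamp lo hi x - clamp lo hi y) <= Rabs (x - y).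
Proof.
  intros; unfold clamp, Rmax, Rmin.
  destruct (Rle_dec hi x), (Rle_dec hi y);
   repeat match goal with |- context [Rle_dec ?a ?b] => destruct (Rle_dec a b) end;
   unfold Rabs; repeat destruct (Rcase_abs _); lra.
Qed.

Lemma clamp_low lo hi x : lo <= hi -> x <= lo -> clamp lo hi x = lo.
Proof. intros; unfold clamp, Rmax, Rmin; destruct (Rle_dec hi x); destruct (Rle_dec lo _); lra. Qed.

Lemma clamp_high lo hi x : lo <= hi -> hi <= x -> clamp lo hi x = hi.
Proof. intros; unfold clamp, Rmax, Rmin; destruct (Rle_dec hi x); destruct (Rle_dec lo _); lra. Qed.

Lemma Cmod_lipschitz z w : Rabs (Cmod z - Cmod w) <= Cmod (z - w).
Proof.
  apply Rabs_le; generalize (Cmod_triangle_rev z w) (Cmod_triangle_rev w z).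
  rewrite (Cmod_minus_sym w z); lra.
Qed.

Fixpoint sgn (n : nat) : R := match n with O => 1 | S n => - sgn n end.

Lemma sgn_cases n : sgn n = 1 \/ sgn n = -1.
Proof. induction n as [|n [IH|IH]]; simpl; [left| right | left]; lra. Qed.

Section Labyrinth.

Variables (c s h : R).
Hypothesis Hc : 0 < c.
Hypothesis Hs : c <= s.
Hypothesis Hh : 0 < h.

(** Ring [j] occupies the radii from [a j] to [b j]; rings and the corridors between them all have
    width [h]. *)
Let a (j : nat) : R := s + (2 * INR j + 1) * h.
Let b (j : nat) : R := s + (2 * INR j + 2) * h.
Let wall (j : nat) (z : C) : Prop := a j <= Cmod z <= b j /\ sgn j * Re z <= c.
(** Saturation at the abscissas [c] and [- c] makes [u] constant inside every gap. *)
Let u (z : C) : R := clamp (- c) c (Re z).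
Let chi (j : nat) (x : R) : R := clamp 0 1 ((x - a j) / h).

(* Between the walls [n-1] and [n] this is [(2n+1)c + sgn n * u]; the increment at a
   wall vanishes in its gap, so that only the walls need a large metric. *)
Fixpoint pot (n : nat) (z : C) : R :=
  match n with
  | O => c + u z
  | S n => pot n z + 2 * chi n (Cmod z) * (c - sgn n * u z)
  end.

Lemma b_eq j : b j = a j + h.
Proof. unfold a, b; ring. Qed.

Lemma u_bounds z : - c <= u z <= c.
Proof. apply clamp_bounds; lra. Qed.

Lemma u_lipschitz z w : Rabs (u z - u w) <= Cmod (z - w).
Proof.
  eapply Rle_trans; [apply clamp_lipschitz; lra|].
  eapply Rle_trans; [|apply re_le_Cmod]; right; f_equal.
Qed.

Lemma gap_factor_bounds n z : 0 <= c - sgn n * u z <= 2 * c.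
Proof. generalize (u_bounds z); destruct (sgn_cases n) as [-> | ->]; lra. Qed.

Lemma chi_low j x : x <= a j -> chi j x = 0.
Proof.
  intros H; apply clamp_low; [lra|]; apply Rmult_le_reg_r with h; trivial; field_simplify; lra.
Qed.

Lemma chi_high j x : b j <= x -> chi j x = 1.
Proof.
  rewrite b_eq; intros H; apply clamp_high; [lra|]; apply Rmult_le_reg_r with h; trivial; field_simplify; lra.
Qed.

(** This constant grows as [h] shrinks. It is used only on the walls, where the height of [Re H] is
    chosen after it. *)
Lemma pot_lipschitz n : exists L, 0 < L /\ forall z w, Rabs (pot n z - pot n w) <= L * Cmod (z - w).
Proof.
  induction n as [|n [L [HL IH]]].
  - exists 1; split; [lra|]; intros z w; simpl.
    replace (c + u z - (c + u w)) with (u z - u w) by ring.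
    rewrite Rmult_1_l; apply u_lipschitz.
  - exists (L + 2 * (2 * c / h + 1)); split.
    { assert (0 < 2 * c / h) by (apply Rdiv_lt_0_compat; lra); lra. }
    intros z w; simpl.
    replace (pot n z + 2 * chi n (Cmod z) * (c - sgn n * u z) -
     (pot n w + 2 * chi n (Cmod w) * (c - sgn n * u w))) with
     ((pot n z - pot n w) + (2 * ((chi n (Cmod z) - chi n (Cmod w)) * (c - sgn n * u z))
       + 2 * (chi n (Cmod w) * (sgn n * (u w - u z))))) by ring.
    eapply Rle_trans; [apply Rabs_triang|].
    eapply Rle_trans; [apply Rplus_le_compat_l, Rabs_triang|].
    rewrite !Rabs_mult, (Rabs_pos_eq 2) by lra.
    assert (Hsg : Rabs (sgn n) = 1).
    { destruct (sgn_cases n) as [-> | ->]; [apply Rabs_R1|unfold Rabs; destruct (Rcase_abs (-1)); lra]. }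
    assert (H1 : Rabs (chi n (Cmod z) - chi n (Cmod w)) <= / h * Cmod (z - w)).
    { eapply Rle_trans; [apply clamp_lipschitz; lra|].
      replace ((Cmod z - a n) / h - (Cmod w - a n) / h) with (/ h * (Cmod z - Cmod w)) by (field; lra).
      assert (0 < / h) by (apply Rinv_0_lt_compat, Hh).
      rewrite Rabs_mult, Rabs_pos_eq by lra; apply Rmult_le_compat_l; [lra|apply Cmod_lipschitz]. }
    assert (H2 : Rabs (c - sgn n * u z) <= 2 * c)
      by (generalize (gap_factor_bounds n z); intros; rewrite Rabs_pos_eq; lra).
    assert (H3 : Rabs (chi n (Cmod w)) <= 1).
    { destruct (clamp_bounds 0 1 ((Cmod w - a n) / h)); [lra|]; unfold chi; rewrite Rabs_pos_eq; lra. }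
    assert (H4 := u_lipschitz w z); rewrite Cmod_minus_sym in H4.
    assert (H5 : Rabs (chi n (Cmod z) - chi n (Cmod w)) * Rabs (c - sgn n * u z) <= / h * Cmod (z - w) * (2 * c))
      by (apply Rmult_le_compat; trivial; apply Rabs_pos).
    assert (H6 : Rabs (chi n (Cmod w)) * (Rabs (sgn n) * Rabs (u w - u z)) <= 1 * Cmod (z - w)).
    { rewrite Hsg, Rmult_1_l; apply Rmult_le_compat; trivial; apply Rabs_pos. }
    replace ((L + 2 * (2 * c / h + 1)) * Cmod (z - w)) with
     (L * Cmod (z - w) + (2 * (/ h * Cmod (z - w) * (2 * c)) + 2 * (1 * Cmod (z - w)))) by (field; lra).
    specialize (IH z w); lra.
Qed.

Lemma pot_beyond n z : (forall i, (i < n)%nat -> b i <= Cmod z) ->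
  pot n z = (2 * INR n + 1) * c + sgn n * u z.
Proof.
  induction n as [|n IH]; intros H; [simpl; ring|].
  simpl pot; rewrite IH, chi_high, S_INR by (intros; apply H; lia); simpl sgn; ring.
Qed.

Lemma pot_inside n z : Cmod z <= s -> pot n z <= 2 * c.
Proof.
  intros Hz; induction n as [|n IH]; simpl; [generalize (u_bounds z); lra|].
  rewrite chi_low; [lra|]; unfold a; generalize (pos_INR n); intros; nra.
Qed.

(** Before the last ring its increment is 0; beyond it [pot_beyond] gives a constant plus or minus
    [u]; in its gap [u] is saturated and the potential is locally constant. *)
Lemma pot_gap n z : (forall i, (i < n)%nat -> ~ wall i z) ->
  exists eta, 0 < eta /\ forall w w', Cmod (w - z) < eta -> Cmod (w' - z) < eta ->
    Rabs (pot n w' - pot n w) <= Cmod (w' - w).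
Proof.
  assert (Hcl : forall k w w', Rabs (k + sgn n * u w' - (k + sgn n * u w)) <= Cmod (w' - w)).
  { intros k w w'; replace (k + sgn n * u w' - (k + sgn n * u w)) with (sgn n * (u w' - u w)) by ring.
    rewrite Rabs_mult; replace (Rabs (sgn n)) with 1; [rewrite Rmult_1_l; apply u_lipschitz|].
    destruct (sgn_cases n) as [-> | ->]; [rewrite Rabs_R1|unfold Rabs; destruct (Rcase_abs (-1))]; lra. }
  revert Hcl; induction n as [|n IH]; intros Hcl Hz.
  - exists 1; split; [lra|]; intros w w' _ _; simpl; specialize (Hcl c w w'); simpl in Hcl.
    rewrite !Rmult_1_l in Hcl; trivial.
  - destruct (Rlt_le_dec (Cmod z) (a n)) as [Hlt|Hge].
    + destruct IH as [e [He H]].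
      (* The auxiliary bound is passed to the previous index, where the sign is opposite. *)
      { intros k w w'; replace (k + sgn n * u w' - (k + sgn n * u w)) with (- (0 + sgn (S n) * u w' - (0 + sgn (S n) * u w)))
         by (simpl; ring).
        rewrite Rabs_Ropp; apply Hcl. }
      { intros i Hi; apply Hz; lia. }
      exists (Rmin e (a n - Cmod z)); split; [apply Rmin_pos; lra|].
      intros w w' Hw Hw'; simpl.
      generalize (Rmin_l e (a n - Cmod z)) (Rmin_r e (a n - Cmod z)); intros.
      rewrite !chi_low.
      * replace (pot n w' + 2 * 0 * (c - sgn n * u w') - (pot n w + 2 * 0 * (c - sgn n * u w)))
         with (pot n w' - pot n w) by ring.
        apply H; lra.
      * generalize (Cmod_triangle_rev' w z); lra.
      * generalize (Cmod_triangle_rev' w' z); lra.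
    + assert (Hprev : exists e, 0 < e /\ forall w, Cmod (w - z) < e -> forall i, (i < n)%nat -> b i <= Cmod w).
      (* The preceding ring ends a full corridor width [h] before [a n]. *)
      { exists h; split; trivial; intros w Hw i Hi.
        assert (INR i + 1 <= INR n) by (rewrite <- S_INR; apply le_INR; lia).
        generalize (Cmod_triangle_rev' z w); rewrite (Cmod_minus_sym z w).
        unfold a, b in *; nra. }
      destruct Hprev as [e [He Hprev]].
      destruct (Rlt_le_dec (b n) (Cmod z)) as [Hbz|Hbz].
      * exists (Rmin e (Cmod z - b n)); split; [apply Rmin_pos; lra|].
        intros w w' Hw Hw'.
        generalize (Rmin_l e (Cmod z - b n)) (Rmin_r e (Cmod z - b n)); intros.
        assert (Hb : forall v, Cmod (v - z) < Rmin e (Cmod z - b n) -> forall i, (i < S n)%nat -> b i <= Cmod v).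
        { intros v Hv i Hi; destruct (Nat.eq_dec i n) as [->|Hne].
          - generalize (Cmod_triangle_rev' z v); rewrite (Cmod_minus_sym z v); lra.
          - apply Hprev; [lra|lia]. }
        rewrite !pot_beyond by (apply Hb; trivial); apply Hcl.
      * assert (Hgap : c < sgn n * Re z).
        { apply Rnot_le_lt; intros Hle; apply (Hz n); [lia|split; [split|]; trivial]. }
        exists (Rmin e (sgn n * Re z - c)); split; [apply Rmin_pos; lra|].
        intros w w' Hw Hw'.
        generalize (Rmin_l e (sgn n * Re z - c)) (Rmin_r e (sgn n * Re z - c)); intros.
        assert (Hu : forall v, Cmod (v - z) < Rmin e (sgn n * Re z - c) -> u v = sgn n * c).
        { intros v Hv; generalize (re_le_Cmod (v - z)); intros Hre.
          replace (Re (v - z)) with (Re v - Re z) in Hre by (unfold Re; simpl; ring).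
          apply Rabs_le_between in Hre; unfold u.
          destruct (sgn_cases n) as [E|E]; rewrite E in *.
          - rewrite clamp_high; lra.
          - rewrite clamp_low; lra. }
        assert (Hval : forall v, Cmod (v - z) < Rmin e (sgn n * Re z - c) -> pot (S n) v = (2 * INR n + 1) * c + c).
        { intros v Hv; simpl; rewrite pot_beyond by (apply Hprev; lra); rewrite (Hu v Hv).
          destruct (sgn_cases n) as [-> | ->]; ring. }
        rewrite !Hval, Rminus_diag, Rabs_R0 by trivial; apply Cmod_ge_0.
Qed.

Lemma Rmin_lipschitz k x y : Rabs (Rmin x k - Rmin y k) <= Rabs (x - y).
Proof.
  unfold Rmin; destruct (Rle_dec x k), (Rle_dec y k); unfold Rabs;
   repeat destruct (Rcase_abs _); lra.
Qed.

(** Beyond the last ring [pot N] is at least [2 * INR N * c]. Cutting it there keeps the Lipschitz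
    bounds and makes it constant where the exponent is not controlled. *)
Lemma labyrinth_potential N : (0 < N)%nat -> exists (psi : C -> R) (L : R), 0 < L /\
  (forall z w, Rabs (psi z - psi w) <= L * Cmod (z - w)) /\
  (forall z, (forall i, (i < N)%nat -> ~ wall i z) -> exists eta, 0 < eta /\
     forall w w', Cmod (w - z) < eta -> Cmod (w' - z) < eta -> Rabs (psi w' - psi w) <= Cmod (w' - w)) /\
  (forall z, Cmod z <= s -> psi z <= 2 * c) /\
  (forall z, s + 2 * INR N * h <= Cmod z -> psi z = 2 * INR N * c).
Proof.
  intros HN; destruct (pot_lipschitz N) as [L [HL Hlip]].
  exists (fun z => Rmin (pot N z) (2 * INR N * c)), L; split; [trivial|split; [|split; [|split]]].
  - intros z w; eapply Rle_trans; [apply Rmin_lipschitz|apply Hlip].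
  - intros z Hz; destruct (pot_gap N z Hz) as [eta [He H]]; exists eta; split; trivial.
    intros w w' Hw Hw'; eapply Rle_trans; [apply Rmin_lipschitz|apply H; trivial].
  - intros z Hz; eapply Rle_trans; [apply Rmin_l|apply pot_inside, Hz].
  - intros z Hz; apply Rmin_right; rewrite pot_beyond.
    + generalize (u_bounds z); destruct (sgn_cases N) as [-> | ->]; lra.
    + intros i Hi; apply Rle_trans with (2 := Hz).
      assert (INR i + 1 <= INR N) by (rewrite <- S_INR; apply le_INR; lia).
      unfold b; nra.
Qed.

(** The walls are treated from the inside outwards: the function added for a new wall is small on a
    disk containing all previous ones. *)
Lemma walls_function (g g' : C -> C) : entire g g' ->
  forall n M eps, 0 < eps -> exists f f', entire f f' /\
    (forall z, Cmod z <= s -> Cmod (f z) <= eps /\ Cmod (f' z) <= eps) /\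
    (forall i z, (i < n)%nat -> wall i z -> M <= Re (g z + f z)).
Proof.
  intros Hg; induction n as [|n IH]; intros M eps He.
  - exists (fun _ => RtoC 0), (fun _ => RtoC 0); split; [apply entire_const|split].
    + intros; rewrite Cmod_0; lra.
    + intros; lia.
  (* The excess 1 on the old walls pays for the new summand, kept below 1 there. *)
  - destruct (IH (M + 1) (eps / 2)) as (f & f' & Hf & Hf1 & Hf2); [lra|].
    destruct (compact_upper_bound (fun z => Cmod z <= b n) (fun z => Cmod (g z + f z))) as [B [HB HgB]].
    { apply compact_disk. }
    { intros z _; apply (continuous_comp (fun z => g z + f z)%C Cmod); [|apply continuous_Cmod].
      apply continuous_Cplus; eapply sd_continuous; [apply Hg|apply Hf]; exact I. }
    (* The outer radius of the previous wall, or [s] if there is none. *)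
    set (r := s + 2 * INR n * h).
    assert (Hrs : s <= r) by (unfold r; generalize (pos_INR n); intros; nra).
    (* Height [M + B] overcomes what [g + f] may already take away on the new wall. *)
    destruct (layer_function r (a n) (b n) c (sgn n) (M + B) (Rmin (eps / 2) 1))
      as (k & k' & Hk & Hk1 & Hk2); try (rewrite ?b_eq; unfold a, r in *; lra).
    { apply sgn_cases. }
    { apply Rmin_pos; lra. }
    assert (Hm1 := Rmin_l (eps / 2) 1); assert (Hm2 := Rmin_r (eps / 2) 1).
    exists (fun z => f z + k z)%C, (fun z => f' z + k' z)%C; split; [apply holo_plus; trivial|split].
    + intros z Hz; destruct (Hf1 z Hz), (Hk1 z ltac:(lra)).
      split; eapply Rle_trans; try apply Cmod_triangle; lra.
    + intros i z Hi Hw.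
      replace (g z + (f z + k z))%C with ((g z + f z) + k z)%C by ring.
      rewrite re_plus; destruct (Nat.eq_dec i n) as [->|Hne].
      * destruct Hw as [Hw1 Hw2]; specialize (Hk2 z Hw1 Hw2).
        generalize (HgB z (proj2 Hw1)) (re_le_Cmod (g z + f z)); intros Q1 Q2.
        apply Rabs_le_between in Q2; lra.
      * assert (Hin : (i < n)%nat) by lia; specialize (Hf2 i z Hin Hw).
        assert (Hzr : Cmod z <= r).
        { destruct Hw as [[_ Hw] _]; apply Rle_trans with (1 := Hw).
          assert (INR i + 1 <= INR n) by (rewrite <- S_INR; apply le_INR; lia).
          unfold b, r; nra. }
        destruct (Hk1 z Hzr) as [Hk3 _]; generalize (re_le_Cmod (k z)); intros Q2.
        apply Rabs_le_between in Q2; lra.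
Qed.

End Labyrinth.

(** * Lower bounds for the conformal factor, and one stage of the construction *)

Lemma exp_le_compat x y : x <= y -> exp x <= exp y.
Proof. intros [H| ->]; [left; apply exp_increasing, H|right; trivial]. Qed.

Definition weight (A B H : C -> C) (z : C) : R :=
  (Cmod (A z * Cexp (H z)) + Cmod (B z * Cexp (- H z))) / 2.

Lemma weight_exp A B H z :
  weight A B H z = (Cmod (A z) * exp (Re (H z)) + Cmod (B z) * exp (- Re (H z))) / 2.
Proof. unfold weight; rewrite !Cmod_mult, !Cmod_Cexp, re_opp; trivial. Qed.

(** Growth linear in [Re H] is enough on the walls and gives an explicit height to ask for. *)
Lemma weight_lower_A A B H z : Cmod (A z) * (1 + Re (H z)) / 2 <= weight A B H z.
Proof.
  rewrite weight_exp.
  generalize (exp_ineq1_le (Re (H z))) (Cmod_ge_0 (A z)) (Cmod_ge_0 (B z)) (exp_pos (- Re (H z))); intros.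
  assert (Cmod (A z) * (1 + Re (H z)) <= Cmod (A z) * exp (Re (H z))) by (apply Rmult_le_compat_l; trivial).
  assert (0 <= Cmod (B z) * exp (- Re (H z))) by (apply Rmult_le_pos; lra).
  lra.
Qed.

Lemma weight_lower_exp A B H z beta : Cmod (H z) <= beta ->
  exp (- beta) * ((Cmod (A z) + Cmod (B z)) / 2) <= weight A B H z.
Proof.
  intros Hb; rewrite weight_exp.
  generalize (re_le_Cmod (H z)); intros K; apply Rabs_le_between in K.
  assert (E1 : exp (- beta) <= exp (Re (H z))) by (apply exp_le_compat; lra).
  assert (E2 : exp (- beta) <= exp (- Re (H z))) by (apply exp_le_compat; lra).
  generalize (Cmod_ge_0 (A z)) (Cmod_ge_0 (B z)); intros; nra.
Qed.

(* AM-GM: this is where [A B = - f3^2] enters. *)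
Lemma weight_lower_f3 A B H z m : 0 <= m -> Cmod (A z) * Cmod (B z) = m ^ 2 -> m <= weight A B H z.
Proof.
  intros Hm HAB; rewrite weight_exp.
  generalize (exp_pos (Re (H z))) (exp_pos (- Re (H z))) (Cmod_ge_0 (A z)) (Cmod_ge_0 (B z)); intros.
  assert (Ee : exp (Re (H z)) * exp (- Re (H z)) = 1) by (rewrite <- exp_plus, Rplus_opp_r; apply exp_0).
  set (x := Cmod (A z) * exp (Re (H z))); set (y := Cmod (B z) * exp (- Re (H z))).
  assert (Hxy : x * y = m ^ 2).
  { unfold x, y; rewrite <- HAB; transitivity (Cmod (A z) * Cmod (B z) * (exp (Re (H z)) * exp (- Re (H z)))); [ring|rewrite Ee; ring]. }
  assert (Hx : 0 <= x) by (apply Rmult_le_pos; lra); assert (Hy : 0 <= y) by (apply Rmult_le_pos; lra).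
  assert (0 <= (x - y) ^ 2) by apply pow2_ge_0.
  apply Rnot_lt_le; intros Hlt; assert ((x + y) ^ 2 < (2 * m) ^ 2); [|nra].
  nra.
Qed.

(** The order of choices is the point: the bound [theta] off the walls must be known before the
    number [N] of rings, then come [h] and the Lipschitz constant [L], and last the function [f].
    The estimate holds for all [H] near [g + f], so it survives later stages. *)
Lemma labyrinth_stage D (A B f3 : C -> C) n (c s s' m Q eps : R) (g g' : C -> C) :
  (forall z, in_dom D z -> continuous A z) -> (forall z, in_dom D z -> continuous B z) ->
  (forall z, in_dom D z -> (A z * B z)%C = (- (f3 z * f3 z))%C) ->
  (forall z, in_dom D z -> 0 < Cmod (A z) + Cmod (B z)) ->
  0 < c -> c <= s -> s < s' -> s' <= rad D n -> 0 < m ->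
  (forall z, s <= Cmod z <= s' -> m < Cmod (f3 z)) ->
  entire g g' -> 0 < eps ->
  exists f f', entire f f' /\
    (forall z, Cmod z <= s -> Cmod (f z) <= eps /\ Cmod (f' z) <= eps) /\
    exists (psi : C -> R) (T : R),
      (forall z, Cmod z <= s -> psi z <= T) /\ (forall z, s' <= Cmod z -> T + Q <= psi z) /\
      forall H : C -> C, (forall z, Cmod z <= s' -> Cmod (H z - (g z + f z)) <= 1) ->
        forall z, in_dom D z -> exists L eta, L < weight A B H z /\ 0 < eta /\
          forall w w', Cmod (w - z) < eta -> Cmod (w' - z) < eta ->
            Rabs (psi w' - psi w) <= L * Cmod (w' - w).
Proof.
  intros HA HB HAB Hpos Hc Hcs Hss Hn Hm Hf3 Hg He.
  assert (Hdom : forall z, Cmod z <= s' -> in_dom D z) by (intros; apply (rad_in_dom D n); lra).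
  assert (Hmod : forall z, in_dom D z -> Cmod (A z) * Cmod (B z) = Cmod (f3 z) ^ 2).
  { intros z Hz; rewrite <- Cmod_mult, (HAB z Hz), Cmod_opp, Cmod_mult; ring. }
  assert (HcA : forall z, in_dom D z -> continuous (fun z => Cmod (A z)) z)
    by (intros z Hz; apply (continuous_comp A Cmod); [apply HA, Hz|apply continuous_Cmod]).
  assert (HcB : forall z, in_dom D z -> continuous (fun z => Cmod (B z)) z)
    by (intros z Hz; apply (continuous_comp B Cmod); [apply HB, Hz|apply continuous_Cmod]).
  destruct (compact_pos_lower_bound (fun z => s <= Cmod z <= s') (fun z => Cmod (A z))) as [mA [HmA HmA']].
  { apply compact_annulus. }
  { intros z Hz; apply HcA, Hdom; lra. }
  { intros z Hz; apply Cmod_gt_0; intros E; specialize (Hf3 z Hz).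
    assert (Hz' : in_dom D z) by (apply Hdom; lra).
    specialize (Hmod z Hz'); rewrite E, Cmod_0 in Hmod; nra. }
  destruct (compact_pos_lower_bound (fun z => Cmod z <= s) (fun z => Cmod (A z) + Cmod (B z))) as [m1 [Hm1 Hm1']].
  { apply compact_disk. }
  { intros z Hz; apply continuous_Rplus; [apply HcA|apply HcB]; apply Hdom; lra. }
  { intros z Hz; apply Hpos, Hdom; lra. }
  destruct (compact_upper_bound (fun z => Cmod z <= s) (fun z => Cmod (g z))) as [G [HG HG']].
  { apply compact_disk. }
  { intros z _; apply (continuous_comp g Cmod); [|apply continuous_Cmod].
    eapply sd_continuous, Hg; exact I. }
  set (beta := G + eps + 1).
  (* The first entry bounds the conformal factor from below in the annulus off the walls, the second
     on the inner disk, where the potential still varies with [u]. *)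
  set (theta := Rmin m (exp (- beta) * (m1 / 2))).
  assert (Hth : 0 < theta).
  { apply Rmin_pos; trivial; apply Rmult_lt_0_compat; [apply exp_pos|lra]. }
  (* Each ring raises [theta * psi] by [2 * theta * c]; one such amount is lost to the variation on
     the inner disk. *)
  destruct (exists_nat_mult (Q + 2 * theta * c) (2 * theta * c)) as [N0 HN0].
  { apply Rmult_lt_0_compat; lra. }
  set (N := S N0).
  assert (HN : (0 < N)%nat) by (unfold N; lia).
  assert (HNR : 0 < INR N) by (apply lt_0_INR; trivial).
  assert (HQ : Q + 2 * theta * c <= INR N * (2 * theta * c)).
  { unfold N; rewrite S_INR; assert (0 < theta * c) by (apply Rmult_lt_0_compat; trivial); nra. }
  (* The odd denominator leaves a free margin [h] between the last ring and [s']. *)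
  set (h := (s' - s) / (2 * INR N + 1)).
  assert (Hh : 0 < h) by (apply Rdiv_lt_0_compat; lra).
  assert (Hhs : s + 2 * INR N * h = s' - h) by (unfold h; field; lra).
  destruct (labyrinth_potential c s h Hc Hh N HN) as (psi & L & HL & P1 & P2 & P3 & P4).
  (* By [weight_lower_A] this height makes the conformal factor exceed [theta * L] on the walls; the
     final 1 pays for the deviation of [H] from [g + f]. *)
  destruct (walls_function c s h Hc Hcs Hh g g' Hg N (2 * theta * L / mA + 1) eps He)
    as (f & f' & Hf & Hfs & Hfw).
  exists f, f'; split; [trivial|split; [trivial|]].
  exists (fun z => theta * psi z), (2 * theta * c); split; [|split].
  - intros z Hz; specialize (P3 z Hz); nra.
  - intros z Hz; rewrite P4 by lra; lra.
  - intros H HH z Hz.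
    (* From [s'] on nothing is known about [H], but the potential is locally constant there, so
       positivity of the conformal factor suffices. *)
    destruct (Rlt_le_dec (Cmod z) s') as [Hzs|Hzs].
    2: { exists 0, h; split; [|split; trivial].
      - rewrite weight_exp; specialize (Hpos z Hz).
        generalize (exp_pos (Re (H z))) (exp_pos (- Re (H z))) (Cmod_ge_0 (A z)) (Cmod_ge_0 (B z)); intros.
        assert (0 <= Cmod (A z) * exp (Re (H z))) by (apply Rmult_le_pos; lra).
        assert (0 <= Cmod (B z) * exp (- Re (H z))) by (apply Rmult_le_pos; lra).
        destruct (Rle_lt_or_eq_dec _ _ (Cmod_ge_0 (A z))) as [Ha|Ha].
        + assert (0 < Cmod (A z) * exp (Re (H z))) by (apply Rmult_lt_0_compat; lra); lra.
        + assert (0 < Cmod (B z) * exp (- Re (H z))) by (apply Rmult_lt_0_compat; lra); lra.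
      - assert (Hfar : forall w, Cmod (w - z) < h -> psi w = 2 * INR N * c).
        { intros w Hw; apply P4; generalize (Cmod_triangle_rev' z w); rewrite (Cmod_minus_sym z w); lra. }
        intros w w' Hw Hw'; rewrite !Hfar, Rminus_diag, Rabs_R0 by trivial; lra. }
    assert (HHz := HH z ltac:(lra)).
    destruct (classic (exists i, (i < N)%nat /\
      (s + (2 * INR i + 1) * h <= Cmod z <= s + (2 * INR i + 2) * h /\ sgn i * Re z <= c))) as [[i [Hi Hw]]|Hno].
    + exists (theta * L), 1; split; [|split; [lra|]].
      * eapply Rlt_le_trans; [|apply weight_lower_A].
        specialize (Hfw i z Hi Hw).
        assert (Hza : s <= Cmod z <= s').
        { split; [|lra]; destruct Hw as [[Hw _] _]; generalize (pos_INR i); intros; nra. }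
        specialize (HmA' z Hza).
        generalize (re_le_Cmod (H z - (g z + f z))); intros K; apply Rabs_le_between in K.
        assert (E : Re (H z - (g z + f z)) = Re (H z) - Re (g z + f z)) by (unfold Re; simpl; ring).
        rewrite E in K.
        assert (HRe : 2 * theta * L / mA <= Re (H z)) by lra.
        assert (HtL : 0 < theta * L) by (apply Rmult_lt_0_compat; trivial).
        assert (Hpos2 : 0 < 2 * theta * L / mA) by (apply Rdiv_lt_0_compat; lra).
        apply Rlt_le_trans with (mA * (1 + 2 * theta * L / mA) / 2).
        { replace (mA * (1 + 2 * theta * L / mA) / 2) with (mA / 2 + theta * L) by (field; lra); lra. }
        { assert (mA * (1 + 2 * theta * L / mA) <= Cmod (A z) * (1 + Re (H z))); [|lra].
          apply Rmult_le_compat; lra. }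
      * intros w w' _ _; rewrite <- Rmult_minus_distr_l, Rabs_mult, (Rabs_pos_eq theta), Rmult_assoc by lra.
        apply Rmult_le_compat_l; [lra|apply P1].
    + destruct (P2 z) as [eta [Heta Hloc]].
      { intros i Hi Hw; apply Hno; exists i; split; trivial. }
      exists theta, eta; split; [|split; trivial].
      * destruct (Rle_lt_dec s (Cmod z)) as [Hzs2|Hzs2].
        { apply Rle_lt_trans with m; [apply Rmin_l|].
          assert (Hfz := Hf3 z ltac:(lra)).
          apply Rlt_le_trans with (1 := Hfz), weight_lower_f3; [apply Cmod_ge_0|apply Hmod, Hz]. }
        { apply Rle_lt_trans with (exp (- beta) * (m1 / 2)); [apply Rmin_r|].
          apply Rlt_le_trans with (exp (- beta) * ((Cmod (A z) + Cmod (B z)) / 2)).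
          - apply Rmult_lt_compat_l; [apply exp_pos|]; specialize (Hm1' z ltac:(lra)); lra.
          - apply weight_lower_exp; unfold beta.
            destruct (Hfs z ltac:(lra)) as [Hfz _]; specialize (HG' z ltac:(lra)); simpl in HG'.
            generalize (Cmod_triangle_rev' (H z) (g z + f z)) (Cmod_triangle (g z) (f z)); lra. }
      * intros w w' Hw Hw'; rewrite <- Rmult_minus_distr_l, Rabs_mult, (Rabs_pos_eq theta) by lra.
        apply Rmult_le_compat_l; [lra|apply Hloc; trivial].
Qed.

(** * Limits of entire functions *)

Lemma half_pow_pos n : 0 < (1 / 2) ^ n.
Proof. apply pow_lt; lra. Qed.

Lemma half_pow_small e : 0 < e -> exists N, forall n, (N <= n)%nat -> (1 / 2) ^ n < e.
Proof.
  intros He; destruct (pow_lt_1_zero (1 / 2)) with (y := e) as [N HN]; trivial.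
  - rewrite Rabs_pos_eq; lra.
  - exists N; intros n Hn; specialize (HN n Hn).
    rewrite Rabs_pos_eq in HN by (left; apply half_pow_pos); trivial.
Qed.

Lemma geometric_limit (x : nat -> R) (e : R) (n : nat) : 0 < e ->
  (forall m k, (n <= m)%nat -> (m <= k)%nat -> Rabs (x k - x m) <= e * (1 / 2) ^ m) ->
  forall m, (n <= m)%nat -> Rabs (real (Lim_seq x) - x m) <= e * (1 / 2) ^ m.
Proof.
  intros He H.
  assert (Hex : ex_finite_lim_seq x).
  { apply ex_lim_seq_cauchy_corr; intros eps.
    destruct (half_pow_small (eps / (2 * e))) as [N HN].
    { apply Rdiv_lt_0_compat; [apply cond_pos|lra]. }
    set (N' := (n + N)%nat); exists N'; intros p q Hp Hq.
    assert (Hb : e * (1 / 2) ^ N' < eps / 2).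
    { apply Rlt_le_trans with (e * (eps / (2 * e))); [|right; field; lra].
      apply Rmult_lt_compat_l; trivial; apply HN; unfold N'; lia. }
    assert (K1 := H N' p ltac:(unfold N'; lia) Hp); assert (K2 := H N' q ltac:(unfold N'; lia) Hq).
    replace (x p - x q) with ((x p - x N') + - (x q - x N')) by ring.
    eapply Rle_lt_trans; [apply Rabs_triang|]; rewrite Rabs_Ropp; lra. }
  destruct Hex as [l Hl]; rewrite (is_lim_seq_unique _ _ Hl); simpl.
  intros m Hm; apply Rabs_le; split.
  - assert (Rbar_le (x m - e * (1 / 2) ^ m) l); [|simpl in *; lra].
    apply (is_lim_seq_le_loc (fun _ => x m - e * (1 / 2) ^ m) x); [|apply is_lim_seq_const|trivial].
    exists m; intros k Hk; specialize (H m k Hm Hk); apply Rabs_le_between in H; lra.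
  - assert (Rbar_le l (x m + e * (1 / 2) ^ m)); [|simpl in *; lra].
    apply (is_lim_seq_le_loc x (fun _ => x m + e * (1 / 2) ^ m)); [|trivial|apply is_lim_seq_const].
    exists m; intros k Hk; specialize (H m k Hm Hk); apply Rabs_le_between in H; lra.
Qed.

(** Total because [Lim_seq] is; the value is meaningful only when the sequence converges, which
    later means inside the domain. *)
Definition Clim (x : nat -> C) : C :=
  (real (Lim_seq (fun n => Re (x n))), real (Lim_seq (fun n => Im (x n)))).

Lemma Clim_geometric (x : nat -> C) (e : R) (n : nat) : 0 < e ->
  (forall m k, (n <= m)%nat -> (m <= k)%nat -> Cmod (x k - x m) <= e * (1 / 2) ^ m) ->
  forall m, (n <= m)%nat -> Cmod (Clim x - x m) <= 2 * e * (1 / 2) ^ m.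
Proof.
  intros He H m Hm; eapply Rle_trans; [apply Cmod_le_Re_Im|].
  assert (K1 := geometric_limit (fun n => Re (x n)) e n He).
  assert (K2 := geometric_limit (fun n => Im (x n)) e n He).
  apply Rle_trans with (e * (1 / 2) ^ m + e * (1 / 2) ^ m); [|lra].
  apply Rplus_le_compat; [apply K1|apply K2]; trivial; intros m' k' Hm' Hk';
   eapply Rle_trans; [|apply (H m' k' Hm' Hk')| |apply (H m' k' Hm' Hk')].
  - apply (re_le_Cmod (x k' - x m')).
  - apply (Im_le_Cmod (x k' - x m')).
Qed.

Lemma segment_in_disk w w' rho t : 0 <= t <= 1 -> Cmod w <= rho -> Cmod w' <= rho ->
  Cmod (w + t * (w' - w)) <= rho.
Proof.
  intros Ht Hw Hw'.
  replace (w + t * (w' - w))%C with ((1 - t)%R * w + t * w')%C by (rewrite RtoC_minus; ring).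
  eapply Rle_trans; [apply Cmod_triangle|]; rewrite !Cmod_mult, !Cmod_R_pos by lra; nra.
Qed.

Lemma lipschitz_of_derivative (f f' : C -> C) (rho M : R) :
  entire f f' -> (forall z, Cmod z <= rho -> Cmod (f' z) <= M) ->
  forall w w', Cmod w <= rho -> Cmod w' <= rho -> Cmod (f w' - f w) <= 2 * M * Cmod (w' - w).
Proof.
  intros Hf HM w w' Hw Hw'.
  assert (HD : forall t : R, D1 (fun t : R => f (w + t * (w' - w))%C) t (f' (w + t * (w' - w)) * (w' - w))%C).
  { intros t; apply (D1_comp f (fun t : R => w + t * (w' - w))%C); [apply Hf; exact I|apply D1_affine]. }
  assert (HB : forall t, 0 <= t <= 1 -> Cmod (f' (w + t * (w' - w)) * (w' - w))%C <= M * Cmod (w' - w)).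
  { intros t Ht; rewrite Cmod_mult; apply Rmult_le_compat_r; [apply Cmod_ge_0|].
    apply HM, segment_in_disk; trivial. }
  assert (HR : forall (g g' : R -> R), (forall t, is_derive g t (g' t)) ->
    (forall t, 0 <= t <= 1 -> Rabs (g' t) <= M * Cmod (w' - w)) -> Rabs (g 1 - g 0) <= M * Cmod (w' - w)).
  { intros g g' Hg Hg'; destruct (MVT_gen g 0 1 g') as [t [Ht E]].
    - intros; apply Hg.
    - intros t _; apply continuity_pt_filterlim, (ex_derive_continuous g t); eexists; apply Hg.
    - rewrite Rmin_left, Rmax_right in Ht by lra.
      rewrite E, Rminus_0_r, Rmult_1_r; apply Hg', Ht. }
  assert (E0 : (w + 0 * (w' - w))%C = w) by ring.
  assert (E1 : (w + 1 * (w' - w))%C = w') by ring.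
  assert (K1 := HR (fun t => Re (f (w + t * (w' - w))%C)) (fun t => Re (f' (w + t * (w' - w)) * (w' - w))%C)
     (fun t => proj1 (HD t)) (fun t Ht => Rle_trans _ _ _ (re_le_Cmod _) (HB t Ht))).
  assert (K2 := HR (fun t => Im (f (w + t * (w' - w))%C)) (fun t => Im (f' (w + t * (w' - w)) * (w' - w))%C)
     (fun t => proj2 (HD t)) (fun t Ht => Rle_trans _ _ _ (Im_le_Cmod _) (HB t Ht))).
  simpl in K1, K2; rewrite E0, E1 in K1, K2.
  eapply Rle_trans; [apply Cmod_le_Re_Im|].
  replace (2 * M * Cmod (w' - w)) with (M * Cmod (w' - w) + M * Cmod (w' - w)) by ring.
  apply Rplus_le_compat; [exact K1|exact K2].
Qed.

Lemma le_of_geometric_error (x y k : R) (n : nat) : 0 < k ->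
  (forall m, (n <= m)%nat -> x <= y + k * (1 / 2) ^ m) -> x <= y.
Proof.
  intros Hk H; apply Rnot_lt_le; intros Hlt.
  destruct (half_pow_small ((x - y) / k)) as [N HN]; [apply Rdiv_lt_0_compat; lra|].
  specialize (H (n + N)%nat ltac:(lia)); specialize (HN (n + N)%nat ltac:(lia)).
  assert (k * (1 / 2) ^ (n + N) < k * ((x - y) / k)) by (apply Rmult_lt_compat_l; trivial).
  replace (k * ((x - y) / k)) with (x - y) in * by (field; lra); lra.
Qed.

Section Limit.

Variables (D : sdomain) (n0 : nat) (e : R) (g g' : nat -> C -> C).
Hypothesis He : 0 < e.
Hypothesis Hg : forall n, entire (g n) (g' n).
Let rd (n : nat) : R := rad D (n0 + n).
Hypothesis Hstep : forall n z, Cmod z <= rd n ->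
  Cmod (g (S n) z - g n z) <= e * (1 / 2) ^ S n /\ Cmod (g' (S n) z - g' n z) <= e * (1 / 2) ^ S n.

Lemma rd_le n m : (n <= m)%nat -> rd n <= rd m.
Proof. intros; apply rad_le; lia. Qed.

Lemma tail_bound n z : Cmod z <= rd n -> forall m k, (n <= m)%nat -> (m <= k)%nat ->
  Cmod (g k z - g m z) <= e * (1 / 2) ^ m /\ Cmod (g' k z - g' m z) <= e * (1 / 2) ^ m.
Proof.
  intros Hz m k Hm Hk.
  assert (Cmod (g k z - g m z) <= e * ((1 / 2) ^ m - (1 / 2) ^ k) /\
     Cmod (g' k z - g' m z) <= e * ((1 / 2) ^ m - (1 / 2) ^ k)).
  { induction Hk as [|k Hk IH].
    - rewrite !Cmod_self; lra.
    - destruct (Hstep k z) as [K1 K2]; [generalize (rd_le n k ltac:(lia)); lra|].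
      simpl pow in *; split.
      + replace (g (S k) z - g m z)%C with ((g (S k) z - g k z) + (g k z - g m z))%C by ring.
        eapply Rle_trans; [apply Cmod_triangle|]; lra.
      + replace (g' (S k) z - g' m z)%C with ((g' (S k) z - g' k z) + (g' k z - g' m z))%C by ring.
        eapply Rle_trans; [apply Cmod_triangle|]; lra. }
  assert (0 < e * (1 / 2) ^ k) by (apply Rmult_lt_0_compat; [|apply half_pow_pos]; trivial); lra.
Qed.

Definition lim_fun (z : C) : C := Clim (fun n => g n z).
Definition lim_der (z : C) : C := Clim (fun n => g' n z).

Lemma lim_fun_close n m z : Cmod z <= rd n -> (n <= m)%nat ->
  Cmod (lim_fun z - g m z) <= 2 * e * (1 / 2) ^ m /\ Cmod (lim_der z - g' m z) <= 2 * e * (1 / 2) ^ m.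
Proof.
  intros Hz Hm; split.
  - apply (Clim_geometric (fun n => g n z) e n); trivial; intros; apply (tail_bound n); trivial.
  - apply (Clim_geometric (fun n => g' n z) e n); trivial; intros; apply (tail_bound n); trivial.
Qed.

(** The derivative bound for [g k - g m] becomes a Lipschitz bound, which passes to the limit in [k]
    without differentiating the limit. *)
Lemma tail_lipschitz n m w w' : (n <= m)%nat -> Cmod w <= rd n -> Cmod w' <= rd n ->
  Cmod ((lim_fun w' - g m w') - (lim_fun w - g m w)) <= 2 * (e * (1 / 2) ^ m) * Cmod (w' - w).
Proof.
  intros Hm Hw Hw'; apply (le_of_geometric_error _ _ (4 * e) m); [lra|].
  intros k Hk.
  destruct (lim_fun_close n k w Hw ltac:(lia)) as [K1 _], (lim_fun_close n k w' Hw' ltac:(lia)) as [K2 _].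
  assert (HL := lipschitz_of_derivative (fun z => g k z - g m z)%C (fun z => g' k z - g' m z)%C (rd n)
     (e * (1 / 2) ^ m) (holo_minus _ _ _ _ _ (Hg k) (Hg m))
     (fun z Hz => proj2 (tail_bound n z Hz m k Hm Hk)) w w' Hw Hw').
  simpl in HL.
  replace (lim_fun w' - g m w' - (lim_fun w - g m w))%C with
    ((g k w' - g m w' - (g k w - g m w)) + (lim_fun w' - g k w') - (lim_fun w - g k w))%C by ring.
  eapply Rle_trans; [apply Cmod_triangle_minus|].
  generalize (Cmod_triangle (g k w' - g m w' - (g k w - g m w)) (lim_fun w' - g k w')).
  intros; lra.
Qed.

Lemma holo_limit : holo D lim_fun lim_der.
Proof.
  intros z Hz; destruct (in_dom_rad D z Hz) as [n Hn].
  assert (Hn' : Cmod z < rd n) by (apply Rlt_le_trans with (1 := Hn), rad_le; lia).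
  assert (Hnear : forall w, Cmod (w - z) < rd n - Cmod z -> Cmod w <= rd n).
  { intros w Hw; generalize (Cmod_triangle_rev' w z); lra. }
  split.
  - intros eps Heps.
    destruct (half_pow_small (eps / (8 * e))) as [N HN]; [apply Rdiv_lt_0_compat; lra|].
    set (m := (n + N)%nat); assert (Hm := HN m ltac:(unfold m; lia)); clear HN.
    assert (Hm2 : e * (1 / 2) ^ m < eps / 8).
    { apply Rlt_le_trans with (e * (eps / (8 * e))); [apply Rmult_lt_compat_l; trivial|right; field; lra]. }
    destruct (proj1 (Hg m z I) (eps / 2)) as [eta [Heta Hw]]; [lra|].
    exists (Rmin eta (rd n - Cmod z)); split; [apply Rmin_pos; lra|].
    intros w w' H1 H2; generalize (Rmin_l eta (rd n - Cmod z)) (Rmin_r eta (rd n - Cmod z)); intros.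
    assert (K1 := Hw w w' ltac:(lra) ltac:(lra)).
    assert (K2 := tail_lipschitz n m w w' ltac:(unfold m; lia) (Hnear w ltac:(lra)) (Hnear w' ltac:(lra))).
    destruct (lim_fun_close n m z ltac:(lra) ltac:(unfold m; lia)) as [_ K3].
    replace (lim_fun w' - lim_fun w - lim_der z * (w' - w))%C with
      ((lim_fun w' - g m w' - (lim_fun w - g m w)) + (g m w' - g m w - g' m z * (w' - w))
       - (lim_der z - g' m z) * (w' - w))%C by ring.
    eapply Rle_trans; [apply Cmod_triangle_minus|].
    eapply Rle_trans; [apply Rplus_le_compat_r, Cmod_triangle|].
    rewrite (Cmod_mult (lim_der z - g' m z)).
    generalize (Cmod_ge_0 (w' - w)); intros Hd.
    assert (Cmod (lim_der z - g' m z) * Cmod (w' - w) <= 2 * e * (1 / 2) ^ m * Cmod (w' - w))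
      by (apply Rmult_le_compat_r; trivial).
    assert (e * (1 / 2) ^ m * Cmod (w' - w) <= eps / 8 * Cmod (w' - w))
      by (apply Rmult_le_compat_r; lra).
    lra.
  - apply continuous_C_eps; intros eps Heps.
    destruct (half_pow_small (eps / (8 * e))) as [N HN]; [apply Rdiv_lt_0_compat; lra|].
    set (m := (n + N)%nat); assert (Hm := HN m ltac:(unfold m; lia)); clear HN.
    assert (Hm2 : e * (1 / 2) ^ m < eps / 8).
    { apply Rlt_le_trans with (e * (eps / (8 * e))); [apply Rmult_lt_compat_l; trivial|right; field; lra]. }
    destruct (proj1 (continuous_C_eps _ _) (proj2 (Hg m z I)) (eps / 4)) as [eta [Heta Hw]]; [lra|].
    exists (Rmin eta (rd n - Cmod z)); split; [apply Rmin_pos; lra|].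
    intros w H1; generalize (Rmin_l eta (rd n - Cmod z)) (Rmin_r eta (rd n - Cmod z)); intros.
    assert (K1 := Hw w ltac:(lra)).
    destruct (lim_fun_close n m z ltac:(lra) ltac:(unfold m; lia)) as [_ K2].
    destruct (lim_fun_close n m w (Hnear w ltac:(lra)) ltac:(unfold m; lia)) as [_ K3].
    replace (lim_der w - lim_der z)%C with
      ((g' m w - g' m z) + (lim_der w - g' m w) - (lim_der z - g' m z))%C by ring.
    eapply Rle_lt_trans; [apply Cmod_triangle_minus|].
    eapply Rle_lt_trans; [apply Rplus_le_compat_r, Cmod_triangle|]; lra.
Qed.

End Limit.

(** * The complete metric *)

(** A certificate that a curve going from the disk of radius [r] to beyond [r'] has length at least
    [Q]: a potential rising by [Q] whose local Lipschitz constants lie below the conformal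
    factor. *)
Definition crossing (D : sdomain) (A B H : C -> C) (r r' Q : R) : Prop :=
  exists (psi : C -> R) (T : R),
    (forall z, Cmod z <= r -> psi z <= T) /\ (forall z, r' <= Cmod z -> T + Q <= psi z) /\
    forall z, in_dom D z -> exists L eta, L < weight A B H z /\ 0 < eta /\
      forall w w', Cmod (w - z) < eta -> Cmod (w' - z) < eta ->
        Rabs (psi w' - psi w) <= L * Cmod (w' - w).

(** Partial sums are built by dependent choice, stage [n] handling the annulus after
    [rad D (n0 + n)] and contributing a crossing of size [INR n]. *)
Lemma labyrinth_exponent D (A B f3 f3' : C -> C) n0 (e : R) :
  (forall z, in_dom D z -> continuous A z) -> (forall z, in_dom D z -> continuous B z) ->
  holo D f3 f3' -> (exists z, in_dom D z /\ f3 z <> 0) ->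
  (forall z, in_dom D z -> (A z * B z)%C = (- (f3 z * f3 z))%C) ->
  (forall z, in_dom D z -> 0 < Cmod (A z) + Cmod (B z)) ->
  0 < e <= 1 / 2 ->
  exists H H', holo D H H' /\ (forall z, Cmod z <= rad D n0 -> Cmod (H z) <= 2 * e) /\
    forall n, crossing D A B H (rad D (n0 + n)) (rad D (n0 + S n)) (INR n).
Proof.
  intros HA HB Hf3 Hne HAB Hpos He.
  set (Rel := fun (n : nat) (p q : {p : (C -> C) * (C -> C) | entire (fst p) (snd p)}) =>
    (forall z, Cmod z <= rad D (n0 + n) ->
       Cmod (fst (proj1_sig q) z - fst (proj1_sig p) z) <= e * (1 / 2) ^ S n /\
       Cmod (snd (proj1_sig q) z - snd (proj1_sig p) z) <= e * (1 / 2) ^ S n) /\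
    forall H, (forall z, Cmod z <= rad D (n0 + S n) -> Cmod (H z - fst (proj1_sig q) z) <= 1) ->
      crossing D A B H (rad D (n0 + n)) (rad D (n0 + S n)) (INR n)).
  assert (Hex : forall n p, exists q, Rel n p q).
  { intros n [[g g'] Hg]; simpl in Hg.
    destruct (nonvanishing_annulus D f3 f3' (n0 + S n) (rad D (n0 + n)) (rad D (n0 + S n)))
      as (s & s' & m & H1 & H2 & H3 & Hm & Hmf); trivial; [apply rad_lt; lia|lra|].
    (* The same abscissa [rad D 0] serves in all stages: it is positive and never exceeds the inner
       radius [s]. *)
    destruct (labyrinth_stage D A B f3 (n0 + S n) (rad D 0) s s' m (INR n) (e * (1 / 2) ^ S n) g g')
      as (f & f' & Hf & Hfs & psi & T & P1 & P2 & P3); trivial; try lra.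
    - apply rad_pos.
    - generalize (rad_le D 0 (n0 + n) ltac:(lia)); lra.
    - apply Rmult_lt_0_compat; [lra|apply half_pow_pos].
    - assert (Hgf : entire (fun z => g z + f z)%C (fun z => g' z + f' z)%C) by (apply holo_plus; trivial).
      exists (exist _ (fun z => g z + f z, fun z => g' z + f' z)%C Hgf); split; simpl.
      + intros z Hz; destruct (Hfs z ltac:(lra)) as [K1 K2]; simpl pow in *; split.
        * replace (g z + f z - g z)%C with (f z) by ring; trivial.
        * replace (g' z + f' z - g' z)%C with (f' z) by ring; trivial.
      + intros H HH; exists psi, T; split; [|split].
        * intros z Hz; apply P1; lra.
        * intros z Hz; apply P2; lra.
        * apply P3; intros z Hz; apply HH; lra. }
  pose (next := fun n p => proj1_sig (constructive_indefinite_description _ (Hex n p))).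
  assert (Hnext : forall n p, Rel n p (next n p))
    by (intros n p; unfold next; destruct (constructive_indefinite_description _ (Hex n p)); trivial).
  pose (sq := fix sq (n : nat) := match n with
    | O => exist _ (fun _ => RtoC 0, fun _ => RtoC 0) (entire_const 0)
    | S n => next n (sq n) end : {p : (C -> C) * (C -> C) | entire (fst p) (snd p)}).
  pose (g := fun n => fst (proj1_sig (sq n))); pose (g' := fun n => snd (proj1_sig (sq n))).
  assert (Hg : forall n, entire (g n) (g' n)) by (intros n; apply (proj2_sig (sq n))).
  assert (Hstep : forall n z, Cmod z <= rad D (n0 + n) ->
    Cmod (g (S n) z - g n z) <= e * (1 / 2) ^ S n /\ Cmod (g' (S n) z - g' n z) <= e * (1 / 2) ^ S n).
  { intros n z Hz; apply (Hnext n (sq n)), Hz. }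
  assert (Hclose := lim_fun_close D n0 e g g' (proj1 He) Hstep).
  exists (lim_fun g), (lim_der g'); split; [|split].
  - apply (holo_limit D n0 e g g' (proj1 He) Hg Hstep).
  - intros z Hz; destruct (Hclose 0%nat 0%nat z) as [K _]; [rewrite Nat.add_0_r; trivial|lia|].
    replace (lim_fun g z) with (lim_fun g z - g 0%nat z)%C by (unfold g; simpl; ring).
    simpl in K; lra.
  - intros n; apply (Hnext n (sq n)); intros z Hz.
    (* All later stages together move the exponent by at most [2 * e * (1 / 2) ^ S n], within the
       deviation 1 allowed by stage [n]. *)
    destruct (Hclose (S n) (S n) z Hz ltac:(lia)) as [K _].
    apply Rle_trans with (1 := K).
    assert (Hp : (1 / 2) ^ n <= 1) by (apply Rle_trans with (1 ^ n); [apply pow_incr; lra|rewrite pow1; lra]).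
    assert (Hp0 := half_pow_pos n); simpl; nra.
Qed.

Lemma continuous_curve_Cmod (gamma : R -> C) t eta : continuous gamma t -> 0 < eta ->
  exists d, 0 < d /\ forall s, Rabs (s - t) < d -> Cmod (gamma s - gamma t) < eta.
Proof.
  intros Hc Heta.
  destruct (Hc (fun w => Cmod (w - gamma t) < eta)) as [d Hd].
  - apply locally_Cmod; exists eta; split; trivial.
  - exists d; split; [apply cond_pos|]; intros s Hs; apply Hd, Hs.
Qed.

(** A single crossing beats any given [M], so no lengths need to be added up: a divergent curve
    crosses every annulus far enough out. *)
Lemma complete_of_crossings D (A B H : C -> C) (Y : C -> R3) n0 :
  (forall n, crossing D A B H (rad D (n0 + n)) (rad D (n0 + S n)) (INR n)) ->
  (forall z L, in_dom D z -> L < weight A B H z ->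
     exists eta, 0 < eta /\ forall w w', Cmod (w - z) < eta -> Cmod (w' - z) < eta ->
       L * Cmod (w' - w) <= norm3 (sub3 (Y w') (Y w))) ->
  complete_on (in_dom D) Y.
Proof.
  intros Hcr HY gamma [Hg Hdiv] M.
  destruct (Hg 0) as [Hg0 _]; [lra|].
  destruct (in_dom_rad D _ Hg0) as [k Hk], (INR_unbounded M) as [N HN].
  (* At least [k] so that the curve starts inside the inner circle, at least [N] so that the
     crossing is longer than [M]. *)
  set (n := (k + N)%nat).
  assert (HnM : M < INR n) by (apply Rlt_le_trans with (1 := HN), le_INR; unfold n; lia).
  destruct (Hcr n) as (psi & T & P1 & P2 & P3).
  destruct (Hdiv (fun z => Cmod z <= rad D (n0 + S n))) as [t0 [Ht0 Hout]].
  { apply compact_disk. }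
  { intros z; apply rad_in_dom. }
  (* The time given by divergence may be negative. *)
  set (t1 := Rmax 0 t0).
  assert (Ht1 : 0 <= t1 < 1) by (unfold t1; split; [apply Rmax_l|apply Rmax_lub_lt; lra]).
  destruct (poly_len_lower_bound (fun t => Y (gamma t)) (fun t => psi (gamma t)) t1) as (l & L1 & L2 & L3).
  - lra.
  - intros t Ht; destruct (Hg t) as [Hgt Hct]; [lra|].
    destruct (P3 _ Hgt) as (L & eta & HL & Heta & Hloc).
    destruct (HY _ L Hgt HL) as [eta' [Heta' Hloc']].
    destruct (continuous_curve_Cmod gamma t (Rmin eta eta') Hct) as [d [Hd Hgd]]; [apply Rmin_pos; trivial|].
    exists d; split; trivial; intros s s' Hs Hs'.
    generalize (Hgd s Hs) (Hgd s' Hs') (Rmin_l eta eta') (Rmin_r eta eta'); intros.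
    eapply Rle_trans; [apply Rle_abs|].
    eapply Rle_trans; [apply Hloc; lra|apply Hloc'; lra].
  - exists 0, l; split; [lra|split; [trivial|split]].
    + eapply Forall_impl; [|exact L2]; simpl; intros; lra.
    + assert (psi (gamma 0) <= T).
      { apply P1; left; apply Rlt_le_trans with (1 := Hk), rad_le; unfold n; lia. }
      assert (T + INR n <= psi (gamma t1)).
      { apply P2; left; apply Rnot_le_lt, Hout; unfold t1; split; [apply Rmax_r|apply Ht1]. }
      lra.
Qed.

(** * Closeness to the given immersion, and the conclusion *)

Lemma norm3_le p : norm3 p <= Rabs (x1 p) + Rabs (x2 p) + Rabs (x3 p).
Proof.
  generalize (norm3_sq p) (norm3_ge_0 p) (Rabs_pos (x1 p)) (Rabs_pos (x2 p)) (Rabs_pos (x3 p)).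
  rewrite <- (pow2_abs (x1 p)), <- (pow2_abs (x2 p)), <- (pow2_abs (x3 p)); intros; nra.
Qed.

Lemma close_of_dz D (g k : C -> R) n (m : R) :
  C1_on (in_dom D) g -> C1_on (in_dom D) k -> g 0 = k 0 ->
  (forall z, Cmod z <= rad D n -> Cmod (dz g z - dz k z) <= m) ->
  forall z, Cmod z <= rad D n -> Rabs (g z - k z) <= 2 * rad D n * m.
Proof.
  intros Hg Hk H0 Hm z Hz.
  replace (g z - k z) with ((g z - k z) - (g 0 - k 0)) by (rewrite H0; ring).
  apply (mean_value_disk (fun z => g z - k z) (fun z => pu g z - pu k z) (fun z => pv g z - pv k z) (rad D n));
   trivial.
  - intros w Hw; assert (Hd := rad_in_dom D n w Hw).
    destruct (Hg w Hd) as (G1 & G2 & _), (Hk w Hd) as (K1 & K2 & _); split.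
    + apply (is_derive_minus (fun t => g (t, snd w)) (fun t => k (t, snd w))); apply Derive_correct; trivial.
    + apply (is_derive_minus (fun t => g (fst w, t)) (fun t => k (fst w, t))); apply Derive_correct; trivial.
  - intros w Hw; specialize (Hm w Hw); split; eapply Rle_trans; [|exact Hm| |exact Hm].
    + eapply Rle_trans; [|apply re_le_Cmod]; right; f_equal.
    + rewrite <- Rabs_Ropp; eapply Rle_trans; [|apply Im_le_Cmod]; right; f_equal; unfold dz, Im; simpl; ring.
Qed.

Lemma pu_const (c : R) z : pu (fun _ => c) z = 0.
Proof. unfold pu; apply Derive_const. Qed.

Lemma pv_const (c : R) z : pv (fun _ => c) z = 0.
Proof. unfold pv; apply Derive_const. Qed.

Lemma dz_const (c : R) z : dz (fun _ => c) z = 0.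
Proof. unfold dz; rewrite pu_const, pv_const; apply C_ext; simpl; ring. Qed.

Lemma C1_on_const S (c : R) : C1_on S (fun _ => c).
Proof.
  intros z _; split; [|split; [|split; [|split]]].
  - exists 0; apply (is_derive_const c (fst z)).
  - exists 0; apply (is_derive_const c (snd z)).
  - apply continuous_const.
  - apply (continuous_ext (fun _ => 0)); [intros; symmetry; apply pu_const|apply continuous_const].
  - apply (continuous_ext (fun _ => 0)); [intros; symmetry; apply pv_const|apply continuous_const].
Qed.

Lemma Cprimitive_0 F : Cprimitive F 0 = 0.
Proof.
  unfold Cprimitive; transitivity (CInt (fun _ => RtoC 0) 0 1).
  - apply CInt_ext; [lra|]; intros; ring.
  - apply C_ext; simpl; rewrite RInt_const; unfold scal; simpl; unfold mult; simpl; ring.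
Qed.

Lemma Cexp_near_1 e : 0 < e -> exists d, 0 < d /\ forall h, Cmod h < d -> Cmod (Cexp h - 1) < e.
Proof.
  intros He; destruct (proj1 (continuous_C_eps _ _) (continuous_Cexp 0) e He) as [d [Hd H]].
  exists d; split; trivial; intros h Hh; rewrite <- Cexp_0; apply H.
  replace (h - 0)%C with h by ring; trivial.
Qed.

Theorem theorem1p1 (D : sdomain) (X : C -> R3) (K : C -> Prop) (eps : R) :
  conformal_minimal_immersion (in_dom D) X ->
  ~ (exists c : R, forall z, in_dom D z -> x3 (X z) = c) ->
  (forall z, K z -> in_dom D z) -> compact_set K -> 0 < eps ->
  exists Y : C -> R3,
    conformal_minimal_immersion (in_dom D) Y /\ complete_on (in_dom D) Y /\
    (forall z, K z -> norm3 (sub3 (X z) (Y z)) < eps) /\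
    (forall z, in_dom D z -> x3 (X z) = x3 (Y z)).
Proof.
  intros HX Hnc HKD HK Heps.
  assert (HX' := HX); destruct HX' as (_ & Hh1 & Hh2 & Hh3).
  set (f1 := dz (fun z => x1 (X z))); set (f2 := dz (fun z => x2 (X z))); set (f3 := dz (fun z => x3 (X z))).
  assert (Hf1 := holo_of_harmonic D _ Hh1); assert (Hf2 := holo_of_harmonic D _ Hh2).
  assert (Hf3 := holo_of_harmonic D _ Hh3); fold f1 f2 f3 in Hf1, Hf2, Hf3.
  set (A := fun z => (f1 z - Ci * f2 z)%C); set (B := fun z => (f1 z + Ci * f2 z)%C).
  assert (HA := holo_minus _ _ _ _ _ Hf1 (holo_scal _ Ci _ _ Hf2)); fold A in HA.
  assert (HB := holo_plus _ _ _ _ _ Hf1 (holo_scal _ Ci _ _ Hf2)); fold B in HB.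
  assert (HcA : forall z, in_dom D z -> continuous A z) by (intros z Hz; eapply sd_continuous, HA, Hz).
  assert (HcB : forall z, in_dom D z -> continuous B z) by (intros z Hz; eapply sd_continuous, HB, Hz).
  assert (HCi : (Ci * Ci)%C = (- (1))%C) by (apply C_ext; unfold Re, Im; simpl; ring).
  assert (HAB : forall z, in_dom D z -> (A z * B z)%C = (- (f3 z * f3 z))%C).
  { intros z Hz; destruct (isotropic_of_immersion D X z HX Hz) as [Hiso _].
    fold f1 f2 f3 in Hiso; unfold A, B.
    transitivity (f1 z * f1 z - Ci * Ci * (f2 z * f2 z))%C; [ring|rewrite HCi].
    transitivity (f1 z * f1 z + f2 z * f2 z + f3 z * f3 z - f3 z * f3 z)%C; [ring|].
    rewrite Hiso; ring. }
  assert (Hpos : forall z, in_dom D z -> 0 < Cmod (A z) + Cmod (B z)).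
  { intros z Hz; apply (isotropic_of_immersion D X z HX Hz). }
  (* If [f3] vanished everywhere, [close_of_dz] with error 0 would make the third coordinate
     constant. *)
  assert (Hne : exists z, in_dom D z /\ f3 z <> 0).
  { apply NNPP; intros Hno; apply Hnc; exists (x3 (X 0)); intros z Hz.
    destruct (in_dom_rad D z Hz) as [n Hn].
    assert (Hb := close_of_dz D (fun z => x3 (X z)) (fun _ => x3 (X 0)) n 0).
    assert (Rabs (x3 (X z) - x3 (X 0)) <= 2 * rad D n * 0).
    { apply Hb; trivial; [apply Hh3| | |lra].
      - apply C1_on_const.
      - intros w Hw; fold f3; rewrite dz_const.
        assert (E : f3 w = 0).
        { apply NNPP; intros Hw0; apply Hno; exists w; split; trivial; apply (rad_in_dom D n w Hw). }
        rewrite E, Cmod_self; lra. }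
    generalize (Rabs_pos (x3 (X z) - x3 (X 0))); intros.
    assert (E : Rabs (x3 (X z) - x3 (X 0)) = 0) by lra.
    destruct (Req_dec (x3 (X z) - x3 (X 0)) 0) as [E0|E0]; [lra|]; apply Rabs_no_R0 in E0; lra. }
  destruct (compact_in_rad D K HK HKD) as [n0 Hn0].
  set (rho := rad D n0); assert (Hrho : 0 < rho) by apply rad_pos.
  destruct (compact_upper_bound (fun z => Cmod z <= rho) (fun z => Cmod (A z) + Cmod (B z))) as [M [HM HM']].
  { apply compact_disk. }
  { intros z Hz; assert (Hd := rad_in_dom D n0 z Hz); apply continuous_Rplus.
    - apply (continuous_comp A Cmod); [apply HcA, Hd|apply continuous_Cmod].
    - apply (continuous_comp B Cmod); [apply HcB, Hd|apply continuous_Cmod]. }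
  (* Each of the two altered coordinates then moves by at most [2 * rho * (M * e1) = eps / 4]. *)
  set (e1 := eps / (8 * rho * M)).
  assert (He1 : 0 < e1).
  { apply Rdiv_lt_0_compat; trivial; apply Rmult_lt_0_compat; lra. }
  destruct (Cexp_near_1 e1 He1) as [d [Hd Hexp]].
  (* [1 / 2] is the bound asked for by the construction; [d / 4] gives [Cmod (H z) <= d / 2], inside
     the range of [Cexp_near_1]. *)
  destruct (labyrinth_exponent D A B f3 (dz' (fun z => x3 (X z))) n0 (Rmin (1 / 2) (d / 4)))
    as (H & H' & HH & Hsmall & Hcross); trivial.
  { split; [apply Rmin_pos; lra|apply Rmin_l]. }
  assert (HaE := holo_mult_exp _ _ _ _ _ HA HH).
  assert (HHn := holo_scal _ (- (1))%C _ _ HH).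
  assert (HbE := holo_mult_exp _ _ _ _ _ HB HHn).
  set (a := fun z => (A z * Cexp (H z))%C) in *; fold a in HaE.
  set (b := fun z => (B z * Cexp (- (1) * H z))%C) in *.
  assert (Hb : forall z, b z = (B z * Cexp (- H z))%C) by (intros z; unfold b; do 2 f_equal; ring).
  assert (Hab : forall z, in_dom D z -> (a z * b z)%C = (- (f3 z * f3 z))%C).
  { intros z Hz; rewrite Hb; unfold a; rewrite <- (HAB z Hz).
    transitivity (A z * B z * (Cexp (H z) * Cexp (- H z)))%C; [ring|rewrite Cexp_opp; ring]. }
  assert (H2c : RtoC 2 <> 0) by (intros E; apply RtoC_inj in E; lra).
  assert (HF1 := holo_scal _ (/ 2)%C _ _ (holo_plus _ _ _ _ _ HaE HbE)).
  assert (HF2 := holo_scal _ (Ci / 2)%C _ _ (holo_minus _ _ _ _ _ HaE HbE)).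
  (* These solve [F1 - Ci * F2 = a] and [F1 + Ci * F2 = b]. *)
  set (F1 := fun z => (/ 2 * (a z + b z))%C) in *; set (F2 := fun z => (Ci / 2 * (a z - b z))%C) in *.
  assert (HP : forall F F' (c : R), holo D F F' ->
    forall z, in_dom D z -> sd (fun z => c + Cprimitive F z)%C z (F z)).
  { intros F F' c HF z Hz; eapply sd_eq; [apply sd_plus; [apply sd_const|apply (sd_primitive D F F' z HF Hz)]|ring]. }
  destruct (harmonic_Re D _ _ _ (HP F1 _ (x1 (X 0)) HF1) HF1) as [G1 D1'].
  destruct (harmonic_Re D _ _ _ (HP F2 _ (x2 (X 0)) HF2) HF2) as [G2 D2'].
  (* The constants make [X] and [Y] agree at 0, from where [close_of_dz] integrates the difference
     of the data. *)
  set (Y := fun z => ((Re (x1 (X 0) + Cprimitive F1 z)%C, Re (x2 (X 0) + Cprimitive F2 z)%C), x3 (X z)) : R3).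
  assert (E1 : forall z, in_dom D z -> dz (fun z => x1 (Y z)) z = F1 z).
  { intros z Hz; destruct (D1' z Hz) as [Q1 Q2]; apply C_ext; [exact Q1|].
    transitivity (- pv (fun z => Re (x1 (X 0) + Cprimitive F1 z)%C) z); [reflexivity|rewrite Q2; ring]. }
  assert (E2 : forall z, in_dom D z -> dz (fun z => x2 (Y z)) z = F2 z).
  { intros z Hz; destruct (D2' z Hz) as [Q1 Q2]; apply C_ext; [exact Q1|].
    transitivity (- pv (fun z => Re (x2 (X 0) + Cprimitive F2 z)%C) z); [reflexivity|rewrite Q2; ring]. }
  assert (E3 : forall z, in_dom D z -> dz (fun z => x3 (Y z)) z = f3 z) by reflexivity.
  assert (Ea : forall z, (F1 z - Ci * F2 z)%C = a z).
  { intros z; unfold F1, F2.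
    transitivity (/ 2 * (a z + b z) - Ci * Ci / 2 * (a z - b z))%C; [field; trivial|rewrite HCi; field; trivial]. }
  assert (Eb : forall z, (F1 z + Ci * F2 z)%C = b z).
  { intros z; unfold F1, F2.
    transitivity (/ 2 * (a z + b z) + Ci * Ci / 2 * (a z - b z))%C; [field; trivial|rewrite HCi; field; trivial]. }
  assert (Hiso : forall z, in_dom D z -> (F1 z * F1 z + F2 z * F2 z + f3 z * f3 z)%C = 0).
  { intros z Hz.
    transitivity ((F1 z - Ci * F2 z) * (F1 z + Ci * F2 z) + (1 + Ci * Ci) * (F2 z * F2 z) + f3 z * f3 z)%C; [ring|].
    rewrite Ea, Eb, (Hab z Hz), HCi; ring. }
  assert (HposY : forall z, in_dom D z -> 0 < Cmod (F1 z - Ci * F2 z) + Cmod (F1 z + Ci * F2 z)).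
  { intros z Hz; rewrite Ea, Eb, Hb; unfold a; rewrite !Cmod_mult, !Cmod_Cexp.
    specialize (Hpos z Hz).
    generalize (exp_pos (Re (H z))) (exp_pos (Re (- H z))) (Cmod_ge_0 (A z)) (Cmod_ge_0 (B z)); intros.
    destruct (Rle_lt_or_eq_dec _ _ (Cmod_ge_0 (A z))); nra. }
  exists Y; split; [|split; [|split]].
  - apply (weierstrass_immersion D Y F1 F2 f3); trivial.
  - apply (complete_of_crossings D A B H Y n0 Hcross).
    intros z L Hz HL; apply (weierstrass_lower_bound D Y F1 F2 f3); trivial.
    rewrite Ea, Eb, Hb; exact HL.
  - assert (Hex : forall z, Cmod z <= rho -> Cmod (Cexp (H z) - 1) < e1 /\ Cmod (Cexp (- H z) - 1) < e1).
    { intros z Hz; specialize (Hsmall z Hz).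
      assert (Hq := Rmin_r (1 / 2) (d / 4)).
      split; apply Hexp; rewrite ?Cmod_opp; lra. }
    assert (Hdiff : forall z, Cmod z <= rho ->
      Cmod (a z - A z) + Cmod (b z - B z) <= M * e1).
    { intros z Hz; destruct (Hex z Hz) as [Q1 Q2]; specialize (HM' z Hz); simpl in HM'.
      replace (a z - A z)%C with (A z * (Cexp (H z) - 1))%C by (unfold a; ring).
      replace (b z - B z)%C with (B z * (Cexp (- H z) - 1))%C by (rewrite Hb; ring).
      rewrite !Cmod_mult.
      assert (Cmod (A z) * Cmod (Cexp (H z) - 1) <= Cmod (A z) * e1)
        by (apply Rmult_le_compat_l; [apply Cmod_ge_0|lra]).
      assert (Cmod (B z) * Cmod (Cexp (- H z) - 1) <= Cmod (B z) * e1)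
        by (apply Rmult_le_compat_l; [apply Cmod_ge_0|lra]).
      nra. }
    assert (Hhalf : Cmod (/ 2) = / 2) by (rewrite Cmod_inv, Cmod_R_pos by (trivial; lra); trivial).
    assert (C1 : forall z, Cmod z <= rho -> Rabs (x1 (X z) - x1 (Y z)) <= 2 * rho * (M * e1)).
    { apply (close_of_dz D (fun z => x1 (X z)) (fun z => x1 (Y z)) n0); trivial.
      - apply Hh1.
      - apply G1.
      - change (x1 (X 0) = Re (x1 (X 0) + Cprimitive F1 0)%C); rewrite Cprimitive_0; unfold Re; simpl; ring.
      - intros z Hz; rewrite E1 by (apply (rad_in_dom D n0), Hz); fold f1; specialize (Hdiff z Hz).
        replace (f1 z - F1 z)%C with (/ 2 * - ((a z - A z) + (b z - B z)))%C
          by (unfold F1, A, B; field; trivial).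
        rewrite Cmod_mult, Cmod_opp, Hhalf.
        generalize (Cmod_triangle (a z - A z) (b z - B z)) (Cmod_ge_0 (a z - A z + (b z - B z))); lra. }
    assert (C2 : forall z, Cmod z <= rho -> Rabs (x2 (X z) - x2 (Y z)) <= 2 * rho * (M * e1)).
    { apply (close_of_dz D (fun z => x2 (X z)) (fun z => x2 (Y z)) n0); trivial.
      - apply Hh2.
      - apply G2.
      - change (x2 (X 0) = Re (x2 (X 0) + Cprimitive F2 0)%C); rewrite Cprimitive_0; unfold Re; simpl; ring.
      - intros z Hz; rewrite E2 by (apply (rad_in_dom D n0), Hz); fold f2; specialize (Hdiff z Hz).
        replace (f2 z - F2 z)%C with (Ci * (/ 2 * - ((a z - A z) - (b z - B z))))%C.
        + rewrite !Cmod_mult, Cmod_opp, Hhalf, Cmod_Ci.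
          generalize (Cmod_triangle_minus (a z - A z) (b z - B z)) (Cmod_ge_0 (a z - A z - (b z - B z))); lra.
        + unfold F2, A, B.
          transitivity (- (Ci * Ci) * f2 z - Ci / 2 * (a z - b z))%C; [field; trivial|rewrite HCi; ring]. }
    intros z Kz; assert (Hz : Cmod z <= rho) by (specialize (Hn0 z Kz); unfold rho; lra).
    specialize (C1 z Hz); specialize (C2 z Hz).
    eapply Rle_lt_trans; [apply norm3_le|].
    change (Rabs (x1 (X z) - x1 (Y z)) + Rabs (x2 (X z) - x2 (Y z)) + Rabs (x3 (X z) - x3 (X z)) < eps).
    rewrite (Rminus_diag (x3 (X z))), Rabs_R0.
    assert (2 * rho * (M * e1) = eps / 4) by (unfold e1; field; lra).
    lra.
  - reflexivity.
Qed.
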